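(* Let $\mathbf A,\mathbf B$ be dg-categories and let $G\colon \mathbf B\to\mathbf A$ be a quasi-functor. Then $G$ has a left adjoint quasi-functor if and only if $G$ is left quasi-representable.
   Context: Fix a commutative ring $\mathbf k$. A dg-category is a category (with a set of objects) enriched over cochain complexes of $\mathbf k$-modules; $\mathsf C_{dg}(\mathbf k)$ is the dg-category of complexes. For a dg-category $\mathbf A$, $\mathsf C_{dg}(\mathbf A)$ is the dg-category of right $\mathbf A$-dg-modules (dg-functors $\mathbf A^{op}\to \mathsf C_{dg}(\mathbf k)$); left $\mathbf A$-dg-modules are right $\mathbf A^{op}$-dg-modules. Put $\mathsf K(\mathbf A)=H^0(\mathsf C_{dg}(\mathbf A))$; quasi-isomorphisms and acyclicity are defined objectwise, and $\mathsf D(\mathbf A)$ is the localisation of $\mathsf K(\mathbf A)$ at quasi-isomorphisms. A dg-module $P$ is h-projective if $\mathsf K(\mathbf A)(P,N)=0$ for all acyclic $N$; $Q(M)\to M$ denotes a (functorial) h-projective resolution. Representables: $h_A=\mathbf A(-,A)$ (right module), $h^A=\mathbf A(A,-)$ (left module); the diagonal bimodule $h_{\mathbf A}$ is $(A,A')\mapsto \mathbf A(A,A')$. A dg-category is h-projective if all its hom-complexes are h-projective complexes of $\mathbf k$-modules; every dg-category $\mathbf A$ has an h-projective resolution (a quasi-equivalence $\mathbf A^{hp}\to\mathbf A$ with $\mathbf A^{hp}$ h-projective, which can be taken to be the identity on objects), and $\mathbf A\otimes^{\mathbb L}\mathbf B=\mathbf A^{hp}\otimes\mathbf B$ up to quasi-equivalence.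 Set $\mathsf D(\mathbf A,\mathbf B)=\mathsf D(\mathbf B\otimes^{\mathbb L}\mathbf A^{op})$. Convention: when working with $\mathsf D(\mathbf A,\mathbf B)$, dg-categories are identified with their h-projective resolutions, so an object $T\in\mathsf D(\mathbf A,\mathbf B)$ is a dg-bimodule $T\colon\mathbf B^{op}\otimes\mathbf A\to\mathsf C_{dg}(\mathbf k)$, covariant in $\mathbf A$ and contravariant in $\mathbf B$, with components $T_A=T(-,A)$ (right $\mathbf B$-module) and $T^B=T(B,-)$ (left $\mathbf A$-module). $T\in\mathsf D(\mathbf A,\mathbf B)$ is right quasi-representable if for every $A\in\mathbf A$ the right $\mathbf B$-module $T_A$ is quasi-isomorphic to $h_{F(A)}$ for some $F(A)\in\mathbf B$; it is left quasi-representable if for every $B\in\mathbf B$ the left $\mathbf A$-module $T^B$ is quasi-isomorphic to $h^{G(B)}$ for some $G(B)\in\mathbf A$. A quasi-functor $\mathbf A\to\mathbf B$ is a right quasi-representable object of $\mathsf D(\mathbf A,\mathbf B)$. Composition of bimodules $F$ ($\mathbf A$-$\mathbf B$) and $G$ ($\mathbf B$-$\mathbf C$) is the coend (tensor product over $\mathbf B$) $(G\diamond F)^C_A=\int^B F^B_A\otimes G^C_B$, i.e. the cokernel of $\bigoplus_{B_1,B_2}F^{B_2}_A\otimes\mathbf B(B_1,B_2)\otimes G^C_{B_1}\to\bigoplus_B F^B_A\otimes G^C_B$, $x\otimes f\otimes y\mapsto xf\otimes y-x\otimes fy$; its derived version is $G\diamond^{\mathbb L}F=Q(G)\diamond Q(F)$.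 With this composition, dg-categories, objects of $\mathsf D(\mathbf A,\mathbf B)$ and morphisms of $\mathsf D(\mathbf A,\mathbf B)$ form a bicategory $\mathsf{DBimod}$ whose unit $1$-morphisms are the diagonal bimodules. A quasi-functor $S\colon\mathbf A\to\mathbf B$ is left adjoint to a quasi-functor $G\colon\mathbf B\to\mathbf A$ (equivalently, $G$ is right adjoint to $S$) if $S\dashv G$ in $\mathsf{DBimod}$, i.e. there are $2$-morphisms $h_{\mathbf A}\to G\diamond^{\mathbb L}S$ and $S\diamond^{\mathbb L}G\to h_{\mathbf B}$ satisfying the triangular identities. *)

(* Defs.v *)
From HB Require Import structures.
From Stdlib Require Import Relation_Operators.
From mathcomp Require Import all_boot all_order all_algebra.
From mathcomp Require Import boolp zify ring.
Set Implicit Arguments.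
Unset Strict Implicit.
Unset Printing Implicit Defensive.
Import GRing.Theory.
Local Open Scope ring_scope.
Local Open Scope quotient_scope.

(* Graded operations carry a proof of the relation between the degrees
   involved (e.g. [p + q = n]), so that no transport along equalities of
   degrees appears in the laws; such proofs are unique since [int] is an
   eqType.  Closed morphisms of degree 0 are indexed by a single degree. *)

(* (-1)^p for an integer p *)
Definition ksign (k : comPzRingType) (p : int) : k := (-1) ^+ absz p.

Lemma ksign_odd (k : comPzRingType) (p q : int) :
  odd (absz p) = odd (absz q) -> ksign k p = ksign k q.
Proof. by move=> e; rewrite /ksign -signr_odd e signr_odd. Qed.

Lemma ksignD (k : comPzRingType) (p q : int) :
  ksign k (p + q) = ksign k p * ksign k q.
Proof.
rewrite /ksign -signr_odd -[X in X * _]signr_odd -[X in _ * X]signr_odd.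
by rewrite -signr_addb; congr (_ ^+ _); congr nat_of_bool; lia.
Qed.

Lemma ksignMM (k : comPzRingType) (p : int) : ksign k p * ksign k p = 1.
Proof. by rewrite /ksign -exprMn mulrNN mulr1 expr1n. Qed.

Lemma ksign1 (k : comPzRingType) : ksign k 1 = -1.
Proof. exact: expr1. Qed.

Definition is_bilin (k : comPzRingType) (U V W : lmodType k) (f : U -> V -> W) :=
  (forall u, linear (f u)) /\ (forall v, linear (f^~ v)).

Section Complexes.
Variable k : comPzRingType.

Record cochain := Cochain {
  cx_mod :> int -> lmodType k;
  cxd : forall n m : int, n + 1 = m -> {linear cx_mod n -> cx_mod m};
  cxd_cxd : forall (n m l : int) (e : n + 1 = m) (e' : m + 1 = l) x,
    cxd e' (cxd e x) = 0
}.

Definition acyclic (C : cochain) := forall (n m l : int) (e : n + 1 = m) (e' : m + 1 = l)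
  (x : C m), cxd C e' x = 0 -> exists y : C n, cxd C e y = x.

Record cmor (C D : cochain) := Cmor {
  cmor_fun :> forall n, {linear C n -> D n};
  cmor_d : forall (n m : int) (e : n + 1 = m) x,
    cmor_fun m (cxd C e x) = cxd D e (cmor_fun n x)
}.

(* injectivity and surjectivity on every cohomology module *)
Definition cquasi_iso C D (f : cmor C D) :=
  forall (n m l : int) (e : n + 1 = m) (e' : m + 1 = l),
    (forall x : C m, cxd C e' x = 0 ->
       (exists z : D n, f m x = cxd D e z) -> exists w : C n, x = cxd C e w) /\
    (forall y : D m, cxd D e' y = 0 ->
       exists (x : C m) (z : D n), cxd C e' x = 0 /\ y = f m x + cxd D e z).

Definition chomotopic C D (f g : cmor C D) :=
  exists h : (forall (n m : int), m + 1 = n -> {linear C n -> D m}),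
    forall (n m l : int) (e : m + 1 = n) (e' : n + 1 = l) (x : C n),
      f n x - g n x = cxd D e (h n m e x) + h l n e' (cxd C e' x).

(* K(k)(P, N) = 0 for all acyclic N *)
Definition hproj_complex (P : cochain) :=
  forall N, acyclic N -> forall f g : cmor P N, chomotopic f g.

(* [dgc e g f] is the composite g \o f, of degree n = |g| + |f|. *)
Record dgcat := DGCat {
  ob :> Type;
  hom : ob -> ob -> cochain;
  dgc : forall (x y z : ob) (p q n : int), p + q = n ->
    hom y z p -> hom x y q -> hom x z n;
  dgid : forall x, hom x x 0;
  dgc_bilin : forall x y z (p q n : int) (e : p + q = n), is_bilin (@dgc x y z p q n e);
  dgcA : forall w x y z (p q r pq qr n : int) (e1 : p + q = pq) (e2 : pq + r = n)
    (e3 : q + r = qr) (e4 : p + qr = n)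
    (h : hom y z p) (g : hom x y q) (f : hom w x r),
    dgc e4 h (dgc e3 g f) = dgc e2 (dgc e1 h g) f;
  dgc1l : forall x y (p : int) (e : 0 + p = p) (f : hom x y p), dgc e (dgid y) f = f;
  dgc1r : forall x y (p : int) (e : p + 0 = p) (f : hom x y p), dgc e f (dgid x) = f;
  dgc_d : forall x y z (p q n p' q' n' : int) (e : p + q = n) (ep : p + 1 = p')
    (eq : q + 1 = q') (en : n + 1 = n') (el : p' + q = n') (er : p + q' = n')
    (g : hom y z p) (f : hom x y q),
    cxd _ en (dgc e g f) =
      dgc el (cxd _ ep g) f + ksign k p *: dgc er g (cxd _ eq f)
}.

Definition hproj_cat (A : dgcat) := forall x y : A, hproj_complex (hom x y).

Record dgfunctor (A B : dgcat) := DGFunctor {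
  dgf_ob :> A -> B;
  dgf_hom : forall x y, cmor (hom x y) (hom (dgf_ob x) (dgf_ob y));
  dgf_comp : forall x y z (p q n : int) (e : p + q = n) (g : hom y z p) (f : hom x y q),
    dgf_hom x z n (dgc e g f) = dgc e (dgf_hom y z p g) (dgf_hom x y q f);
  dgf_id : forall x, dgf_hom x x 0 (dgid x) = dgid (dgf_ob x)
}.

(* x and y are isomorphic in the category H^0(A) *)
Definition H0_iso (A : dgcat) (x y : A) :=
  exists (f : hom x y 0) (g : hom y x 0) (u : hom x x (-1)) (v : hom y y (-1)),
    [/\ cxd _ (add0r 1) f = 0, cxd _ (add0r 1) g = 0,
        dgc (addr0 0) g f - dgid x = cxd _ (addNr 1) u &
        dgc (addr0 0) f g - dgid y = cxd _ (addNr 1) v].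

Definition quasi_equivalence (A B : dgcat) (F : dgfunctor A B) :=
  (forall x y, cquasi_iso (dgf_hom F x y)) /\ (forall b, exists a, H0_iso (F a) b).

Record hp_resolution (A : dgcat) := HPResolution {
  hp_cat :> dgcat;
  hp_fun : dgfunctor hp_cat A;
  hp_quasi_equivalence : quasi_equivalence hp_fun;
  hp_hproj : hproj_cat hp_cat
}.

Record rmod (B : dgcat) := RMod {
  rm :> B -> cochain;
  rma : forall (x y : B) (p q n : int), p + q = n ->
    rm y p -> hom x y q -> rm x n;
  rma_bilin : forall x y (p q n : int) (e : p + q = n), is_bilin (@rma x y p q n e);
  rmaA : forall x y z (p q r pq qr n : int) (e1 : p + q = pq) (e2 : pq + r = n)
    (e3 : q + r = qr) (e4 : p + qr = n)
    (u : rm z p) (g : hom y z q) (f : hom x y r),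
    rma e4 u (dgc e3 g f) = rma e2 (rma e1 u g) f;
  rma1 : forall x (p : int) (e : p + 0 = p) (u : rm x p), rma e u (dgid x) = u;
  rma_d : forall x y (p q n p' q' n' : int) (e : p + q = n) (ep : p + 1 = p')
    (eq : q + 1 = q') (en : n + 1 = n') (el : p' + q = n') (er : p + q' = n')
    (u : rm y p) (f : hom x y q),
    cxd _ en (rma e u f) =
      rma el (cxd _ ep u) f + ksign k p *: rma er u (cxd _ eq f)
}.

Record rmor (B : dgcat) (M N : rmod B) := RMor {
  rmor_fun :> forall b, cmor (M b) (N b);
  rmor_act : forall x y (p q n : int) (e : p + q = n) (u : M y p) (f : hom x y q),
    rmor_fun x n (rma e u f) = rma e (rmor_fun y p u) f
}.

Definition rquasi_iso (B : dgcat) (M N : rmod B) (f : rmor M N) :=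
  forall b, cquasi_iso (f b).

(* connected by a zigzag of quasi-isomorphisms *)
Definition quasi_isomorphic (B : dgcat) : rmod B -> rmod B -> Prop :=
  clos_refl_sym_trans (rmod B)
    (fun M N => exists f : rmor M N, rquasi_iso f).

Definition representable (B : dgcat) (b : B) : rmod B.
Proof.
refine (@RMod B (fun x => hom x b) (fun x y p q n e u f => dgc e u f) _ _ _ _).
- by move=> *; apply: dgc_bilin.
- by move=> *; apply: dgcA.
- by move=> *; apply: dgc1r.
- by move=> *; apply: dgc_d.
Defined.

(* A-B-bimodules T, covariant in A and contravariant in B; [T b a] is T(b, a).
   Left action [bla e f x] = f x, right action [bra e x g] = x g. *)
Record bimod (A B : dgcat) := Bimod {
  bm :> B -> A -> cochain;
  bla : forall (b : B) (a a' : A) (p q n : int), p + q = n ->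
    hom a a' p -> bm b a q -> bm b a' n;
  bra : forall (b' b : B) (a : A) (p q n : int), p + q = n ->
    bm b a p -> hom b' b q -> bm b' a n;
  bla_bilin : forall b a a' (p q n : int) (e : p + q = n), is_bilin (@bla b a a' p q n e);
  bra_bilin : forall b' b a (p q n : int) (e : p + q = n), is_bilin (@bra b' b a p q n e);
  blaA : forall b a a' a'' (p q r pq qr n : int) (e1 : p + q = pq) (e2 : pq + r = n)
    (e3 : q + r = qr) (e4 : p + qr = n)
    (g : hom a' a'' p) (f : hom a a' q) (x : bm b a r),
    bla e4 g (bla e3 f x) = bla e2 (dgc e1 g f) x;
  braA : forall b'' b' b a (p q r pq qr n : int) (e1 : p + q = pq) (e2 : pq + r = n)
    (e3 : q + r = qr) (e4 : p + qr = n)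
    (x : bm b a p) (g : hom b' b q) (f : hom b'' b' r),
    bra e4 x (dgc e3 g f) = bra e2 (bra e1 x g) f;
  blra : forall b' b a a' (p q r pq qr n : int) (e1 : p + q = pq) (e2 : pq + r = n)
    (e3 : q + r = qr) (e4 : p + qr = n)
    (f : hom a a' p) (x : bm b a q) (g : hom b' b r),
    bla e4 f (bra e3 x g) = bra e2 (bla e1 f x) g;
  bla1 : forall b a (p : int) (e : 0 + p = p) (x : bm b a p), bla e (dgid a) x = x;
  bra1 : forall b a (p : int) (e : p + 0 = p) (x : bm b a p), bra e x (dgid b) = x;
  bla_d : forall b a a' (p q n p' q' n' : int) (e : p + q = n) (ep : p + 1 = p')
    (eq : q + 1 = q') (en : n + 1 = n') (el : p' + q = n') (er : p + q' = n')
    (f : hom a a' p) (x : bm b a q),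
    cxd _ en (bla e f x) =
      bla el (cxd _ ep f) x + ksign k p *: bla er f (cxd _ eq x);
  bra_d : forall b' b a (p q n p' q' n' : int) (e : p + q = n) (ep : p + 1 = p')
    (eq : q + 1 = q') (en : n + 1 = n') (el : p' + q = n') (er : p + q' = n')
    (x : bm b a p) (f : hom b' b q),
    cxd _ en (bra e x f) =
      bra el (cxd _ ep x) f + ksign k p *: bra er x (cxd _ eq f)
}.

Definition diag (A : dgcat) : bimod A A.
Proof.
refine (@Bimod A A (fun x y => hom x y)
  (fun b a a' p q n e f x => dgc e f x) (fun b' b a p q n e x f => dgc e x f)
  _ _ _ _ _ _ _ _ _).
- by move=> *; apply: dgc_bilin.
- by move=> *; apply: dgc_bilin.
- by move=> *; apply: dgcA.
- by move=> *; apply: dgcA.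
- by move=> *; apply: dgcA.
- by move=> *; apply: dgc1l.
- by move=> *; apply: dgc1r.
- by move=> *; apply: dgc_d.
- by move=> *; apply: dgc_d.
Defined.


Section Bilin.
Variables (U V W : lmodType k) (f : U -> V -> W) (hf : is_bilin f).
Lemma bilZl a u v : f (a *: u) v = a *: f u v.
Proof. exact: (GRing.scalable_linear (hf.2 v)). Qed.
Lemma bilZr a u v : f u (a *: v) = a *: f u v.
Proof. exact: (GRing.scalable_linear (hf.1 u)). Qed.
Lemma bilDl u u' v : f (u + u') v = f u v + f u' v.
Proof. by have := hf.2 v 1 u u'; rewrite !scale1r. Qed.
Lemma bilDr u v v' : f u (v + v') = f u v + f u v'.
Proof. by have := hf.1 u 1 v v'; rewrite !scale1r. Qed.
End Bilin.

Section Bdgc.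
Variables (A : dgcat) (x y z : A) (p q n : int) (e : p + q = n).
Implicit Types (u : hom y z p) (v : hom x y q).
Lemma dgcZl t u v : dgc e (t *: u) v = t *: dgc e u v.
Proof. exact: (bilZl (dgc_bilin _ _ _ e)). Qed.
Lemma dgcZr t u v : dgc e u (t *: v) = t *: dgc e u v.
Proof. exact: (bilZr (dgc_bilin _ _ _ e)). Qed.
Lemma dgcDl u u' v : dgc e (u + u') v = dgc e u v + dgc e u' v.
Proof. exact: (bilDl (dgc_bilin _ _ _ e)). Qed.
Lemma dgcDr u v v' : dgc e u (v + v') = dgc e u v + dgc e u v'.
Proof. exact: (bilDr (dgc_bilin _ _ _ e)). Qed.
End Bdgc.

Section Bbla.
Variables (A B : dgcat) (T : bimod A B) (b : B) (x y : A) (p q n : int) (e : p + q = n).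
Implicit Types (u : hom x y p) (v : T b x q).
Lemma blaZl t u v : bla e (t *: u) v = t *: bla e u v.
Proof. exact: (bilZl (bla_bilin T _ _ _ e)). Qed.
Lemma blaZr t u v : bla e u (t *: v) = t *: bla e u v.
Proof. exact: (bilZr (bla_bilin T _ _ _ e)). Qed.
Lemma blaDl u u' v : bla e (u + u') v = bla e u v + bla e u' v.
Proof. exact: (bilDl (bla_bilin T _ _ _ e)). Qed.
Lemma blaDr u v v' : bla e u (v + v') = bla e u v + bla e u v'.
Proof. exact: (bilDr (bla_bilin T _ _ _ e)). Qed.
Lemma bla0r u : bla e u (0 : T b x q) = 0.
Proof. by rewrite -(scale0r 0) blaZr scale0r. Qed.
End Bbla.

Section Bbra.
Variables (A B : dgcat) (T : bimod A B) (x y : B) (a : A) (p q n : int) (e : p + q = n).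
Implicit Types (u : T y a p) (v : hom x y q).
Lemma braZl t u v : bra e (t *: u) v = t *: bra e u v.
Proof. exact: (bilZl (bra_bilin T _ _ _ e)). Qed.
Lemma braZr t u v : bra e u (t *: v) = t *: bra e u v.
Proof. exact: (bilZr (bra_bilin T _ _ _ e)). Qed.
Lemma braDl u u' v : bra e (u + u') v = bra e u v + bra e u' v.
Proof. exact: (bilDl (bra_bilin T _ _ _ e)). Qed.
Lemma braDr u v v' : bra e u (v + v') = bra e u v + bra e u v'.
Proof. exact: (bilDr (bra_bilin T _ _ _ e)). Qed.
Lemma bra0l v : bra e (0 : T y a p) v = 0.
Proof. by rewrite -(scale0r 0) braZl scale0r. Qed.
End Bbra.

(* the composite of g and f in A^op is (-1)^(|g||f|) f g *)
Definition op (A : dgcat) : dgcat.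
Proof.
refine (@DGCat A (fun x y => hom y x)
  (fun x y z p q n e g f => ksign k (p * q) *: dgc (etrans (addrC q p) e) f g)
  (fun x => dgid x) _ _ _ _ _).
- move=> x y z p q n e; split=> u a v w /=;
    rewrite ?dgcDl ?dgcDr ?dgcZl ?dgcZr scalerDr !scalerA; by congr (_ *: _ + _); rewrite mulrC.
- move=> w x y z p q r pq qr n e1 e2 e3 e4 h g f.
  rewrite dgcZl dgcZr !scalerA.
  rewrite -(dgcA (etrans (addrC r q) e3) (etrans (addrC qr p) e4)
    (etrans (addrC q p) e1) (etrans (addrC r pq) e2)).
  by congr (_ *: _); rewrite -!ksignD; apply: ksign_odd; lia.
- by move=> x y p e f; rewrite mul0r scale1r dgc1r.
- by move=> x y p e f; rewrite mulr0 scale1r dgc1l.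
- move=> x y z p q n p' q' n' e ep eq en el er g f.
  rewrite linearZ /= (dgc_d (etrans (addrC _ _) e) eq ep en (etrans (addrC _ _) er) (etrans (addrC _ _) el)).
  rewrite scalerDr !scalerA [LHS]addrC; congr (_ *: _ + _ *: _); subst;
  by rewrite -!ksignD; apply: ksign_odd; lia.
Defined.

Definition bm_right (A B : dgcat) (T : bimod A B) (a : A) : rmod B.
Proof.
refine (@RMod B (fun b => T b a) (fun x y p q n e u f => bra e u f) _ _ _ _).
- by move=> *; apply: bra_bilin.
- by move=> *; apply: braA.
- by move=> *; apply: bra1.
- by move=> *; apply: bra_d.
Defined.

(* T(b, -) as a right module over A^op: x f = (-1)^(|x||f|) f x *)
Definition bm_left (A B : dgcat) (T : bimod A B) (b : B) : rmod (op A).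
Proof.
refine (@RMod (op A) (fun a => T b a)
  (fun x y p q n e u f =>
     ksign k (p * q) *: @bla A B T b y x _ _ _ (etrans (addrC q p) e) f u) _ _ _ _).
- move=> x y p q n e; split=> u a v w /=;
    rewrite ?blaDl ?blaDr ?blaZl ?blaZr scalerDr !scalerA; by congr (_ *: _ + _); rewrite mulrC.
- move=> x y z p q r pq qr n e1 e2 e3 e4 u g f /=.
  rewrite blaZl blaZr !scalerA.
  rewrite -(blaA (etrans (addrC r q) e3) (etrans (addrC qr p) e4)
    (etrans (addrC q p) e1) (etrans (addrC r pq) e2)).
  by congr (_ *: _); rewrite -!ksignD; apply: ksign_odd; lia.
- by move=> x p e u; rewrite mulr0 scale1r bla1.
- move=> x y p q n p' q' n' e ep eq en el er u f /=.
  rewrite linearZ /= (bla_d (etrans (addrC _ _) e) eq ep en (etrans (addrC _ _) er) (etrans (addrC _ _) el)).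
  rewrite scalerDr !scalerA [LHS]addrC; congr (_ *: _ + _ *: _); subst;
  by rewrite -!ksignD; apply: ksign_odd; lia.
Defined.

Definition right_quasi_repr (A B : dgcat) (T : bimod A B) :=
  forall a, exists b, quasi_isomorphic (bm_right T a) (representable b).

Definition quasi_functor (A B : dgcat) (T : bimod A B) := right_quasi_repr T.

(* [representable (a : op A)] is the left module A(a, -) *)
Definition left_quasi_repr (A B : dgcat) (T : bimod A B) :=
  forall b, exists a : op A, quasi_isomorphic (bm_left T b) (representable a).

Record bmor (A B : dgcat) (M N : bimod A B) := Bmor {
  bmor_fun :> forall b a, cmor (M b a) (N b a);
  bmor_la : forall b a a' (p q n : int) (e : p + q = n) (f : hom a a' p) (x : M b a q),
    bmor_fun b a' n (bla e f x) = bla e f (bmor_fun b a q x);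
  bmor_ra : forall b' b a (p q n : int) (e : p + q = n) (x : M b a p) (f : hom b' b q),
    bmor_fun b' a n (bra e x f) = bra e (bmor_fun b a p x) f
}.

Definition cid_mor (C : cochain) : cmor C C.
Proof. by refine (@Cmor C C (fun n => idfun) _). Defined.

Definition ccomp_mor (C D E : cochain) (g : cmor D E) (f : cmor C D) : cmor C E.
Proof.
refine (@Cmor C E (fun n => g n \o f n) _).
by move=> n m e x /=; rewrite !cmor_d.
Defined.

Definition bid (A B : dgcat) (M : bimod A B) : bmor M M.
Proof. by refine (@Bmor A B M M (fun b a => cid_mor (M b a)) _ _). Defined.

Definition bcompm (A B : dgcat) (M N P : bimod A B) (g : bmor N P) (f : bmor M N) :
  bmor M P.
Proof.
refine (@Bmor A B M P (fun b a => ccomp_mor (g b a) (f b a)) _ _).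
- by move=> * /=; rewrite !bmor_la.
- by move=> * /=; rewrite !bmor_ra.
Defined.

Definition bquasi_iso (A B : dgcat) (M N : bimod A B) (f : bmor M N) :=
  forall b a, cquasi_iso (f b a).

Definition bacyclic (A B : dgcat) (M : bimod A B) := forall b a, acyclic (M b a).

(* f - g is the differential of a morphism h of degree -1 of C_dg(M, N) *)
Definition bhomotopic (A B : dgcat) (M N : bimod A B) (f g : bmor M N) :=
  exists h : (forall b a (n m : int), m + 1 = n -> {linear M b a n -> N b a m}),
  [/\ (forall b a a' (p q n q' n' : int) (e : p + q = n) (eq : q' + 1 = q) (en : n' + 1 = n)
         (e' : p + q' = n') (u : hom a a' p) (x : M b a q),
         h b a' n n' en (bla e u x) = ksign k p *: bla e' u (h b a q q' eq x)),
      (forall b' b a (p q n p' n' : int) (e : p + q = n) (ep : p' + 1 = p) (en : n' + 1 = n)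
         (e' : p' + q = n') (x : M b a p) (u : hom b' b q),
         h b' a n n' en (bra e x u) = bra e' (h b a p p' ep x) u) &
      (forall b a (n m l : int) (e : m + 1 = n) (e' : n + 1 = l) (x : M b a n),
         f b a n x - g b a n x =
           cxd _ e (h b a n m e x) + h b a l n e' (cxd _ e' x))].

(* K(P, N) = 0 for all acyclic N *)
Definition hproj (A B : dgcat) (P : bimod A B) :=
  forall N : bimod A B, bacyclic N -> forall f g : bmor P N, bhomotopic f g.

(* Morphisms of D(A, B), the localisation of K at quasi-isomorphisms: formal
   composites of morphisms and of formal inverses of quasi-isomorphisms, to be
   considered up to the congruence [deq]. *)
Inductive dmor (A B : dgcat) : bimod A B -> bimod A B -> Type :=
| Dof M N : bmor M N -> dmor M N
| Dinv M N (s : bmor M N) : bquasi_iso s -> dmor N M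
| Dcomp M N P : dmor N P -> dmor M N -> dmor M P.

Inductive deq (A B : dgcat) : forall M N : bimod A B, dmor M N -> dmor M N -> Prop :=
| deq_refl M N (f : dmor M N) : deq f f
| deq_sym M N (f g : dmor M N) : deq f g -> deq g f
| deq_trans M N (f g h : dmor M N) : deq f g -> deq g h -> deq f h
| deq_Dcomp M N P (g g' : dmor N P) (f f' : dmor M N) :
    deq g g' -> deq f f' -> deq (Dcomp g f) (Dcomp g' f')
| deq_assoc M N P R (h : dmor P R) (g : dmor N P) (f : dmor M N) :
    deq (Dcomp h (Dcomp g f)) (Dcomp (Dcomp h g) f)
| deq_id_l M N (f : dmor M N) : deq (Dcomp (Dof (bid N)) f) f
| deq_id_r M N (f : dmor M N) : deq (Dcomp f (Dof (bid M))) f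
| deq_homotopic M N (f g : bmor M N) : bhomotopic f g -> deq (Dof f) (Dof g)
| deq_Dof_comp M N P (g : bmor N P) (f : bmor M N) :
    deq (Dof (bcompm g f)) (Dcomp (Dof g) (Dof f))
| deq_inv_l M N (s : bmor M N) (hs : bquasi_iso s) :
    deq (Dcomp (Dinv hs) (Dof s)) (Dof (bid M))
| deq_inv_r M N (s : bmor M N) (hs : bquasi_iso s) :
    deq (Dcomp (Dof s) (Dinv hs)) (Dof (bid N)).

Section Coend.
Variables (A B C : dgcat) (F : bimod A B) (G : bimod B C) (a : A) (c : C).

(* Degree n of the coend int^B F(B, a) (x) G(c, B): the k-module generated by
   the x (x) y, with |x| + |y| = n, subject to bilinearity and to
   x f (x) y = x (x) f y, i.e. the cokernel of
   (+)_(b1, b2) F(b2, a) (x) B(b1, b2) (x) G(c, b1) -> (+)_b F(b, a) (x) G(c, b). *)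
Inductive tsum (n : int) : Type :=
| tzero
| tadd of tsum n & tsum n
| tscale of k & tsum n
| tgen (b : B) (p q : int) (e : p + q = n) (x : F b a p) (y : G c b q).
Arguments tzero {n}.
Arguments tgen {n b p q}.

Inductive trel (n : int) : tsum n -> tsum n -> Prop :=
| trel_refl s : trel s s
| trel_sym s t : trel s t -> trel t s
| trel_trans s t u : trel s t -> trel t u -> trel s u
| trel_add s s' t t' : trel s s' -> trel t t' -> trel (tadd s t) (tadd s' t')
| trel_scale r s s' : trel s s' -> trel (tscale r s) (tscale r s')
| trel_addA s t u : trel (tadd s (tadd t u)) (tadd (tadd s t) u)
| trel_addC s t : trel (tadd s t) (tadd t s)
| trel_add0 s : trel (tadd tzero s) s
| trel_addN s : trel (tadd (tscale (-1) s) s) tzero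
| trel_scaleA r r' s : trel (tscale r (tscale r' s)) (tscale (r * r') s)
| trel_scale1 s : trel (tscale 1 s) s
| trel_scaleDr r s t : trel (tscale r (tadd s t)) (tadd (tscale r s) (tscale r t))
| trel_scaleDl r r' s : trel (tscale (r + r') s) (tadd (tscale r s) (tscale r' s))
| trel_linl b (p q : int) (e : p + q = n) r (x x' : F b a p) (y : G c b q) :
    trel (tgen e (r *: x + x') y) (tadd (tscale r (tgen e x y)) (tgen e x' y))
| trel_linr b (p q : int) (e : p + q = n) r (x : F b a p) (y y' : G c b q) :
    trel (tgen e x (r *: y + y')) (tadd (tscale r (tgen e x y)) (tgen e x y'))
| trel_bal b1 b2 (p r q pr rq : int) (e1 : p + r = pr) (e2 : pr + q = n)
    (e3 : r + q = rq) (e4 : p + rq = n)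
    (x : F b2 a p) (f : hom b1 b2 r) (y : G c b1 q) :
    trel (tgen e2 (bra e1 x f) y) (tgen e4 x (bla e3 f y)).

HB.instance Definition _ (n : int) := gen_eqMixin (tsum n).
HB.instance Definition _ (n : int) := gen_choiceMixin (tsum n).

Definition trelb (n : int) (s t : tsum n) := `[< trel s t >].

Lemma trelb_equiv (n : int) : equiv_class_of (@trelb n).
Proof.
split=> [s|s t|t s u].
- by apply/asboolP; apply: trel_refl.
- by apply/asboolP/asboolP; apply: trel_sym.
- by move=> /asboolP h1 /asboolP h2; apply/asboolP; apply: trel_trans h1 h2.
Qed.

Canonical trelb_equiv_rel (n : int) := EquivRelPack (trelb_equiv n).

Definition tens (n : int) := {eq_quot (@trelb n)}.

Definition tpi (n : int) (s : tsum n) : tens n := \pi_(tens n) s.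

HB.instance Definition _ (n : int) := Choice.on (tens n).

Lemma tpi_eq (n : int) (s t : tsum n) : tpi s = tpi t <-> trel s t.
Proof.
split=> [h|h]; last by apply/eqquotP/asboolP.
by have /eqquotP/asboolP := h.
Qed.

Lemma tpiK (n : int) (x : tens n) : tpi (repr x) = x.
Proof. exact: reprK. Qed.

Lemma trepr (n : int) (s : tsum n) : trel (repr (tpi s)) s.
Proof. by apply/tpi_eq; rewrite tpiK. Qed.

Definition tens_add (n : int) (x y : tens n) := tpi (tadd (repr x) (repr y)).
Definition tens_scale (n : int) (r : k) (x : tens n) := tpi (tscale r (repr x)).

Lemma tens_addE (n : int) (s t : tsum n) : tens_add (tpi s) (tpi t) = tpi (tadd s t).
Proof. by apply/tpi_eq/trel_add; apply: trepr. Qed.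

Lemma tens_scaleE (n : int) r (s : tsum n) : tens_scale r (tpi s) = tpi (tscale r s).
Proof. by apply/tpi_eq/trel_scale; apply: trepr. Qed.

Section TensLmod.
Variable n : int.
Fact tens_addA : associative (@tens_add n).
Proof.
move=> x y z; rewrite -(tpiK x) -(tpiK y) -(tpiK z) !tens_addE.
exact/tpi_eq/trel_addA.
Qed.
Fact tens_addC : commutative (@tens_add n).
Proof. by move=> x y; rewrite -(tpiK x) -(tpiK y) !tens_addE; apply/tpi_eq/trel_addC. Qed.
Fact tens_add0 : left_id (tpi tzero) (@tens_add n).
Proof. by move=> x; rewrite -(tpiK x) tens_addE; apply/tpi_eq/trel_add0. Qed.
Fact tens_addN : left_inverse (tpi tzero) (@tens_scale n (-1)) (@tens_add n).
Proof. by move=> x; rewrite -(tpiK x) tens_scaleE tens_addE; apply/tpi_eq/trel_addN. Qed.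
HB.instance Definition _ :=
  GRing.isZmodule.Build (tens n) tens_addA tens_addC tens_add0 tens_addN.
Fact tens_scaleA r r' (x : tens n) : tens_scale r (tens_scale r' x) = tens_scale (r * r') x.
Proof. by rewrite -(tpiK x) !tens_scaleE; apply/tpi_eq/trel_scaleA. Qed.
Fact tens_scale1 : left_id 1 (@tens_scale n).
Proof. by move=> x; rewrite -(tpiK x) tens_scaleE; apply/tpi_eq/trel_scale1. Qed.
Fact tens_scaleDr : right_distributive (@tens_scale n) +%R.
Proof.
suff E (r : k) (s t : tsum n) : tens_scale r (tens_add (tpi s) (tpi t)) =
    tens_add (tens_scale r (tpi s)) (tens_scale r (tpi t)).
  by move=> r x y; rewrite -(tpiK x) -(tpiK y); apply: E.
by rewrite (tens_scaleE r s) (tens_scaleE r t) !tens_addE tens_scaleE; apply/tpi_eq/trel_scaleDr.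
Qed.
Fact tens_scaleDl (x : tens n) : {morph (@tens_scale n)^~ x : r r' / r + r'}.
Proof.
suff E (r r' : k) (s : tsum n) : tens_scale (r + r') (tpi s) =
    tens_add (tens_scale r (tpi s)) (tens_scale r' (tpi s)).
  by move=> r r'; rewrite -(tpiK x); apply: E.
by rewrite (tens_scaleE r s) (tens_scaleE r' s) tens_addE tens_scaleE; apply/tpi_eq/trel_scaleDl.
Qed.
HB.instance Definition _ := GRing.Zmodule_isLmodule.Build k (tens n)
  tens_scaleA tens_scale1 tens_scaleDr tens_scaleDl.

(* the class of x (x) y *)
Definition tg (b : B) (p q : int) (e : p + q = n) (x : F b a p) (y : G c b q) : tens n :=
  tpi (tgen e x y).

Lemma tg_bilin b p q (e : p + q = n) : is_bilin (@tg b p q e).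
Proof.
split=> [x r y y'|y r x x'] /=.
- apply: (etrans (y := tpi (tadd (tscale r (tgen e x y)) (tgen e x y')))).
    exact/tpi_eq/trel_linr.
  by rewrite -tens_addE -tens_scaleE.
- apply: (etrans (y := tpi (tadd (tscale r (tgen e x y)) (tgen e x' y)))).
    exact/tpi_eq/trel_linl.
  by rewrite -tens_addE -tens_scaleE.
Qed.

Lemma tg_bal b1 b2 (p r q pr rq : int) (e1 : p + r = pr) (e2 : pr + q = n)
    (e3 : r + q = rq) (e4 : p + rq = n)
    (x : F b2 a p) (f : hom b1 b2 r) (y : G c b1 q) :
  tg e2 (bra e1 x f) y = tg e4 x (bla e3 f y).
Proof. by apply/tpi_eq; apply: trel_bal. Qed.

Lemma tens_ind (P : tens n -> Prop) : P 0 -> (forall x y, P x -> P y -> P (x + y)) ->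
  (forall r x, P x -> P (r *: x)) ->
  (forall b p q (e : p + q = n) (x : F b a p) (y : G c b q), P (tg e x y)) ->
  forall x, P x.
Proof.
move=> P0 PD PZ Pg x; rewrite -(tpiK x); elim: (repr x) => [|s hs t ht|r s hs|//].
- exact: P0.
- by rewrite -tens_addE; apply: PD.
- by rewrite -tens_scaleE; apply: PZ.
Qed.

Section Lift.
Variables (W : lmodType k)
  (phi : forall (b : B) (p q : int), p + q = n -> F b a p -> G c b q -> W).
Arguments phi {b p q}.
Hypothesis phi_bilin : forall b p q (e : p + q = n), is_bilin (@phi b p q e).
Hypothesis phi_bal : forall b1 b2 (p r q pr rq : int) (e1 : p + r = pr) (e2 : pr + q = n)
    (e3 : r + q = rq) (e4 : p + rq = n)
    (x : F b2 a p) (f : hom b1 b2 r) (y : G c b1 q),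
  phi e2 (bra e1 x f) y = phi e4 x (bla e3 f y).

Fixpoint teval (s : tsum n) : W :=
  match s with
  | tzero => 0
  | tadd s t => teval s + teval t
  | tscale r s => r *: teval s
  | tgen _ _ _ e x y => phi e x y
  end.

Lemma teval_rel s t : trel s t -> teval s = teval t.
Proof.
elim=> //=.
- by move=> ? ? ? _ -> _ ->.
- by move=> ? ? ? ? _ -> _ ->.
- by move=> ? ? ? _ ->.
- by move=> *; rewrite addrA.
- by move=> *; rewrite addrC.
- by move=> *; rewrite add0r.
- by move=> *; rewrite scaleN1r addNr.
- by move=> *; rewrite scalerA.
- by move=> *; rewrite scale1r.
- by move=> *; rewrite scalerDr.
- by move=> *; rewrite scalerDl.
- by move=> b p q e r x x' y; exact: ((phi_bilin _ e).2 y r x x').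
- by move=> b p q e r x y y'; exact: ((phi_bilin _ e).1 x r y y').
Qed.

(* the linear map x (x) y |-> phi x y *)
Definition tlift_fun (x : tens n) : W := teval (repr x).

Lemma tlift_pi s : tlift_fun (tpi s) = teval s.
Proof. exact/teval_rel/trepr. Qed.

Fact tlift_linear : linear tlift_fun.
Proof.
move=> r x y; rewrite -(tpiK x) -(tpiK y) [r *: _]tens_scaleE [_ + _]tens_addE.
by rewrite !tlift_pi.
Qed.
HB.instance Definition _ := GRing.isLinear.Build k (tens n) W *:%R tlift_fun tlift_linear.

Definition tlift : {linear tens n -> W} := tlift_fun.

Lemma tlift_tg b p q (e : p + q = n) (x : F b a p) (y : G c b q) :
  tlift (tg e x y) = phi e x y.
Proof. exact: tlift_pi. Qed.
End Lift.
End TensLmod.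
End Coend.

Lemma int_irr (p q : int) (e e' : p = q) : e = e'.
Proof. exact: eq_irrelevance. Qed.

Section TgLinear.
Variables (A B C : dgcat) (F : bimod A B) (G : bimod B C) (a : A) (c : C).
Variables (n : int) (b : B) (p q : int) (e : p + q = n).
Implicit Types (x : F b a p) (y : G c b q).
Lemma tgZl t x y : tg e (t *: x) y = t *: tg e x y.
Proof. exact: (bilZl (tg_bilin F G a c b e)). Qed.
Lemma tgZr t x y : tg e x (t *: y) = t *: tg e x y.
Proof. exact: (bilZr (tg_bilin F G a c b e)). Qed.
Lemma tgDl x x' y : tg e (x + x') y = tg e x y + tg e x' y.
Proof. exact: (bilDl (tg_bilin F G a c b e)). Qed.
Lemma tgDr x y y' : tg e x (y + y') = tg e x y + tg e x y'.
Proof. exact: (bilDr (tg_bilin F G a c b e)). Qed.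
Lemma tg0l y : tg e (0 : F b a p) y = 0.
Proof. by rewrite -(scale0r 0) tgZl scale0r. Qed.
Lemma tg0r x : tg e x (0 : G c b q) = 0.
Proof. by rewrite -(scale0r 0) tgZr scale0r. Qed.
End TgLinear.

Section BComp.
Variables (A B C : dgcat) (F : bimod A B) (G : bimod B C).
Let T (c : C) (a : A) (n : int) : lmodType k := tens F G a c n.

Fact degSl (p q n m : int) : n + 1 = m -> p + q = n -> (p + 1) + q = m.
Proof. lia. Qed.
Fact degSr (p q n m : int) : n + 1 = m -> p + q = n -> p + (q + 1) = m.
Proof. lia. Qed.
Fact degl (r p q n m : int) : r + n = m -> p + q = n -> (r + p) + q = m.
Proof. lia. Qed.
Fact degr (r p q n m : int) : n + r = m -> p + q = n -> p + (q + r) = m.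
Proof. lia. Qed.

(* d (x (x) y) = d x (x) y + (-1)^|x| x (x) d y *)
Section Diff.
Variables (a : A) (c : C) (n m : int) (en : n + 1 = m).
Definition tdphi (b : B) (p q : int) (e : p + q = n) (x : F b a p) (y : G c b q) :
    T c a m :=
  tg (degSl en e) (cxd _ (erefl (p + 1)) x) y +
  ksign k p *: tg (degSr en e) x (cxd _ (erefl (q + 1)) y).

Lemma tdphiE (b : B) (p q p' q' : int) (e : p + q = n) (ep : p + 1 = p')
    (eq : q + 1 = q') (el : p' + q = m) (er : p + q' = m) (x : F b a p) (y : G c b q) :
  tdphi e x y = tg el (cxd _ ep x) y + ksign k p *: tg er x (cxd _ eq y).
Proof. by subst p' q'; rewrite /tdphi; rewrite (int_irr (degSl en e) el) (int_irr (degSr en e) er). Qed.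

Fact tdphi_bilin b (p q : int) (e : p + q = n) : is_bilin (@tdphi b p q e).
Proof.
split=> u r v w; rewrite /tdphi !linearD !linearZ /= !(tgDl, tgDr, tgZl, tgZr);
  rewrite !scalerDr !scalerA [ksign k p * r]mulrC -!addrA; congr (_ + _);
  by rewrite addrCA.
Qed.

Fact tdphi_bal b1 b2 (p r q pr rq : int) (e1 : p + r = pr) (e2 : pr + q = n)
    (e3 : r + q = rq) (e4 : p + rq = n)
    (x : F b2 a p) (f : hom b1 b2 r) (y : G c b1 q) :
  tdphi e2 (bra e1 x f) y = tdphi e4 x (bla e3 f y).
Proof.
have [p1 ep] : exists p1, p + 1 = p1 by exists (p + 1).
have [q1 eq] : exists q1, q + 1 = q1 by exists (q + 1).
have [r1 er] : exists r1, r + 1 = r1 by exists (r + 1).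
have [pr1 epr] : exists pr1, pr + 1 = pr1 by exists (pr + 1).
have [rq1 erq] : exists rq1, rq + 1 = rq1 by exists (rq + 1).
have i1 : pr1 + q = m by lia.
have i2 : pr + q1 = m by lia.
have i3 : p1 + rq = m by lia.
have i4 : p + rq1 = m by lia.
have i5 : p1 + r = pr1 by lia.
have i6 : p + r1 = pr1 by lia.
have i7 : r1 + q = rq1 by lia.
have i8 : r + q1 = rq1 by lia.
rewrite (tdphiE e2 epr eq i1 i2) (tdphiE e4 ep erq i3 i4).
rewrite (bra_d e1 ep er epr i5 i6) (bla_d e3 er eq erq i7 i8).
rewrite !(tgDl, tgDr, tgZl, tgZr).
rewrite (tg_bal i5 i1 e3 i3) (tg_bal i6 i1 i7 i4) (tg_bal e1 i2 i8 i4).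
by rewrite scalerDr scalerA -ksignD e1 addrA.
Qed.

Definition td : {linear T c a n -> T c a m} := tlift tdphi_bilin tdphi_bal.

Lemma td_tg (b : B) (p q p' q' : int) (e : p + q = n) (ep : p + 1 = p')
    (eq : q + 1 = q') (el : p' + q = m) (er : p + q' = m) (x : F b a p) (y : G c b q) :
  td (tg e x y) = tg el (cxd _ ep x) y + ksign k p *: tg er x (cxd _ eq y).
Proof. by rewrite tlift_tg; apply: tdphiE. Qed.
Lemma tdZ s x : td (s *: x) = s *: td x.
Proof. exact: linearZZ. Qed.
End Diff.

Fact td_td a c (n m l : int) (e : n + 1 = m) (e' : m + 1 = l) x :
  td a c e' (td a c e x) = 0.
Proof.
elim/tens_ind: x => [|x y hx hy|r x hx|b p q i x y]; rewrite ?linear0 //.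
- by rewrite !linearD hx hy addr0.
- by rewrite !linearZ /= hx scaler0.
have i1 : (p + 1) + q = m by lia.
have i2 : p + (q + 1) = m by lia.
have i3 : (p + 1 + 1) + q = l by lia.
have i4 : p + (q + 1 + 1) = l by lia.
have i5 : (p + 1) + (q + 1) = l by lia.
rewrite (td_tg e i (erefl _) (erefl _) i1 i2) linearD linearZ /=.
rewrite (td_tg e' i1 (erefl _) (erefl _) i3 i5) (td_tg e' i2 (erefl _) (erefl _) i5 i4).
rewrite !cxd_cxd tg0l tg0r scaler0 add0r addr0 ksignD ksign1 mulrN1 scaleNr.
by rewrite addNr.
Qed.

Definition tens_cx (c : C) (a : A) : cochain := @Cochain (T c a) (td a c) (@td_td a c).

Section Actions.
Variables (a a' : A) (c c' : C) (r n m : int).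
Section L.
Variables (e : r + n = m) (f : hom a a' r).
Definition tlaphi (b : B) (p q : int) (i : p + q = n) (x : F b a p) (y : G c b q) :
  T c a' m := tg (degl e i) (bla (erefl (r + p)) f x) y.
Fact tlaphi_bilin b (p q : int) (i : p + q = n) : is_bilin (@tlaphi b p q i).
Proof. by split=> u t v w; rewrite /tlaphi ?blaDr ?blaZr !(tgDl, tgDr, tgZl, tgZr). Qed.
Lemma tlaphiE (b : B) (p q rp : int) (i : p + q = n) (j : r + p = rp) (l : rp + q = m)
    (x : F b a p) (y : G c b q) : tlaphi i x y = tg l (bla j f x) y.
Proof. by subst rp; rewrite /tlaphi (int_irr (degl e i) l). Qed.
Fact tlaphi_bal b1 b2 (p s q ps sq : int) (e1 : p + s = ps) (e2 : ps + q = n)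
    (e3 : s + q = sq) (e4 : p + sq = n)
    (x : F b2 a p) (g : hom b1 b2 s) (y : G c b1 q) :
  tlaphi e2 (bra e1 x g) y = tlaphi e4 x (bla e3 g y).
Proof.
have i1 : (r + p) + s = r + ps by lia.
have i2 : (r + ps) + q = m by lia.
have i3 : (r + p) + sq = m by lia.
rewrite (tlaphiE e2 (erefl (r + ps)) i2) (tlaphiE e4 (erefl (r + p)) i3).
by rewrite (blra (erefl _) i1) (tg_bal i1 i2 e3 i3).
Qed.
Definition tla : {linear T c a n -> T c a' m} := tlift tlaphi_bilin tlaphi_bal.
Lemma tla_tg (b : B) (p q rp : int) (i : p + q = n) (j : r + p = rp) (l : rp + q = m)
    (x : F b a p) (y : G c b q) : tla (tg i x y) = tg l (bla j f x) y.
Proof. by rewrite tlift_tg; apply: tlaphiE. Qed.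
Lemma tlaZ s x : tla (s *: x) = s *: tla x.
Proof. exact: linearZZ. Qed.
End L.
Section R.
Variables (e : n + r = m) (f : hom c' c r).
Definition traphi (b : B) (p q : int) (i : p + q = n) (x : F b a p) (y : G c b q) :
  T c' a m := tg (degr e i) x (bra (erefl (q + r)) y f).
Fact traphi_bilin b (p q : int) (i : p + q = n) : is_bilin (@traphi b p q i).
Proof. by split=> u t v w; rewrite /traphi ?braDl ?braZl !(tgDl, tgDr, tgZl, tgZr). Qed.
Lemma traphiE (b : B) (p q qr : int) (i : p + q = n) (j : q + r = qr) (l : p + qr = m)
    (x : F b a p) (y : G c b q) : traphi i x y = tg l x (bra j y f).
Proof. by subst qr; rewrite /traphi (int_irr (degr e i) l). Qed.
Fact traphi_bal b1 b2 (p s q ps sq : int) (e1 : p + s = ps) (e2 : ps + q = n)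
    (e3 : s + q = sq) (e4 : p + sq = n)
    (x : F b2 a p) (g : hom b1 b2 s) (y : G c b1 q) :
  traphi e2 (bra e1 x g) y = traphi e4 x (bla e3 g y).
Proof.
have i1 : s + (q + r) = sq + r by lia.
have i2 : ps + (q + r) = m by lia.
have i3 : p + (sq + r) = m by lia.
rewrite (traphiE e2 (erefl (q + r)) i2) (traphiE e4 (erefl (sq + r)) i3).
by rewrite (tg_bal e1 i2 i1 i3) (blra e3 (erefl (sq + r)) (erefl _) i1).
Qed.
Definition tra : {linear T c a n -> T c' a m} := tlift traphi_bilin traphi_bal.
Lemma tra_tg (b : B) (p q qr : int) (i : p + q = n) (j : q + r = qr) (l : p + qr = m)
    (x : F b a p) (y : G c b q) : tra (tg i x y) = tg l x (bra j y f).
Proof. by rewrite tlift_tg; apply: traphiE. Qed.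
Lemma traZ s x : tra (s *: x) = s *: tra x.
Proof. exact: linearZZ. Qed.
End R.
End Actions.

(* F (x)_B G, i.e. G <> F *)
Definition btens : bimod A C.
Proof.
refine (@Bimod A C tens_cx
  (fun c a a' r n m e f x => tla c e f x)
  (fun c' c a n r m e x f => tra a e f x) _ _ _ _ _ _ _ _ _).
- move=> c a a' r n m e; split=> [f|x t f g]; first exact: linearP.
  elim/tens_ind: x => [|x y hx hy|s x hx|b p q i x y].
  + by rewrite !linear0 ?scaler0 ?addr0.
  + by rewrite !linearD hx hy /= ?scalerDr addrACA.
  + by rewrite !linearZ /= hx ?scalerDr !scalerA mulrC.
  + have l : (r + p) + q = m by lia.
    by rewrite !(tla_tg _ _ _ (erefl _) l) blaDl blaZl tgDl tgZl.
- move=> c' c a n r m e; split=> [x t f g|f]; last exact: linearP.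
  elim/tens_ind: x => [|x y hx hy|s x hx|b p q i x y].
  + by rewrite !linear0 ?scaler0 ?addr0.
  + by rewrite !linearD hx hy /= ?scalerDr addrACA.
  + by rewrite !linearZ /= hx ?scalerDr !scalerA mulrC.
  + have l : p + (q + r) = m by lia.
    by rewrite !(tra_tg _ _ _ (erefl _) l) braDr braZr tgDr tgZr.
- move=> c a a' a'' p q r pq qr n e1 e2 e3 e4 g f x.
  elim/tens_ind: x => [|x y hx hy|s x hx|b p' q' i x y].
  + by rewrite !linear0.
  + by rewrite !linearD hx hy.
  + by rewrite !linearZ /= hx.
  + have l1 : (q + p') + q' = qr by lia.
    have l2 : (p + (q + p')) + q' = n by lia.
    have l3 : pq + p' = p + (q + p') by lia.
    rewrite (tla_tg _ _ _ (erefl _) l1) (tla_tg _ _ _ (erefl _) l2).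
    by rewrite (tla_tg _ _ _ l3 l2) (blaA e1 l3 (erefl _) (erefl _)).
- move=> c'' c' c a p q r pq qr n e1 e2 e3 e4 x g f.
  elim/tens_ind: x => [|x y hx hy|s x hx|b p' q' i x y].
  + by rewrite !linear0.
  + by rewrite !linearD hx hy.
  + by rewrite !linearZ /= hx.
  + have l1 : p' + (q' + q) = pq by lia.
    have l2 : p' + ((q' + q) + r) = n by lia.
    have l3 : q' + qr = (q' + q) + r by lia.
    rewrite (tra_tg e1 _ _ (erefl _) l1) (tra_tg e2 _ _ (erefl _) l2).
    by rewrite (tra_tg e4 _ _ l3 l2) (braA (erefl _) (erefl _) e3 l3).
- move=> c' c a a' p q r pq qr n e1 e2 e3 e4 f x g.
  elim/tens_ind: x => [|x y hx hy|s x hx|b p' q' i x y].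
  + by rewrite !linear0.
  + by rewrite !linearD hx hy.
  + by rewrite !linearZ /= hx.
  + have l1 : p' + (q' + r) = qr by lia.
    have l2 : (p + p') + q' = pq by lia.
    have l3 : (p + p') + (q' + r) = n by lia.
    rewrite (tra_tg e3 _ _ (erefl _) l1) (tla_tg e1 _ _ (erefl _) l2).
    by rewrite (tla_tg e4 _ _ (erefl _) l3) (tra_tg e2 _ _ (erefl _) l3).
- move=> c a p e x.
  elim/tens_ind: x => [|x y hx hy|s x hx|b p' q' i x y].
  + by rewrite !linear0.
  + by rewrite !linearD hx hy.
  + by rewrite !linearZ /= hx.
  + by rewrite (tla_tg e _ _ (add0r _) i) bla1.
- move=> c a p e x.
  elim/tens_ind: x => [|x y hx hy|s x hx|b p' q' i x y].
  + by rewrite !linear0.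
  + by rewrite !linearD hx hy.
  + by rewrite !linearZ /= hx.
  + by rewrite (tra_tg e _ _ (addr0 _) i) bra1.
- move=> c a a' r n m r1 n1 m1 e er en em el er'  f x.
  change (td a' c em (tla c e f x) =
    tla c el (cxd (hom a a') er f) x + ksign k r *: tla c er' f (td a c en x)).
  elim/tens_ind: x => [|x y hx hy|s x hx|b p q i x y].
  + by rewrite !linear0 ?scaler0 ?addr0.
  + by rewrite !linearD hx hy ?scalerDr addrACA.
  + by rewrite !(tdZ, tlaZ, traZ) hx scalerDr !scalerA [s * _]mulrC.
  + have l1 : (r + p) + q = m by lia.
    have l2 : (r1 + p) + q = m1 by lia.
    have l3 : (p + 1) + q = n1 by lia.
    have l4 : p + (q + 1) = n1 by lia.
    have l5 : r + p + 1 = r1 + p by lia.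
    have l6 : (r + p) + (q + 1) = m1 by lia.
    have l7 : r + (p + 1) = r1 + p by lia.
    rewrite (tla_tg e _ _ (erefl _) l1) (tla_tg el _ _ (erefl _) l2).
    rewrite (td_tg em l1 l5 (erefl _) l2 l6) (td_tg en i (erefl _) (erefl _) l3 l4).
    rewrite linearD tlaZ (tla_tg er' _ _ l7 l2) (tla_tg er' _ _ (erefl _) l6).
    rewrite (bla_d (erefl _) er (erefl _) l5 (erefl _) l7) tgDl tgZl scalerDr scalerA.
    by rewrite -ksignD addrA.
- move=> c' c a n r m n1 r1 m1 e en er em el er' x f.
  change (td a c' em (tra a e f x) =
    tra a el f (td a c en x) + ksign k n *: tra a er' (cxd (hom c' c) er f) x).
  elim/tens_ind: x => [|x y hx hy|s x hx|b p q i x y].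
  + by rewrite !linear0 ?scaler0 ?addr0.
  + by rewrite !linearD hx hy ?scalerDr addrACA.
  + by rewrite !(tdZ, tlaZ, traZ) hx scalerDr !scalerA [s * _]mulrC.
  + have l1 : p + (q + r) = m by lia.
    have l2 : p + (q + r1) = m1 by lia.
    have l3 : (p + 1) + q = n1 by lia.
    have l4 : p + (q + 1) = n1 by lia.
    have l5 : q + r + 1 = q + r1 by lia.
    have l6 : (p + 1) + (q + r) = m1 by lia.
    have l7 : (q + 1) + r = q + r1 by lia.
    rewrite (tra_tg e _ _ (erefl _) l1) (tra_tg er' _ _ (erefl _) l2).
    rewrite (td_tg em l1 (erefl _) l5 l6 l2) (td_tg en i (erefl _) (erefl _) l3 l4).
    rewrite linearD traZ (tra_tg el _ _ (erefl _) l6) (tra_tg el _ _ l7 l2).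
    rewrite (bra_d (erefl _) (erefl _) er l5 l7 (erefl _)) tgDr tgZr scalerDr scalerA.
    by rewrite -ksignD i addrA.
Defined.

End BComp.

Section BTensMap.
Variables (A B C : dgcat) (F F' : bimod A B) (G G' : bimod B C).
Variables (f : bmor F F') (g : bmor G G').

Section Component.
Variables (c : C) (a : A) (n : int).
Definition tmphi (b : B) (p q : int) (e : p + q = n) (x : F b a p) (y : G c b q) :
  tens F' G' a c n := tg e (f b a p x) (g c b q y).
Fact tmphi_bilin b (p q : int) (e : p + q = n) : is_bilin (@tmphi b p q e).
Proof. by split=> u t v w; rewrite /tmphi linearP ?tgDl ?tgDr ?tgZl ?tgZr. Qed.
Fact tmphi_bal b1 b2 (p s q ps sq : int) (e1 : p + s = ps) (e2 : ps + q = n)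
    (e3 : s + q = sq) (e4 : p + sq = n)
    (x : F b2 a p) (h : hom b1 b2 s) (y : G c b1 q) :
  tmphi e2 (bra e1 x h) y = tmphi e4 x (bla e3 h y).
Proof. by rewrite /tmphi bmor_ra bmor_la (tg_bal e1 e2 e3 e4). Qed.
Definition tm : {linear tens F G a c n -> tens F' G' a c n} := tlift tmphi_bilin tmphi_bal.
Lemma tm_tg (b : B) (p q : int) (e : p + q = n) (x : F b a p) (y : G c b q) :
  tm (tg e x y) = tg e (f b a p x) (g c b q y).
Proof. exact: tlift_tg. Qed.
Lemma tmZ s x : tm (s *: x) = s *: tm x.
Proof. exact: linearZZ. Qed.
End Component.

Fact tm_d c a (n m : int) (e : n + 1 = m) x : tm c a m (td F G a c e x) = td F' G' a c e (tm c a n x).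
Proof.
elim/tens_ind: x => [|x y hx hy|s x hx|b p q i x y].
- by rewrite !linear0.
- by rewrite !linearD hx hy.
- by rewrite !(tdZ, tmZ) hx.
have l1 : (p + 1) + q = m by lia.
have l2 : p + (q + 1) = m by lia.
rewrite (td_tg e i (erefl _) (erefl _) l1 l2) linearD tmZ !tm_tg.
by rewrite (td_tg e i (erefl _) (erefl _) l1 l2) !cmor_d.
Qed.

(* x (x) y |-> f x (x) g y *)
Definition btens_map : bmor (btens F G) (btens F' G').
Proof.
refine (@Bmor _ _ (btens F G) (btens F' G')
  (fun c a => @Cmor (btens F G c a) (btens F' G' c a) (tm c a) (@tm_d c a)) _ _).
- move=> c a a' r n m e h x.
  change (tm c a' m (tla F G c e h x) = tla F' G' c e h (tm c a n x)).
  elim/tens_ind: x => [|x y hx hy|s x hx|b p q i x y].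
  + by rewrite !linear0.
  + by rewrite !linearD hx hy.
  + by rewrite !(tlaZ, tmZ) hx.
  have l : (r + p) + q = m by lia.
  by rewrite (tla_tg e _ _ (erefl _) l) !tm_tg (tla_tg e _ _ (erefl _) l) bmor_la.
- move=> c' c a n r m e x h.
  change (tm c' a m (tra F G a e h x) = tra F' G' a e h (tm c a n x)).
  elim/tens_ind: x => [|x y hx hy|s x hx|b p q i x y].
  + by rewrite !linear0.
  + by rewrite !linearD hx hy.
  + by rewrite !(traZ, tmZ) hx.
  have l : p + (q + r) = m by lia.
  by rewrite (tra_tg e _ _ (erefl _) l) !tm_tg (tra_tg e _ _ (erefl _) l) bmor_ra.
Defined.
End BTensMap.

Section Unitors.
Variables (A B : dgcat) (F : bimod A B).

Section Component.
Variables (b : B) (a : A) (n : int).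
Definition lunphi (b' : B) (p q : int) (e : p + q = n) (x : F b' a p)
  (g : diag B b b' q) : F b a n := bra e x g.
Fact lunphi_bilin b' (p q : int) (e : p + q = n) : is_bilin (@lunphi b' p q e).
Proof. exact: (bra_bilin F _ _ _ e). Qed.
Fact lunphi_bal b1 b2 (p s q ps sq : int) (e1 : p + s = ps) (e2 : ps + q = n)
    (e3 : s + q = sq) (e4 : p + sq = n)
    (x : F b2 a p) (h : hom b1 b2 s) (y : diag B b b1 q) :
  lunphi e2 (bra e1 x h) y = lunphi e4 x (bla e3 h y).
Proof. exact/esym/braA. Qed.
Definition lun : {linear tens F (diag B) a b n -> F b a n} := tlift lunphi_bilin lunphi_bal.
Lemma lun_tg b' (p q : int) (e : p + q = n) (x : F b' a p) (g : diag B b b' q) :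
  lun (tg e x g) = bra e x g.
Proof. exact: tlift_tg. Qed.
Lemma lunZ s x : lun (s *: x) = s *: lun x.
Proof. exact: linearZZ. Qed.

Definition runphi (a' : A) (p q : int) (e : p + q = n) (g : diag A a' a p)
  (x : F b a' q) : F b a n := bla e g x.
Fact runphi_bilin a' (p q : int) (e : p + q = n) : is_bilin (@runphi a' p q e).
Proof. exact: (bla_bilin F _ _ _ e). Qed.
Fact runphi_bal a1 a2 (p s q ps sq : int) (e1 : p + s = ps) (e2 : ps + q = n)
    (e3 : s + q = sq) (e4 : p + sq = n)
    (x : diag A a2 a p) (h : hom a1 a2 s) (y : F b a1 q) :
  runphi e2 (bra e1 x h) y = runphi e4 x (bla e3 h y).
Proof. exact/esym/blaA. Qed.
Definition run : {linear tens (diag A) F a b n -> F b a n} := tlift runphi_bilin runphi_bal.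
Lemma run_tg a' (p q : int) (e : p + q = n) (g : diag A a' a p) (x : F b a' q) :
  run (tg e g x) = bla e g x.
Proof. exact: tlift_tg. Qed.
Lemma runZ s x : run (s *: x) = s *: run x.
Proof. exact: linearZZ. Qed.
End Component.

Fact lun_d b a (n m : int) (e : n + 1 = m) x :
  lun b a m (td F (diag B) a b e x) = cxd _ e (lun b a n x).
Proof.
elim/tens_ind: x => [|x y hx hy|s x hx|b' p q i x y].
- by rewrite !linear0.
- by rewrite !linearD hx hy.
- by rewrite tdZ !lunZ linearZZ hx.
have l1 : (p + 1) + q = m by lia.
have l2 : p + (q + 1) = m by lia.
rewrite (td_tg e i (erefl _) (erefl _) l1 l2) linearD lunZ !lun_tg.
by rewrite (bra_d i (erefl _) (erefl _) e l1 l2).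
Qed.

Fact run_d b a (n m : int) (e : n + 1 = m) x :
  run b a m (td (diag A) F a b e x) = cxd _ e (run b a n x).
Proof.
elim/tens_ind: x => [|x y hx hy|s x hx|b' p q i x y].
- by rewrite !linear0.
- by rewrite !linearD hx hy.
- by rewrite tdZ !runZ linearZZ hx.
have l1 : (p + 1) + q = m by lia.
have l2 : p + (q + 1) = m by lia.
rewrite (td_tg e i (erefl _) (erefl _) l1 l2) linearD runZ !run_tg.
by rewrite (bla_d i (erefl _) (erefl _) e l1 l2).
Qed.

(* h_B <> F -> F, x (x) g |-> x g *)
Definition left_unitor : bmor (btens F (diag B)) F.
Proof.
refine (@Bmor _ _ (btens F (diag B)) F
  (fun b a => @Cmor (btens F (diag B) b a) (F b a) (lun b a) (@lun_d b a)) _ _).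
- move=> b a a' r n m e h x.
  change (lun b a' m (tla F (diag B) b e h x) = bla e h (lun b a n x)).
  elim/tens_ind: x => [|x y hx hy|s x hx|b' p q i x y].
  + by rewrite !linear0 bla0r.
  + by rewrite !linearD hx hy blaDr.
  + by rewrite tlaZ !lunZ hx blaZr.
  have l : (r + p) + q = m by lia.
  by rewrite (tla_tg e _ _ (erefl _) l) !lun_tg (blra (erefl _) l i e).
- move=> b' b a n r m e x h.
  change (lun b' a m (tra F (diag B) a e h x) = bra e (lun b a n x) h).
  elim/tens_ind: x => [|x y hx hy|s x hx|b'' p q i x y].
  + by rewrite !linear0 bra0l.
  + by rewrite !linearD hx hy braDl.
  + by rewrite traZ !lunZ hx braZl.
  have l : p + (q + r) = m by lia.
  by rewrite (tra_tg e _ _ (erefl _) l) !lun_tg (braA i e (erefl _) l).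
Defined.

(* F <> h_A -> F, g (x) x |-> g x *)
Definition right_unitor : bmor (btens (diag A) F) F.
Proof.
refine (@Bmor _ _ (btens (diag A) F) F
  (fun b a => @Cmor (btens (diag A) F b a) (F b a) (run b a) (@run_d b a)) _ _).
- move=> b a a' r n m e h x.
  change (run b a' m (tla (diag A) F b e h x) = bla e h (run b a n x)).
  elim/tens_ind: x => [|x y hx hy|s x hx|b' p q i x y].
  + by rewrite !linear0 bla0r.
  + by rewrite !linearD hx hy blaDr.
  + by rewrite tlaZ !runZ hx blaZr.
  have l : (r + p) + q = m by lia.
  by rewrite (tla_tg e _ _ (erefl _) l) !run_tg (blaA (erefl _) l i e).
- move=> b' b a n r m e x h.
  change (run b' a m (tra (diag A) F a e h x) = bra e (run b a n x) h).
  elim/tens_ind: x => [|x y hx hy|s x hx|b'' p q i x y].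
  + by rewrite !linear0 bra0l.
  + by rewrite !linearD hx hy braDl.
  + by rewrite traZ !runZ hx braZl.
  have l : p + (q + r) = m by lia.
  by rewrite (tra_tg e _ _ (erefl _) l) !run_tg (blra i e (erefl _) l).
Defined.
End Unitors.

Section Associator.
Variables (A B C D : dgcat) (F : bimod A B) (G : bimod B C) (H : bimod C D).

Fact degA (p q r s n : int) : p + q = n -> r + s = q -> (p + r) + s = n.
Proof. lia. Qed.
Fact degA' (p q r s n : int) : p + q = n -> r + s = p -> r + (s + q) = n.
Proof. lia. Qed.

Section Component.
Variables (d : D) (a : A) (n : int).

Section Inner.
Variables (b : B) (p q : int) (e : p + q = n) (x : F b a p).
Definition as1phi (c : C) (r s : int) (i : r + s = q) (y : G c b r) (z : H d c s) :
    tens (btens F G) H a d n :=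
  @tg A C D (btens F G) H a d n c (p + r) s (degA e i) (tg (erefl (p + r)) x y) z.
Lemma as1phiE (c : C) (r s pr : int) (i : r + s = q) (j : p + r = pr) (l : pr + s = n)
    (y : G c b r) (z : H d c s) :
  as1phi i y z = @tg A C D (btens F G) H a d n c pr s l (tg j x y) z.
Proof. by subst pr; rewrite /as1phi (int_irr (degA e i) l). Qed.
Fact as1phi_bilin c (r s : int) (i : r + s = q) : is_bilin (@as1phi c r s i).
Proof. by split=> u t v w; rewrite /as1phi !(tgDl, tgDr, tgZl, tgZr). Qed.
Fact as1phi_bal c1 c2 (r t s rt ts : int) (e1 : r + t = rt) (e2 : rt + s = q)
    (e3 : t + s = ts) (e4 : r + ts = q)
    (y : G c2 b r) (h : hom c1 c2 t) (z : H d c1 s) :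
  as1phi e2 (bra e1 y h) z = as1phi e4 y (bla e3 h z).
Proof.
have l1 : (p + r) + t = p + rt by lia.
have l2 : (p + rt) + s = n by lia.
have l3 : (p + r) + ts = n by lia.
rewrite (as1phiE e2 (erefl _) l2) (as1phiE e4 (erefl _) l3).
rewrite -(tg_bal (F := btens F G) l1 l2 e3 l3).
congr (tg _ _ _); exact/esym/tra_tg.
Qed.
Definition as1 : {linear tens G H b d q -> tens (btens F G) H a d n} :=
  tlift as1phi_bilin as1phi_bal.
Lemma as1_tg (c : C) (r s pr : int) (i : r + s = q) (j : p + r = pr) (l : pr + s = n)
    (y : G c b r) (z : H d c s) :
  as1 (tg i y z) = @tg A C D (btens F G) H a d n c pr s l (tg j x y) z.
Proof. by rewrite tlift_tg; apply: as1phiE. Qed.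
Lemma as1Z s w : as1 (s *: w) = s *: as1 w.
Proof. exact: linearZZ. Qed.
End Inner.

Fact as1_bilin b (p q : int) (e : p + q = n) : is_bilin (fun x => @as1 b p q e x : _ -> _).
Proof.
split=> [x|w t x x']; first exact: linearP.
elim/tens_ind: w => [|w w' hw hw'|s w hw|c r s i y z].
- by rewrite !linear0 ?scaler0 ?addr0.
- by rewrite !linearD hw hw' ?scalerDr addrACA.
- by rewrite !as1Z hw scalerDr !scalerA mulrC.
- have l : (p + r) + s = n by lia.
  by rewrite !(as1_tg e _ _ (erefl _) l) !(tgDl, tgZl).
Qed.

Fact as1_bal b1 b2 (p s q ps sq : int) (e1 : p + s = ps) (e2 : ps + q = n)
    (e3 : s + q = sq) (e4 : p + sq = n)
    (x : F b2 a p) (h : hom b1 b2 s) (w : btens G H d b1 q) :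
  as1 e2 (bra e1 x h) w = as1 e4 x (bla e3 h w).
Proof.
change (as1 e2 (bra e1 x h) w = as1 e4 x (tla G H d e3 h w)).
elim/tens_ind: w => [|w w' hw hw'|t w hw|c r t i y z].
- by rewrite !linear0.
- by rewrite !linearD hw hw'.
- by rewrite tlaZ !as1Z hw.
have l1 : (s + r) + t = sq by lia.
have l2 : p + (s + r) = ps + r by lia.
have l3 : (ps + r) + t = n by lia.
rewrite (tla_tg e3 h i (erefl _) l1) (as1_tg e2 _ i (erefl _) l3).
by rewrite (as1_tg e4 _ l1 l2 l3) (tg_bal e1 (erefl _) (erefl _) l2).
Qed.

Definition asl : {linear tens F (btens G H) a d n -> tens (btens F G) H a d n} :=
  tlift (G := btens G H) as1_bilin as1_bal.
Lemma asl_tg b (p q : int) (e : p + q = n) (x : F b a p) (w : btens G H d b q) :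
  asl (tg e x w) = as1 e x w.
Proof. exact: tlift_tg. Qed.
Lemma aslZ s w : asl (s *: w) = s *: asl w.
Proof. exact: linearZZ. Qed.

Section Inner'.
Variables (c : C) (p q : int) (e : p + q = n) (z : H d c q).
Definition as2phi (b : B) (r s : int) (i : r + s = p) (x : F b a r) (y : G c b s) :
    tens F (btens G H) a d n :=
  @tg A B D F (btens G H) a d n b r (s + q) (degA' e i) x (tg (erefl (s + q)) y z).
Lemma as2phiE (b : B) (r s sq : int) (i : r + s = p) (j : s + q = sq) (l : r + sq = n)
    (x : F b a r) (y : G c b s) :
  as2phi i x y = @tg A B D F (btens G H) a d n b r sq l x (tg j y z).
Proof. by subst sq; rewrite /as2phi (int_irr (degA' e i) l). Qed.
Fact as2phi_bilin b (r s : int) (i : r + s = p) : is_bilin (@as2phi b r s i).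
Proof. by split=> u t v w; rewrite /as2phi !(tgDl, tgDr, tgZl, tgZr). Qed.
Fact as2phi_bal b1 b2 (r t s rt ts : int) (e1 : r + t = rt) (e2 : rt + s = p)
    (e3 : t + s = ts) (e4 : r + ts = p)
    (x : F b2 a r) (h : hom b1 b2 t) (y : G c b1 s) :
  as2phi e2 (bra e1 x h) y = as2phi e4 x (bla e3 h y).
Proof.
have l1 : t + (s + q) = ts + q by lia.
have l2 : rt + (s + q) = n by lia.
have l3 : r + (ts + q) = n by lia.
rewrite (as2phiE e2 (erefl _) l2) (as2phiE e4 (erefl _) l3).
rewrite (tg_bal (G := btens G H) e1 l2 l1 l3).
congr (tg _ _ _); exact: tla_tg.
Qed.
Definition as2 : {linear tens F G a c p -> tens F (btens G H) a d n} :=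
  tlift as2phi_bilin as2phi_bal.
Lemma as2_tg (b : B) (r s sq : int) (i : r + s = p) (j : s + q = sq) (l : r + sq = n)
    (x : F b a r) (y : G c b s) :
  as2 (tg i x y) = @tg A B D F (btens G H) a d n b r sq l x (tg j y z).
Proof. by rewrite tlift_tg; apply: as2phiE. Qed.
Lemma as2Z s w : as2 (s *: w) = s *: as2 w.
Proof. exact: linearZZ. Qed.
End Inner'.

Fact as2_bilin c (p q : int) (e : p + q = n) : is_bilin (fun w z => @as2 c p q e z w).
Proof.
split=> [w t z z'|z]; last exact: linearP.
elim/tens_ind: w => [|w w' hw hw'|s w hw|b r s i x y].
- by rewrite !linear0 ?scaler0 ?addr0.
- by rewrite !linearD hw hw' ?scalerDr addrACA.
- by rewrite !as2Z hw scalerDr !scalerA mulrC.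
- have l : r + (s + q) = n by lia.
  by rewrite !(as2_tg e _ _ (erefl _) l) !(tgDr, tgZr).
Qed.

Fact as2_bal c1 c2 (p s q ps sq : int) (e1 : p + s = ps) (e2 : ps + q = n)
    (e3 : s + q = sq) (e4 : p + sq = n)
    (w : btens F G c2 a p) (h : hom c1 c2 s) (z : H d c1 q) :
  as2 e2 z (bra e1 w h) = as2 e4 (bla e3 h z) w.
Proof.
change (as2 e2 z (tra F G a e1 h w) = as2 e4 (bla e3 h z) w).
elim/tens_ind: w => [|w w' hw hw'|t w hw|b r t i x y].
- by rewrite !linear0.
- by rewrite !linearD hw hw'.
- by rewrite traZ !as2Z hw.
have l1 : r + (t + s) = ps by lia.
have l2 : (t + s) + q = t + sq by lia.
have l3 : r + (t + sq) = n by lia.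
rewrite (tra_tg e1 h i (erefl _) l1) (as2_tg e4 _ i (erefl _) l3).
by rewrite (as2_tg e2 _ l1 l2 l3) (tg_bal (erefl _) l2 e3 (erefl _)).
Qed.

Definition asr : {linear tens (btens F G) H a d n -> tens F (btens G H) a d n} :=
  tlift (F := btens F G) as2_bilin as2_bal.
Lemma asr_tg c (p q : int) (e : p + q = n) (w : btens F G c a p) (z : H d c q) :
  asr (tg e w z) = as2 e z w.
Proof. exact: tlift_tg. Qed.
Lemma asrZ s w : asr (s *: w) = s *: asr w.
Proof. exact: linearZZ. Qed.
End Component.

Section ComponentD.
Variables (d : D) (a : A) (n m : int) (e : n + 1 = m).

Fact asl_d w : asl d a m (td F (btens G H) a d e w) = td (btens F G) H a d e (asl d a n w).
Proof.
elim/tens_ind: w => [|w w' hw hw'|t w hw|b p q i x w].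
- by rewrite !linear0.
- by rewrite !linearD hw hw'.
- by rewrite !(tdZ, aslZ) hw.
have l1 : (p + 1) + q = m by lia.
have l2 : p + (q + 1) = m by lia.
rewrite asl_tg (td_tg e i (erefl _) (erefl _) l1 l2) linearD aslZ !asl_tg.
change (as1 d l1 (cxd (F b a) (erefl (p + 1)) x) w +
    ksign k p *: as1 d l2 x (td G H b d (erefl (q + 1)) w) =
  td (btens F G) H a d e (as1 d i x w)).
elim/tens_ind: w => [|w w' hw hw'|t w hw|c r s j y z].
- by rewrite !linear0 ?scaler0 ?addr0.
- by rewrite !linearD -hw -hw' ?scalerDr addrACA.
- by rewrite !(tdZ, as1Z) -hw scalerDr !scalerA [t * _]mulrC.
have m1 : (p + r) + s = n by lia.
have m2 : (p + 1) + r = p + r + 1 by lia.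
have m3 : p + (r + 1) = p + r + 1 by lia.
have m4 : (p + r + 1) + s = m by lia.
have m5 : (p + r) + (s + 1) = m by lia.
have m6 : (r + 1) + s = q + 1 by lia.
have m7 : r + (s + 1) = q + 1 by lia.
rewrite (as1_tg i _ j (erefl _) m1) (as1_tg l1 _ j m2 m4).
rewrite (td_tg (erefl (q + 1)) j (erefl _) (erefl _) m6 m7) linearD as1Z.
rewrite (as1_tg l2 _ m6 m3 m4) (as1_tg l2 _ m7 (erefl _) m5).
rewrite (td_tg (F := btens F G) e m1 (erefl _) (erefl _) m4 m5).
have -> : cxd (btens F G c a) (erefl (p + r + 1)) (tg (erefl (p + r)) x y) =
    tg m2 (cxd _ (erefl _) x) y + ksign k p *: tg m3 x (cxd _ (erefl _) y).
  exact: td_tg.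
rewrite (tgDl (F := btens F G)) (tgZl (F := btens F G)) scalerDr scalerA.
by rewrite -ksignD addrA.
Qed.

Fact asr_d w : asr d a m (td (btens F G) H a d e w) = td F (btens G H) a d e (asr d a n w).
Proof.
elim/tens_ind: w => [|w w' hw hw'|t w hw|c p q i w z].
- by rewrite !linear0.
- by rewrite !linearD hw hw'.
- by rewrite !(tdZ, asrZ) hw.
have l1 : (p + 1) + q = m by lia.
have l2 : p + (q + 1) = m by lia.
rewrite asr_tg (td_tg e i (erefl _) (erefl _) l1 l2) linearD asrZ !asr_tg.
change (as2 a l1 z (td F G a c (erefl (p + 1)) w) +
    ksign k p *: as2 a l2 (cxd (H d c) (erefl (q + 1)) z) w =
  td F (btens G H) a d e (as2 a i z w)).
elim/tens_ind: w => [|w w' hw hw'|t w hw|b r s j x y].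
- by rewrite !linear0 ?scaler0 ?addr0.
- by rewrite !linearD -hw -hw' ?scalerDr addrACA.
- by rewrite !(tdZ, as2Z) -hw scalerDr !scalerA [t * _]mulrC.
have m1 : r + (s + q) = n by lia.
have m2 : (s + 1) + q = s + q + 1 by lia.
have m3 : s + (q + 1) = s + q + 1 by lia.
have m4 : (r + 1) + (s + q) = m by lia.
have m5 : r + (s + q + 1) = m by lia.
have m6 : (r + 1) + s = p + 1 by lia.
have m7 : r + (s + 1) = p + 1 by lia.
rewrite (as2_tg i _ j (erefl _) m1) (as2_tg l2 _ j m3 m5).
rewrite (td_tg (erefl (p + 1)) j (erefl _) (erefl _) m6 m7) linearD as2Z.
rewrite (as2_tg l1 _ m6 (erefl _) m4) (as2_tg l1 _ m7 m2 m5).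
rewrite (td_tg (G := btens G H) e m1 (erefl _) (erefl _) m4 m5).
have -> : cxd (btens G H d b) (erefl (s + q + 1)) (tg (erefl (s + q)) y z) =
    tg m2 (cxd _ (erefl _) y) z + ksign k s *: tg m3 y (cxd _ (erefl _) z).
  exact: td_tg.
rewrite (tgDr (G := btens G H)) (tgZr (G := btens G H)) scalerDr scalerA.
by rewrite -ksignD -j addrA.
Qed.
End ComponentD.

(* (H <> G) <> F -> H <> (G <> F), x (x) (y (x) z) |-> (x (x) y) (x) z *)
Definition associator_l :
  bmor (btens F (btens G H)) (btens (btens F G) H).
Proof.
refine (@Bmor _ _ (btens F (btens G H)) (btens (btens F G) H)
  (fun d a => @Cmor (btens F (btens G H) d a) (btens (btens F G) H d a) (asl d a)
     (@asl_d d a)) _ _).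
- move=> d a a' t n m e h w.
  change (asl d a' m (tla F (btens G H) d e h w) =
    tla (btens F G) H d e h (asl d a n w)).
  elim/tens_ind: w => [|w w' hw hw'|s w hw|b p q i x w].
  + by rewrite !linear0.
  + by rewrite !linearD hw hw'.
  + by rewrite !(tlaZ, aslZ) hw.
  have l : (t + p) + q = m by lia.
  rewrite (tla_tg e h i (erefl _) l) !asl_tg.
  elim/tens_ind: w => [|w w' hw hw'|s w hw|c r s j y z].
  + by rewrite !linear0.
  + by rewrite !linearD hw hw'.
  + by rewrite !(tlaZ, as1Z) hw.
  have m1 : (p + r) + s = n by lia.
  have m2 : (t + p) + r = t + (p + r) by lia.
  have m3 : (t + (p + r)) + s = m by lia.
  rewrite (as1_tg i _ j (erefl _) m1) (as1_tg l _ j m2 m3).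
  rewrite (tla_tg (F := btens F G) e h m1 (erefl _) m3); congr (tg _ _ _).
  exact/esym/tla_tg.
- move=> d' d a n t m e w h.
  change (asl d' a m (tra F (btens G H) a e h w) =
    tra (btens F G) H a e h (asl d a n w)).
  elim/tens_ind: w => [|w w' hw hw'|s w hw|b p q i x w].
  + by rewrite !linear0.
  + by rewrite !linearD hw hw'.
  + by rewrite !(traZ, aslZ) hw.
  have l : p + (q + t) = m by lia.
  rewrite (tra_tg e h i (erefl _) l) !asl_tg.
  change (as1 d' l x (tra G H b (erefl (q + t)) h w) =
    tra (btens F G) H a e h (as1 d i x w)).
  elim/tens_ind: w => [|w w' hw hw'|s w hw|c r s j y z].
  + by rewrite !linear0.
  + by rewrite !linearD hw hw'.
  + by rewrite !(traZ, as1Z) hw.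
  have m1 : (p + r) + s = n by lia.
  have m2 : r + (s + t) = q + t by lia.
  have m3 : (p + r) + (s + t) = m by lia.
  rewrite (as1_tg i _ j (erefl _) m1) (tra_tg _ h j (erefl _) m2).
  by rewrite (as1_tg l _ m2 (erefl _) m3) (tra_tg (F := btens F G) e h m1 (erefl _) m3).
Defined.

(* H <> (G <> F) -> (H <> G) <> F, (x (x) y) (x) z |-> x (x) (y (x) z) *)
Definition associator_r :
  bmor (btens (btens F G) H) (btens F (btens G H)).
Proof.
refine (@Bmor _ _ (btens (btens F G) H) (btens F (btens G H))
  (fun d a => @Cmor (btens (btens F G) H d a) (btens F (btens G H) d a) (asr d a)
     (@asr_d d a)) _ _).
- move=> d a a' t n m e h w.
  change (asr d a' m (tla (btens F G) H d e h w) =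
    tla F (btens G H) d e h (asr d a n w)).
  elim/tens_ind: w => [|w w' hw hw'|s w hw|c p q i w z].
  + by rewrite !linear0.
  + by rewrite !linearD hw hw'.
  + by rewrite !(tlaZ, asrZ) hw.
  have l : (t + p) + q = m by lia.
  rewrite (tla_tg e h i (erefl _) l) !asr_tg.
  change (as2 a' l z (tla F G c (erefl (t + p)) h w) =
    tla F (btens G H) d e h (as2 a i z w)).
  elim/tens_ind: w => [|w w' hw hw'|s w hw|b r s j x y].
  + by rewrite !linear0.
  + by rewrite !linearD hw hw'.
  + by rewrite !(tlaZ, as2Z) hw.
  have m1 : r + (s + q) = n by lia.
  have m2 : (t + r) + s = t + p by lia.
  have m3 : (t + r) + (s + q) = m by lia.
  rewrite (as2_tg i _ j (erefl _) m1) (tla_tg _ h j (erefl _) m2).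
  by rewrite (as2_tg l _ m2 (erefl _) m3) (tla_tg (G := btens G H) e h m1 (erefl _) m3).
- move=> d' d a n t m e w h.
  change (asr d' a m (tra (btens F G) H a e h w) =
    tra F (btens G H) a e h (asr d a n w)).
  elim/tens_ind: w => [|w w' hw hw'|s w hw|c p q i w z].
  + by rewrite !linear0.
  + by rewrite !linearD hw hw'.
  + by rewrite !(traZ, asrZ) hw.
  have l : p + (q + t) = m by lia.
  rewrite (tra_tg e h i (erefl _) l) !asr_tg.
  elim/tens_ind: w => [|w w' hw hw'|s w hw|b r s j x y].
  + by rewrite !linear0.
  + by rewrite !linearD hw hw'.
  + by rewrite !(traZ, as2Z) hw.
  have m1 : r + (s + q) = n by lia.
  have m2 : s + (q + t) = s + q + t by lia.
  have m3 : r + (s + q + t) = m by lia.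
  rewrite (as2_tg i _ j (erefl _) m1) (as2_tg l _ j m2 m3).
  rewrite (tra_tg (G := btens G H) e h m1 (erefl _) m3); congr (tg _ _ _).
  exact/esym/tra_tg.
Defined.
End Associator.

(* h-projective resolutions Q M -> M of bimodules.  As Q M is h-projective,
   [res_map f] is determined by f up to homotopy, so that it is functorial. *)
Record bimod_resolution (A B : dgcat) := BimodResolution {
  res :> bimod A B -> bimod A B;
  res_hproj : forall M, hproj (res M);
  res_mor : forall M, bmor (res M) M;
  res_quasi_iso : forall M, bquasi_iso (res_mor M);
  res_map : forall M N, dmor M N -> bmor (res M) (res N);
  res_natural : forall M N (f : dmor M N),
    deq (Dcomp (Dof (res_mor N)) (Dof (res_map f))) (Dcomp f (Dof (res_mor M)))
}.

Section DBimod.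
Variable Q : forall A B : dgcat, bimod_resolution A B.

(* G <>^L F *)
Definition dcomp (A B C : dgcat) (G : bimod B C) (F : bimod A B) : bimod A C :=
  btens (Q A B F) (Q B C G).

Definition dhcomp (A B C : dgcat) (G G' : bimod B C) (F F' : bimod A B)
    (v : dmor G G') (u : dmor F F') : dmor (dcomp G F) (dcomp G' F') :=
  Dof (btens_map (res_map (Q A B) u) (res_map (Q B C) v)).

(* h_B <>^L F -> F *)
Definition dleft_unitor (A B : dgcat) (F : bimod A B) : dmor (dcomp (diag B) F) F :=
  Dof (bcompm (left_unitor F)
    (btens_map (res_mor (Q A B) F) (res_mor (Q B B) (diag B)))).

(* F <>^L h_A -> F *)
Definition dright_unitor (A B : dgcat) (F : bimod A B) : dmor (dcomp F (diag A)) F :=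
  Dof (bcompm (right_unitor F)
    (btens_map (res_mor (Q A A) (diag A)) (res_mor (Q A B) F))).

Section DAssociator.
Variables (A B C D : dgcat) (F : bimod A B) (G : bimod B C) (H : bimod C D).

(* (H <>^L G) <>^L F -> Q H <> (Q G <> Q F) and
   H <>^L (G <>^L F) -> (Q H <> Q G) <> Q F *)
Definition compare_l : bmor (dcomp (dcomp H G) F)
    (btens (Q A B F) (btens (Q B C G) (Q C D H))) :=
  btens_map (bid (Q A B F)) (res_mor (Q B D) (dcomp H G)).
Definition compare_r : bmor (dcomp H (dcomp G F))
    (btens (btens (Q A B F) (Q B C G)) (Q C D H)) :=
  btens_map (res_mor (Q A C) (dcomp G F)) (bid (Q C D H)).

(* The two mutually inverse associativity isomorphisms of the derived
   composition.  Over h-projective dg-categories both comparison morphisms are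
   quasi-isomorphisms. *)
Definition dassociator (w : bquasi_iso compare_r) :
    dmor (dcomp (dcomp H G) F) (dcomp H (dcomp G F)) :=
  Dcomp (Dinv w) (Dof (bcompm (associator_l _ _ _) compare_l)).
Definition dassociator_inv (w : bquasi_iso compare_l) :
    dmor (dcomp H (dcomp G F)) (dcomp (dcomp H G) F) :=
  Dcomp (Dinv w) (Dof (bcompm (associator_r _ _ _) compare_r)).
End DAssociator.

Definition triangle_l (A B : dgcat) (S : bimod A B) (G : bimod B A)
    (eta : dmor (diag A) (dcomp G S)) (eps : dmor (dcomp S G) (diag B)) :=
  exists w : bquasi_iso (compare_l S G S),
    deq (Dcomp (dleft_unitor S) (Dcomp (dhcomp eps (Dof (bid S)))
          (Dcomp (dassociator_inv w) (dhcomp (Dof (bid S)) eta))))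
        (dright_unitor S).

Definition triangle_r (A B : dgcat) (S : bimod A B) (G : bimod B A)
    (eta : dmor (diag A) (dcomp G S)) (eps : dmor (dcomp S G) (diag B)) :=
  exists w : bquasi_iso (compare_r G S G),
    deq (Dcomp (dright_unitor G) (Dcomp (dhcomp (Dof (bid G)) eps)
          (Dcomp (dassociator w) (dhcomp eta (Dof (bid G))))))
        (dleft_unitor G).

(* S -| G in DBimod *)
Definition left_adjoint (A B : dgcat) (S : bimod A B) (G : bimod B A) :=
  exists (eta : dmor (diag A) (dcomp G S)) (eps : dmor (dcomp S G) (diag B)),
    triangle_l eta eps /\ triangle_r eta eps.

End DBimod.

End Complexes.

(* Main.v *)
(* The left adjoint of G is its left dual S(b, a) = Hom_B(QG(a, -), B(b, -)),
   the complex of morphisms of left B-modules.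

   If QG(a, -) is quasi-isomorphic to a representable B(b0, -), then, being
   h-projective, it is homotopy equivalent to it.  Hence X (x)_B QG(a, -) is
   homotopy equivalent to X(b0) for every X, so that the natural morphism
   S (x)_B QG -> Hom_B(QG, QG) is a quasi-isomorphism, natural in a.  The unit
   of the adjunction is the action of A on QG followed by the inverse of this
   quasi-isomorphism, and the counit is evaluation; the triangular identities
   then hold up to homotopy already before localisation.

   Conversely, let S -| G with S(-, a) represented by s in S(b0, a).  Then
   QS(-, a) is homotopy equivalent to B(-, b0), so the image of id_a under the
   unit is the class of s (x) e for some cocycle e in QG(a, b0).  By the
   triangular identities, f |-> f e and x |-> eps(x (x) s) are mutually inverse
   between the cohomologies of B(b0, b) and of QG(a, b).

   Both directions use that the restriction P(-, a) of an h-projective bimodule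
   is h-projective: restriction has the right adjoint
   N |-> Hom_k(A(-, a), N), which preserves acyclicity because the complexes
   A(a', a) are h-projective. *)

From HB Require Import structures.
From Stdlib Require Import Relation_Operators.
From mathcomp Require Import all_boot all_order all_algebra.
From mathcomp Require Import boolp zify.
Require Import Defs.
Set Implicit Arguments.
Unset Strict Implicit.
Unset Printing Implicit Defensive.
Import GRing.Theory.
Local Open Scope ring_scope.

(** * Cocycles and quasi-isomorphisms *)

(** A morphism of D(A, B) is a word in morphisms and formal inverses modulo a congruence, so nothing
    can be read off it directly. It is reached through two functors that invert quasi-isomorphisms:
    H^n of a component (b, a), which evaluates unit and counit on elements, and homotopy classes of
    morphisms out of an h-projective bimodule, which turn equalities in D into homotopies. The
    associativity isomorphisms contain a formal inverse too; that the comparison morphism inverted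
    there is a quasi-isomorphism is part of each triangular identity, and is proved from the
    representability up to homotopy of QS(-, a) and QG(a, -). The underived Hom that defines S is
    already the right one, because QG(a, -) is homotopy equivalent to a representable. For the
    triangular identities, S (x)_B QG is compared with Hom_B(QG, QG): there the unit becomes the
    right action of A on QG, and what remains are strict equalities between evaluation and
    composition of maps. Maps in Hom complexes act on the right of their argument, so that actions,
    evaluation and composition carry no sign. *)

Definition lin_of (k : comPzRingType) (U V : lmodType k) (f : U -> V) (hf : linear f) :
    {linear U -> V} :=
  HB.pack f (GRing.isLinear.Build k U V *:%R f hf).

Section Linear.
Variables (k : comPzRingType) (U V W : lmodType k).
Lemma linear_comp (f : {linear V -> W}) (g : {linear U -> V}) : linear (fun x => f (g x)).
Proof. by move=> t x y; rewrite !linearP. Qed.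
Lemma linear_add (f g : {linear U -> V}) : linear (fun x => f x + g x).
Proof. by move=> t x y; rewrite !linearP scalerDr addrACA. Qed.
Lemma linear_scale t (f : {linear U -> V}) : linear (fun x => t *: f x).
Proof. by move=> s x y; rewrite linearP scalerDr !scalerA mulrC. Qed.
End Linear.

Definition cmor_of (k : comPzRingType) (C D : cochain k) (f : forall n, C n -> D n)
    (fl : forall n, linear (f n))
    (fd : forall (n m : int) (e : n + 1 = m) x, f m (cxd C e x) = cxd D e (f n x)) :
    cmor C D :=
  @Cmor k C D (fun n => lin_of (fl n)) fd.

Definition bmor_of (k : comPzRingType) (A B : dgcat k) (M N : bimod A B)
    (f : forall b a n, M b a n -> N b a n)
    (fl : forall b a n, linear (f b a n))
    (fd : forall b a (n m : int) (e : n + 1 = m) x,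
      f b a m (cxd (M b a) e x) = cxd (N b a) e (f b a n x))
    (fla : forall b a a' (p q n : int) (e : p + q = n) (u : hom a a' p) (x : M b a q),
      f b a' n (bla e u x) = bla e u (f b a q x))
    (fra : forall b' b a (p q n : int) (e : p + q = n) (x : M b a p) (u : hom b' b q),
      f b' a n (bra e x u) = bra e (f b a p x) u) : bmor M N :=
  @Bmor k A B M N (fun b a => cmor_of (fl b a) (fd b a)) fla fra.

Section Opposites.
Variables (k : comPzRingType) (A B : dgcat k) (T : bimod A B).
Lemma blaNr b a a' (p q n : int) (e : p + q = n) (f : hom a a' p) (x : T b a q) :
  bla e f (- x) = - bla e f x.
Proof. by rewrite -scaleN1r blaZr scaleN1r. Qed.
Lemma blaNl b a a' (p q n : int) (e : p + q = n) (f : hom a a' p) (x : T b a q) :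
  bla e (- f) x = - bla e f x.
Proof. by rewrite -scaleN1r blaZl scaleN1r. Qed.
Lemma braNr b b' a (p q n : int) (e : p + q = n) (x : T b a p) (f : hom b' b q) :
  bra e x (- f) = - bra e x f.
Proof. by rewrite -scaleN1r braZr scaleN1r. Qed.
Lemma braNl b b' a (p q n : int) (e : p + q = n) (x : T b a p) (f : hom b' b q) :
  bra e (- x) f = - bra e x f.
Proof. by rewrite -scaleN1r braZl scaleN1r. Qed.
Lemma bla0l b a a' (p q n : int) (e : p + q = n) (x : T b a q) :
  bla e (0 : hom a a' p) x = 0.
Proof. by rewrite -(scale0r 0) blaZl scale0r. Qed.
End Opposites.

Section Cohomology.
Variable k : comPzRingType.
Implicit Types C D E : cochain k.

Definition cyc C n (x : C n) := forall m (e : n + 1 = m), cxd C e x = 0.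
Definition bd C n (x : C n) := exists m (e : m + 1 = n) (y : C m), x = cxd C e y.
Definition coh C n (x y : C n) := bd (x - y).

Lemma cycP C n m (e : n + 1 = m) (x : C n) : cxd C e x = 0 -> cyc x.
Proof. by move=> h l e'; subst m l. Qed.

Lemma bdP C n m (e : m + 1 = n) (x : C n) : bd x -> exists y : C m, x = cxd C e y.
Proof.
case=> m' [e' [y ->]]; have em : m' = m by lia.
by subst m'; exists y; rewrite (int_irr e e').
Qed.

Lemma bd_d C m n (e : m + 1 = n) (y : C m) : bd (cxd C e y).
Proof. by exists m, e, y. Qed.
Lemma bd0 C n : bd (0 : C n).
Proof. by exists (n - 1), (subrK _ _), 0; rewrite linear0. Qed.
Lemma bdP_lin C n t (x y : C n) : bd x -> bd y -> bd (t *: x + y).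
Proof.
move=> /(bdP (subrK 1 n))[u ->] /(bdP (subrK 1 n))[v ->].
by rewrite -linearP; apply: bd_d.
Qed.
Lemma bdD C n (x y : C n) : bd x -> bd y -> bd (x + y).
Proof. by move=> hx; rewrite -[x]scale1r; apply: bdP_lin. Qed.
Lemma bdZ C n t (x : C n) : bd x -> bd (t *: x).
Proof. by move=> hx; rewrite -[_ *: _]addr0; apply: bdP_lin (bd0 _ _). Qed.
Lemma bdN C n (x : C n) : bd x -> bd (- x).
Proof. by rewrite -scaleN1r; apply: bdZ. Qed.
Lemma bdB C n (x y : C n) : bd x -> bd y -> bd (x - y).
Proof. by move=> hx /bdN; apply: bdD. Qed.
Lemma bd_cyc C n (x : C n) : bd x -> cyc x.
Proof. by move=> [m [e [y ->]]] l e'; rewrite cxd_cxd. Qed.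

Lemma cyc0 C n : cyc (0 : C n).
Proof. by move=> m e; rewrite linear0. Qed.
Lemma cycD C n (x y : C n) : cyc x -> cyc y -> cyc (x + y).
Proof. by move=> hx hy m e; rewrite linearD hx hy addr0. Qed.
Lemma cycZ C n t (x : C n) : cyc x -> cyc (t *: x).
Proof. by move=> hx m e; rewrite linearZZ hx scaler0. Qed.
Lemma cycN C n (x : C n) : cyc x -> cyc (- x).
Proof. by rewrite -scaleN1r; apply: cycZ. Qed.
Lemma cycB C n (x y : C n) : cyc x -> cyc y -> cyc (x - y).
Proof. by move=> hx /cycN; apply: cycD. Qed.

Lemma coh_refl C n (x : C n) : coh x x.
Proof. by rewrite /coh subrr; apply: bd0. Qed.
Lemma coh_sym C n (x y : C n) : coh x y -> coh y x.
Proof. by move=> /bdN; rewrite opprB. Qed.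
Lemma coh_trans C n (y x z : C n) : coh x y -> coh y z -> coh x z.
Proof. by move=> h1 h2; rewrite /coh -(subrKA y); apply: bdD. Qed.
Lemma coh_cyc C n (x y : C n) : coh x y -> cyc x -> cyc y.
Proof. by move=> /bd_cyc h /cycB/(_ h); rewrite subKr. Qed.
Lemma coh_bd C n (x y : C n) : coh x y -> bd x -> bd y.
Proof. by move=> h /bdB/(_ h); rewrite subKr. Qed.
Lemma coh0 C n (x : C n) : coh x 0 <-> bd x.
Proof. by rewrite /coh subr0. Qed.

Section Map.
Variables (C D : cochain k) (f : cmor C D).
Lemma cmor_cyc n (x : C n) : cyc x -> cyc (f n x).
Proof. by move=> hx m e; rewrite -cmor_d hx linear0. Qed.
Lemma cmor_bd n (x : C n) : bd x -> bd (f n x).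
Proof. by move=> [m [e [y ->]]]; rewrite cmor_d; apply: bd_d. Qed.
Lemma cmor_coh n (x y : C n) : coh x y -> coh (f n x) (f n y).
Proof. by rewrite /coh -linearB; apply: cmor_bd. Qed.

Lemma cquasi_isoP : cquasi_iso f <-> forall n,
  (forall x : C n, cyc x -> bd (f n x) -> bd x) /\
  (forall y : D n, cyc y -> exists2 x : C n, cyc x & coh (f n x) y).
Proof.
split=> h.
  move=> n; have [h1 h2] := h _ _ _ (subrK 1 n) (erefl (n + 1)); split.
    move=> x hx /(bdP (subrK 1 n)) [z hz].
    by have [|w ->] := h1 x (hx _ _); [exists z|apply: bd_d].
  move=> y hy; have [x [z [hx ->]]] := h2 y (hy _ _).
  exists x; first exact: cycP hx.
  by apply: coh_sym; rewrite /coh addrAC subrr add0r; apply: bd_d.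
move=> n m l e e'; have [h1 h2] := h m; split.
  move=> x /cycP hx [z hz]; apply: bdP; apply: h1 => //.
  by rewrite hz; apply: bd_d.
move=> y /cycP hy; have [x hx /coh_sym/(bdP e)[z hz]] := h2 y hy.
by exists x, z; split; [apply: hx|rewrite -hz addrC subrK].
Qed.

Lemma qi_inj : cquasi_iso f -> forall n (x : C n), cyc x -> bd (f n x) -> bd x.
Proof. by move=> /cquasi_isoP h n; have [] := h n. Qed.
Lemma qi_surj : cquasi_iso f -> forall n (y : D n), cyc y ->
  exists2 x : C n, cyc x & coh (f n x) y.
Proof. by move=> /cquasi_isoP h n; have [] := h n. Qed.
Lemma qi_coh : cquasi_iso f -> forall n (x y : C n), cyc x -> cyc y ->
  coh (f n x) (f n y) -> coh x y.
Proof. by move=> h n x y hx hy; rewrite /coh -linearB; apply: qi_inj => //; apply: cycB. Qed.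
End Map.

Section TwoOfThree.
Variables (C D E : cochain k) (f : cmor C D) (g : cmor D E) (h : cmor C E).
Hypothesis H : forall n (x : C n), cyc x -> coh (h n x) (g n (f n x)).
(** The triangle is only required to commute on classes of cocycles, so these three lemmas also
    serve where two maps agree merely up to coboundaries. *)
Lemma qi_comp : cquasi_iso f -> cquasi_iso g -> cquasi_iso h.
Proof.
move=> qf qg; apply/cquasi_isoP => n; split=> [x hx|z hz].
  by move=> /(coh_bd (H hx)) /(qi_inj qg (cmor_cyc _ hx)) /(qi_inj qf hx).
have [y hy yz] := qi_surj qg hz; have [x hx xy] := qi_surj qf hy.
by exists x => //; apply: coh_trans (H hx) (coh_trans (cmor_coh g xy) yz).
Qed.
Lemma qi_cancel_f : cquasi_iso f -> cquasi_iso h -> cquasi_iso g.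
Proof.
move=> qf qh; apply/cquasi_isoP => n; split=> [y hy hgy|z hz].
  have [x hx xy] := qi_surj qf hy.
  have b : bd (h n x).
    by apply: coh_bd (coh_sym (coh_trans (H hx) (cmor_coh g xy))) hgy.
  exact: coh_bd xy (cmor_bd f (qi_inj qh hx b)).
have [x hx xz] := qi_surj qh hz; exists (f n x); first exact: cmor_cyc.
exact: coh_trans (coh_sym (H hx)) xz.
Qed.
Lemma qi_cancel_g : cquasi_iso g -> cquasi_iso h -> cquasi_iso f.
Proof.
move=> qg qh; apply/cquasi_isoP => n; split=> [x hx b|y hy].
  apply: (qi_inj qh) => //; exact: coh_bd (coh_sym (H hx)) (cmor_bd g b).
have [x hx xy] := qi_surj qh (cmor_cyc g hy); exists x => //.
apply: (qi_coh qg) => //; first exact: cmor_cyc.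
exact: coh_trans (coh_sym (H hx)) xy.
Qed.
End TwoOfThree.

Lemma qi_id C D (f : cmor C D) (g : cmor D C) :
  (forall n (x : C n), cyc x -> coh (g n (f n x)) x) ->
  (forall n (y : D n), cyc y -> coh (f n (g n y)) y) -> cquasi_iso f.
Proof.
move=> h1 h2; apply/cquasi_isoP => n; split=> [x hx b|y hy].
  exact: coh_bd (h1 _ _ hx) (cmor_bd g b).
by exists (g n y); [apply: cmor_cyc|apply: h2].
Qed.
End Cohomology.

(** * Cones *)

Section Cast.
Variable k : comPzRingType.
Implicit Types C D : cochain k.

(** In a cone, f leads from degree n + j to degree m + j - 1 with m = n + 1. These integers are
    equal but not convertible, so here a transport is unavoidable. *)
Definition deg_cast (C : cochain k) (p q : int) (e : p = q) : {linear C p -> C q} :=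
  match e with erefl => idfun end.

Lemma cc_id C (p : int) (e : p = p) (x : C p) : deg_cast C e x = x.
Proof. by rewrite (int_irr e erefl). Qed.
Lemma cc_cc C (p q r : int) (e : p = q) (i : q = r) (j : p = r) (x : C p) :
  deg_cast C i (deg_cast C e x) = deg_cast C j x.
Proof. by subst r q; rewrite !cc_id. Qed.
Lemma cc_d C (p q p' q' : int) (e : p = q) (i : p + 1 = p') (j : q + 1 = q')
    (e' : p' = q') (x : C p) : cxd C j (deg_cast C e x) = deg_cast C e' (cxd C i x).
Proof. by subst q p' q'; rewrite !cc_id. Qed.
Lemma cc_cmor C D (f : cmor C D) (p q : int) (e : p = q) (x : C p) :
  f q (deg_cast C e x) = deg_cast D e (f p x).
Proof. by subst q. Qed.
Lemma cc_bla (A B : dgcat k) (T : bimod A B) b a a' (p q q' n n' : int) (i : p + q = n)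
    (j : p + q' = n') (e : q = q') (e' : n = n') (f : hom a a' p) (x : T b a q) :
  bla j f (deg_cast (T b a) e x) = deg_cast (T b a') e' (bla i f x).
Proof. by subst q' n n'; rewrite !cc_id. Qed.
Lemma cc_bra (A B : dgcat k) (T : bimod A B) b b' a (p q p' n n' : int) (i : p + q = n)
    (j : p' + q = n') (e : p = p') (e' : n = n') (x : T b a p) (f : hom b' b q) :
  bra j (deg_cast (T b a) e x) f = deg_cast (T b' a) e' (bra i x f).
Proof. by subst p' n n'; rewrite !cc_id. Qed.
End Cast.

Lemma ksignN (k : comPzRingType) (p : int) : - ksign k p = ksign k (p + 1).
Proof. by rewrite ksignD ksign1 mulrN1. Qed.

(** A product of signs depends only on the parity of the sum of the exponents, which is left to
    linear arithmetic. *)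
Ltac ksolve :=
  rewrite ?(mulrN1, mulNr, mulrN, opprK) -?ksignD ?ksignN; apply: ksign_odd; lia.

Section Pairs.
Variables (k : comPzRingType) (U V : lmodType k).
Lemma fstD (x y : U * V) : (x + y).1 = x.1 + y.1. Proof. by []. Qed.
Lemma sndD (x y : U * V) : (x + y).2 = x.2 + y.2. Proof. by []. Qed.
Lemma fstZ t (x : U * V) : (t *: x).1 = t *: x.1. Proof. by []. Qed.
Lemma sndZ t (x : U * V) : (t *: x).2 = t *: x.2. Proof. by []. Qed.
End Pairs.

Section Cone.
Variable k : comPzRingType.
Implicit Types C D : cochain k.

Section Complex.
Variables (C D : cochain k) (f : cmor C D) (j : int).

(* The cone, shifted by [j - 1]: a null-homotopy of a morphism into it yields a
   homotopy between maps of degree [j], without a separate shift functor. *)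
Definition cone_mod (n : int) : lmodType k := (C (n + j)%R * D (n + j - 1)%R)%type.

Fact cone_deg1 (n m : int) : n + 1 = m -> (n + j) + 1 = m + j. Proof. lia. Qed.
Fact cone_deg2 (n m : int) : n + 1 = m -> (n + j - 1) + 1 = m + j - 1. Proof. lia. Qed.
Fact cone_deg3 (n m : int) : n + 1 = m -> n + j = m + j - 1. Proof. lia. Qed.

(** For j = 0 this is the homotopy fibre of f, with d (x, y) = (d x, f x - d y). The factor (-1)^j
    is the sign of the shift by j. *)
Definition cone_d_fun (n m : int) (e : n + 1 = m) (x : cone_mod n) : cone_mod m :=
  ksign k j *: (cxd C (cone_deg1 e) x.1,
                deg_cast D (cone_deg3 e) (f _ x.1) - cxd D (cone_deg2 e) x.2).
Fact cone_d_linear (n m : int) (e : n + 1 = m) : linear (cone_d_fun e).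
Proof.
move=> t [x y] [x' y']; rewrite /cone_d_fun /= !linearP /= scalerA mulrC -scalerA -scalerDr.
congr (_ *: (_, _)).
by rewrite addrACA -scalerDr.
Qed.
Definition cone_d (n m : int) (e : n + 1 = m) := lin_of (cone_d_linear e).

Fact cone_d_d (n m l : int) (e : n + 1 = m) (e' : m + 1 = l) x :
  cone_d e' (cone_d e x) = 0.
Proof.
rewrite [cone_d e x]/(cone_d_fun e x) /cone_d_fun linearZZ /= /cone_d_fun /=.
rewrite linearB /= !cxd_cxd subr0 cmor_d.
rewrite (cc_d (cone_deg3 e) (cone_deg1 e) (cone_deg2 e') (cone_deg3 e')) subrr.
by rewrite !scaler0.
Qed.

Definition cone : cochain k := Cochain cone_d_d.

Lemma cone_d1 (n m : int) (e : n + 1 = m) (x : cone n) :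
  (cxd cone e x).1 = ksign k j *: cxd C (cone_deg1 e) x.1.
Proof. by []. Qed.
Lemma cone_d2 (n m : int) (e : n + 1 = m) (x : cone n) : (cxd cone e x).2 =
  ksign k j *: deg_cast D (cone_deg3 e) (f _ x.1) - ksign k j *: cxd D (cone_deg2 e) x.2.
Proof. by rewrite -scalerBr. Qed.

(** For a cocycle (x, y) one has d x = 0 and f x = d y, so x = d w by injectivity on cohomology.
    Then y - f w is a cocycle, which surjectivity writes as f v + d z with v a cocycle; up to the
    sign (-1)^j, a preimage is (w + v, - z). *)
Lemma cone_acyclic : cquasi_iso f -> acyclic cone.
Proof.
move=> qf n m l e e' [x y] /= h.
have {h} : ksign k j *: cone_d_fun e' (x, y) = 0 by rewrite h scaler0.
rewrite /cone_d_fun scalerA ksignMM scale1r => -[hx hy].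
have {}hx : cyc x by apply: cycP hx.
have hfx : bd (f _ x).
  have -> : f _ x = deg_cast D (esym (cone_deg3 e')) (cxd D (cone_deg2 e') y).
    by move/eqP: hy; rewrite subr_eq0 => /eqP <-; rewrite (cc_cc _ _ erefl).
  exists (m + j - 1), (subrK _ _), y.
  by rewrite -(cc_d erefl (cone_deg2 e') (subrK _ _)).
have [w hw] := bdP (cone_deg1 e) (qi_inj qf hx hfx).
pose y0 := y - deg_cast D (cone_deg3 e) (f _ w).
have hy0 : cyc y0.
  apply: (cycP (e := cone_deg2 e')); rewrite linearB /=.
  rewrite (cc_d (cone_deg3 e) (cone_deg1 e) (cone_deg2 e') (cone_deg3 e')).
  by rewrite -cmor_d -hw; apply/eqP; rewrite subr_eq0 eq_sym -subr_eq0; apply/eqP.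
have [v hv /coh_sym /(bdP (cone_deg2 e)) [z hz]] := qi_surj qf hy0.
pose v' := deg_cast C (esym (cone_deg3 e)) v.
have dv' : cxd C (cone_deg1 e) v' = 0.
  have i : (m + j - 1) + 1 = m + j by lia.
  by rewrite (cc_d _ i _ erefl) (hv _ _).
exists (ksign k j *: (w + v', - z)).
apply: (etrans (linearZZ (cone_d e) _ _)).
change (ksign k j *: cone_d_fun e (w + v', - z) = (x, y)).
rewrite /cone_d_fun scalerA ksignMM scale1r /=.
rewrite !linearD linearN /= dv' addr0 -hw opprK.
congr (_, _); rewrite (cc_cmor f) (cc_cc _ _ erefl) -hz /y0 cc_id.
by rewrite addrACA subrr addr0 addrC subrK.
Qed.
End Complex.

Section Bimod.
Variables (A B : dgcat k) (M N : bimod A B) (s : bmor M N) (j : int).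

Fact cone_degl (r n m : int) : r + n = m -> r + (n + j) = m + j. Proof. lia. Qed.
Fact cone_degl' (r n m : int) : r + n = m -> r + (n + j - 1) = m + j - 1. Proof. lia. Qed.
Fact cone_degr (r n m : int) : n + r = m -> (n + j) + r = m + j. Proof. lia. Qed.
Fact cone_degr' (r n m : int) : n + r = m -> (n + j - 1) + r = m + j - 1. Proof. lia. Qed.

(** Koszul signs: a left factor of degree r passes the shift by j in the first component and the
    shift by j - 1 in the second. A right factor passes nothing. *)
Definition cone_la b a a' (r n m : int) (e : r + n = m) (f : hom a a' r)
    (x : cone (s b a) j n) : cone (s b a') j m :=
  (ksign k (r * j) *: bla (cone_degl e) f x.1,
   ksign k (r * j + r) *: bla (cone_degl' e) f x.2).
Definition cone_ra b' b a (n r m : int) (e : n + r = m) 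
    (x : cone (s b a) j n) (f : hom b' b r) : cone (s b' a) j m :=
  (bra (cone_degr e) x.1 f, bra (cone_degr' e) x.2 f).

Lemma scaleP (U : lmodType k) r t (u v : U) :
  r *: (t *: u + v) = t *: (r *: u) + r *: v.
Proof. by rewrite scalerDr !scalerA mulrC. Qed.

Lemma cone_ra1 b' b a n r m e x f : (@cone_ra b' b a n r m e x f).1 = bra (cone_degr e) x.1 f.
Proof. by []. Qed.
Lemma cone_ra2 b' b a n r m e x f : (@cone_ra b' b a n r m e x f).2 = bra (cone_degr' e) x.2 f.
Proof. by []. Qed.

Definition bcone : bimod A B.
Proof.
refine (@Bimod k A B (fun b a => cone (s b a) j) cone_la cone_ra _ _ _ _ _ _ _ _ _).
- move=> b a a' p q n e; split=> [f|x] t u v; rewrite /cone_la /=.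
  + by rewrite !(blaDr, blaZr); congr (_, _); apply: scaleP.
  + by rewrite !(blaDl, blaZl); congr (_, _); apply: scaleP.
- move=> b' b a p q n e; split=> [x|f] t u v; rewrite /cone_ra /=.
  + by rewrite !(braDr, braZr).
  + by rewrite !(braDl, braZl).
- move=> b a a' a'' p q r pq qr n e1 e2 e3 e4 g f x; rewrite /cone_la /= !blaZr.
  rewrite (blaA e1 (cone_degl e2) (cone_degl e3) (cone_degl e4)).
  rewrite (blaA e1 (cone_degl' e2) (cone_degl' e3) (cone_degl' e4)).
  rewrite !scalerA; congr (_ *: _, _ *: _);
    by rewrite -!ksignD; apply: ksign_odd; lia.
- move=> b'' b' b a p q r pq qr n e1 e2 e3 e4 x g f; rewrite /cone_ra /=.
  rewrite (braA (cone_degr e1) (cone_degr e2) e3 (cone_degr e4)).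
  by rewrite (braA (cone_degr' e1) (cone_degr' e2) e3 (cone_degr' e4)).
- move=> b' b a a' p q r pq qr n e1 e2 e3 e4 f x g; rewrite /cone_la /cone_ra /= !braZl.
  rewrite (blra (cone_degl e1) (cone_degr e2) (cone_degr e3) (cone_degl e4)).
  by rewrite (blra (cone_degl' e1) (cone_degr' e2) (cone_degr' e3) (cone_degl' e4)).
- by move=> b a p e [x y]; rewrite /cone_la /= !bla1 mul0r addr0 !scale1r.
- by move=> b a p e [x y]; rewrite /cone_ra /= !bra1.
- move=> b a a' p q n p' q' n' e ep eq en el er f [x y].
  rewrite /cone_la /= /cone_d_fun /=.
  rewrite !linearZZ !blaZr.
  rewrite (bla_d (cone_degl e) ep (cone_deg1 j eq) (cone_deg1 j en) (cone_degl el) (cone_degl er)).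
  rewrite (bla_d (cone_degl' e) ep (cone_deg2 j eq) (cone_deg2 j en) (cone_degl' el) (cone_degl' er)).
  rewrite bmor_la -(cc_bla (cone_degl e) (cone_degl' er) (cone_deg3 j eq) (cone_deg3 j en)).
  rewrite blaDr -scaleN1r blaZr.
  congr (_, _); rewrite !scalerDr !scalerA.
    by rewrite /= ?fstZ /= ?scalerA; congr (_ *: _ + _ *: _); subst; ksolve.
  rewrite /= ?sndZ /= ?scalerDr ?scalerN ?scaleN1r ?scalerA.
  rewrite !scalerDr opprD -!scaleNr !scalerA addrCA.
  by congr (_ *: _ + (_ *: _ + _ *: _)); subst; ksolve.
- move=> b' b a p q n p' q' n' e ep eq en el er x f; lazy beta.
  rewrite [RHS]surjective_pairing [LHS]surjective_pairing; congr (_, _).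
    rewrite cone_d1 fstD fstZ !cone_ra1 cone_d1 braZl.
    rewrite (bra_d (cone_degr e) (cone_deg1 j ep) eq (cone_deg1 j en) (cone_degr el) (cone_degr er)).
    rewrite scalerDr !scalerA.
    by congr (_ *: _ + _ *: _); subst; ksolve.
  rewrite cone_d2 sndD sndZ !cone_ra2 cone_ra1 cone_d2 braDl -scaleNr !braZl bmor_ra.
  rewrite (bra_d (cone_degr' e) (cone_deg2 j ep) eq (cone_deg2 j en) (cone_degr' el) (cone_degr' er)).
  rewrite -(cc_bra (cone_degr e) (cone_degr' el) (cone_deg3 j ep) (cone_deg3 j en)).
  rewrite !scalerDr ?opprD -?scaleNr !scalerA !addrA (braZl (cone_degr' el)).
  by congr (_ *: _ + _ *: _ + _ *: _); subst; ksolve.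
Defined.
End Bimod.
End Cone.

(** * Homotopies and h-projective bimodules *)

Lemma addrBl (V : zmodType) (x y : V) : x + y - x = y.
Proof. by rewrite addrAC subrr add0r. Qed.

Section Homotopy.
Variables (k : comPzRingType) (A B : dgcat k).
Implicit Types M N P : bimod A B.

Fact linear_zero (U V : lmodType k) : linear (fun _ : U => 0 : V).
Proof. by move=> t x y; rewrite scaler0 addr0. Qed.

(** The zero homotopy. Strict identities between morphisms are always used in this form, which
    avoids comparing the records themselves. *)
Lemma bh_ext M N (f g : bmor M N) :
  (forall b a n (x : M b a n), f b a n x = g b a n x) -> bhomotopic f g.
Proof.
move=> fg; exists (fun b a n m e => lin_of (@linear_zero (M b a n) (N b a m))); split.
- by move=> *; rewrite /= bla0r scaler0.
- by move=> *; rewrite /= bra0l.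
- by move=> b a n m l e e' x; rewrite fg subrr linear0 /= addr0.
Qed.

Lemma bh_refl M N (f : bmor M N) : bhomotopic f f.
Proof. exact: bh_ext. Qed.

Lemma bh_sym M N (f g : bmor M N) : bhomotopic f g -> bhomotopic g f.
Proof.
move=> [h [hl hr hd]].
exists (fun b a n m e => lin_of (linear_scale (-1) (h b a n m e))); split.
- move=> b a a' p q n q' n' e eq en e' u x /=.
  by rewrite (hl _ _ _ _ _ _ _ _ e eq en e') blaZr !scalerA mulrC.
- move=> b' b a p q n p' n' e ep en e' x u /=.
  by rewrite (hr _ _ _ _ _ _ _ _ e ep en e') braZl.
- move=> b a n m l e e' x /=.
  by rewrite linearZZ -scalerDr -(hd b a n m l e e') scaleN1r opprB.
Qed.

Lemma bh_trans M N (g f h : bmor M N) : bhomotopic f g -> bhomotopic g h -> bhomotopic f h.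
Proof.
move=> [h1 [hl1 hr1 hd1]] [h2 [hl2 hr2 hd2]].
exists (fun b a n m e => lin_of (linear_add (h1 b a n m e) (h2 b a n m e))); split.
- move=> b a a' p q n q' n' e eq en e' u x /=.
  rewrite (hl1 _ _ _ _ _ _ _ _ e eq en e') (hl2 _ _ _ _ _ _ _ _ e eq en e').
  by rewrite blaDr scalerDr.
- move=> b' b a p q n p' n' e ep en e' x u /=.
  rewrite (hr1 _ _ _ _ _ _ _ _ e ep en e') (hr2 _ _ _ _ _ _ _ _ e ep en e').
  by rewrite braDl.
- move=> b a n m l e e' x /=.
  by rewrite -(subrKA (g b a n x)) (hd1 b a n m l e e') (hd2 b a n m l e e') linearD addrACA.
Qed.

Lemma bh_compl M N P (g : bmor N P) (f f' : bmor M N) :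
  bhomotopic f f' -> bhomotopic (bcompm g f) (bcompm g f').
Proof.
move=> [h [hl hr hd]].
exists (fun b a n m e => lin_of (linear_comp (g b a m) (h b a n m e))); split.
- move=> b a a' p q n q' n' e eq en e' u x /=.
  by rewrite (hl _ _ _ _ _ _ _ _ e eq en e') linearZZ bmor_la.
- move=> b' b a p q n p' n' e ep en e' x u /=.
  by rewrite (hr _ _ _ _ _ _ _ _ e ep en e') bmor_ra.
- move=> b a n m l e e' x /=.
  by rewrite -linearB (hd b a n m l e e') linearD cmor_d.
Qed.

Lemma bh_compr M N P (g g' : bmor N P) (f : bmor M N) :
  bhomotopic g g' -> bhomotopic (bcompm g f) (bcompm g' f).
Proof.
move=> [h [hl hr hd]].
exists (fun b a n m e => lin_of (linear_comp (h b a n m e) (f b a n))); split.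
- move=> b a a' p q n q' n' e eq en e' u x /=.
  by rewrite bmor_la (hl _ _ _ _ _ _ _ _ e eq en e').
- move=> b' b a p q n p' n' e ep en e' x u /=.
  by rewrite bmor_ra (hr _ _ _ _ _ _ _ _ e ep en e').
- move=> b a n m l e e' x /=.
  by rewrite (hd b a n m l e e') cmor_d.
Qed.

Lemma bh_coh M N (f g : bmor M N) b a n (x : M b a n) :
  bhomotopic f g -> cyc x -> coh (f b a n x) (g b a n x).
Proof.
move=> [h [_ _ hd]] hx; have i : (n - 1) + 1 = n by lia.
by rewrite /coh (hd b a n _ _ i (erefl _)) hx linear0 addr0; apply: bd_d.
Qed.

Section Lifting.
Variables (P M N : bimod A B) (s : bmor M N).
Hypotheses (hP : hproj P) (qs : bquasi_iso s).

Lemma bcone_acyclic j : bacyclic (bcone s j).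
Proof. by move=> b a; apply: cone_acyclic; apply: qs. Qed.

Section Zero.
Variable j : int.
Let zf b a n (x : P b a n) : bcone s j b a n := 0.
Fact bzero_linear b a n : linear (@zf b a n).
Proof. exact: linear_zero. Qed.
Fact bzero_d b a (n m : int) (e : n + 1 = m) x :
  @zf b a m (cxd (P b a) e x) = cxd (bcone s j b a) e (zf x).
Proof. exact/esym/linear0. Qed.
Definition bzero : bmor P (bcone s j).
Proof.
apply: (bmor_of bzero_linear bzero_d).
- by move=> *; apply/esym/bla0r.
- by move=> *; apply/esym/bra0l.
Defined.
End Zero.

Section Surj.
Variable f : bmor P N.
Fact lift_deg (n : int) : n = n + 1 - 1. Proof. lia. Qed.
Definition to_cone1_fun b a n (x : P b a n) : bcone s 1 b a n :=
  (0, deg_cast (N b a) (lift_deg n) (f b a n x)).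
Fact to_cone1_linear b a n : linear (@to_cone1_fun b a n).
Proof.
move=> t x y; rewrite /to_cone1_fun; apply: injective_projections => /=.
  by rewrite scaler0 addr0.
by rewrite !linearP.
Qed.
Fact to_cone1_d b a (n m : int) (e : n + 1 = m) x :
  to_cone1_fun (cxd (P b a) e x) = cxd (bcone s 1 b a) e (to_cone1_fun x).
Proof.
rewrite /to_cone1_fun.
apply: injective_projections; rewrite ?cone_d1 ?cone_d2 /= !linear0 ?scaler0 //.
rewrite ?linear0 ?scaler0 ksign1 scaleN1r sub0r opprK cmor_d.
by rewrite (cc_d (lift_deg n) e (cone_deg2 1 e) (lift_deg m)).
Qed.
Definition to_cone1 : bmor P (bcone s 1).
Proof.
apply: (bmor_of to_cone1_linear to_cone1_d).
- move=> b a a' p q n e u x; rewrite /= /to_cone1_fun /cone_la /= bla0r scaler0.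
  rewrite mulr1 bmor_la (cc_bla e (cone_degl' 1 e) (lift_deg q) (lift_deg n)).
  by rewrite (@ksign_odd k _ 0) ?scale1r //; lia.
- move=> b' b a p q n e x u; rewrite /= /to_cone1_fun /cone_ra /= bra0l.
  by rewrite bmor_ra (cc_bra e (cone_degr' 1 e) (lift_deg p) (lift_deg n)).
Defined.

(** The morphism x |-> (0, f x) into the cone with j = 1 is null-homotopic. In that degree the
    components of the null-homotopy lie in M^n and N^(n-1): the first is, up to sign, a morphism g,
    and the second a homotopy between f and s g. *)
Lemma hproj_lift : exists g : bmor P M, bhomotopic (bcompm s g) f.
Proof.
have [h [hl hr hd]] := hP (@bcone_acyclic 1) to_cone1 (bzero 1).
pose g b a n (x : P b a n) : M b a n :=
  - deg_cast (M b a) (subrK 1 n) (h b a n _ (subrK 1 n) x).1.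
have gE b a n m (e : m + 1 = n) x : g b a n x = - deg_cast (M b a) e (h b a n m e x).1.
  have em : m = n - 1 by lia.
  by subst m; rewrite (int_irr e (subrK 1 n)).
have gl b a n : linear (g b a n).
  by move=> t x y; rewrite /g linearP fstD fstZ linearP opprD scalerN.
have i (m : int) : m + 1 - 1 = m by lia.
have hd1 b a n m (e : n + 1 = m) x : g b a m (cxd (P b a) e x) = cxd (M b a) e (g b a n x).
  have E0 : 0 = (cxd (bcone s 1 b a) (subrK 1 n) (h b a n _ (subrK 1 n) x)).1
      + (h b a m n e (cxd (P b a) e x)).1.
    by rewrite -fstD -hd; apply/esym/subr0.
  rewrite (cone_d1 (f := s b a)) ksign1 scaleN1r in E0.
  move/esym/eqP: E0; rewrite addr_eq0 => /eqP/oppr_inj/esym E.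
  rewrite (gE _ _ _ _ e) /g linearN /= E.
  rewrite (cc_d (subrK 1 n) (cone_deg1 1 (subrK 1 n)) e e). exact: erefl.
have gla b a a' (p q n : int) (e : p + q = n) (u : hom a a' p) (x : P b a q) :
    g b a' n (bla e u x) = bla e u (g b a q x).
  have e1 : p + (q - 1) = n - 1 by lia.
  rewrite /g (hl b a a' p q n _ _ e (subrK 1 q) (subrK 1 n) e1) fstZ linearZZ.
  rewrite blaNr (cc_bla (cone_degl 1 e1) e (subrK 1 q) (subrK 1 n)) -linearZZ.
  congr (- deg_cast _ _ _).
  by rewrite /= scalerA mulr1 ksignMM scale1r.
have gra b' b a (p q n : int) (e : p + q = n) (x : P b a p) (u : hom b' b q) :
    g b' a n (bra e x u) = bra e (g b a p x) u.
  have e1 : (p - 1) + q = n - 1 by lia.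
  rewrite /g (hr b' b a p q n _ _ e (subrK 1 p) (subrK 1 n) e1).
  by rewrite braNl (cc_bra (cone_degr 1 e1) e (subrK 1 p) (subrK 1 n)).
exists (bmor_of gl hd1 gla gra); apply: bh_sym.
pose w b a n m (e : m + 1 = n) (x : P b a n) : N b a m := deg_cast (N b a) (i m) (h b a n m e x).2.
have wl b a n m (e : m + 1 = n) : linear (w b a n m e).
  by move=> t x y; rewrite /w linearP sndD sndZ linearP.
exists (fun b a n m e => lin_of (wl b a n m e)); split; rewrite /= /w.
- move=> b a a' p q n q' n' e eq en e' u x.
  rewrite (hl b a a' p q n _ _ e eq en e') sndZ linearZZ; congr (_ *: _).
  rewrite (cc_bla (cone_degl' 1 e') e' (i q') (i n')); congr (deg_cast _ _ _).
  by rewrite /= (@ksign_odd k _ 0) ?scale1r //; lia.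
- move=> b' b a p q n p' n' e ep en e' x u.
  rewrite (hr b' b a p q n _ _ e ep en e').
  by rewrite (cc_bra (cone_degr' 1 e') e' (i p') (i n')).
- move=> b a n m l e e' x.
  have E0 : deg_cast (N b a) (lift_deg n) (f b a n x) = (cxd (bcone s 1 b a) e (h b a n m e x)).2
      + (h b a l n e' (cxd (P b a) e' x)).2.
    by rewrite -sndD -hd; apply/esym/subr0.
  rewrite (cone_d2 (f := s b a)) ksign1 !scaleN1r opprK in E0.
  have {E0} /= E0 := congr1 (deg_cast (N b a) (i n)) E0.
  rewrite (cc_cc (lift_deg n) (i n) erefl) cc_id in E0.
  rewrite E0 !linearD linearN /= (cc_cc _ (i n) e) -(cc_d (i m) (cone_deg2 1 e) e (i n)).
  by rewrite (gE _ _ _ _ e) linearN opprK (cc_cmor (s b a)) [LHS]addrC !addrA subrr add0r.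
Qed.
End Surj.

Section Inj.
Variables f g : bmor P M.
Hypothesis sfg : bhomotopic (bcompm s f) (bcompm s g).

(** If h is a homotopy from s f to s g, then x |-> (f x - g x, h x) is a morphism into the cone with
    j = 0; the first component of a null-homotopy of it is a homotopy from f to g. *)
Lemma hproj_inj : bhomotopic f g.
Proof.
have [h [hl hr hd]] := sfg.
have i (n : int) : n = n + 0 by rewrite addr0.
have i' (n : int) : n - 1 = n + 0 - 1 by rewrite addr0.
have j (n : int) : n + 0 = n by rewrite addr0.
pose D b a n : {linear P b a n -> M b a n} :=
  lin_of (linear_add (f b a n) (lin_of (linear_scale (-1) (g b a n)))).
have DE b a n x : D b a n x = f b a n x - g b a n x by rewrite /= scaleN1r.
have Dd b a n m (e : n + 1 = m) x : D b a m (cxd (P b a) e x) = cxd (M b a) e (D b a n x).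
  by rewrite !DE !cmor_d linearB.
have sD b a n x : s b a n (D b a n x) =
    cxd (N b a) (subrK 1 n) (h b a n _ (subrK 1 n) x) + h b a _ n (erefl _) (cxd (P b a) erefl x).
  by rewrite -hd DE linearB.
move: D DE Dd sD => D DE Dd sD.
pose u b a n (x : P b a n) : bcone s 0 b a n :=
  (deg_cast (M b a) (i n) (D b a n x), deg_cast (N b a) (i' n) (h b a n _ (subrK 1 n) x)).
have hE b a n m m' (e : m + 1 = n) (e1 : m' + 1 = n) (e' : m = m') x :
    deg_cast (N b a) e' (h b a n m e x) = h b a n m' e1 x.
  by subst m'; rewrite cc_id (int_irr e e1).
have ul b a n : linear (u b a n).
  by move=> t x y; rewrite /u; apply: injective_projections => /=; rewrite !linearP.
have ud b a n m (e : n + 1 = m) x :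
    u b a m (cxd (P b a) e x) = cxd (bcone s 0 b a) e (u b a n x).
  apply: injective_projections.
    rewrite (cone_d1 (f := s b a)) scale1r /=.
    by rewrite (cc_d (i n) e _ (i m)) Dd.
  rewrite (cone_d2 (f := s b a)) !scale1r /=.
  rewrite (cc_cmor (s b a)) sD.
  rewrite (cc_d (i' n) (subrK 1 n) _ (etrans (i n) (cone_deg3 0 e))).
  rewrite (cc_cc _ _ (etrans (i n) (cone_deg3 0 e))) linearD addrBl.
  subst m; have e1 : n + 1 + 0 - 1 + 1 = n + 1 by lia.
  by rewrite !(hE _ _ _ _ _ _ e1).
have ula b a a' (p q n : int) (e : p + q = n) (v : hom a a' p) (x : P b a q) :
    u b a' n (bla e v x) = bla e v (u b a q x).
  have e1 : p + (q - 1) = n - 1 by lia.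
  apply: injective_projections; rewrite /= ?mulr0 ?add0r ?scale1r.
    by rewrite (cc_bla e _ _ (i n)) !DE !bmor_la blaDr blaNr.
  by rewrite (hl b a a' p q n _ _ e (subrK 1 q) (subrK 1 n) e1) (cc_bla e1 _ _ (i' n)) linearZZ.
have ura b' b a (p q n : int) (e : p + q = n) (x : P b a p) (v : hom b' b q) :
    u b' a n (bra e x v) = bra e (u b a p x) v.
  have e1 : (p - 1) + q = n - 1 by lia.
  apply: injective_projections => /=.
    by rewrite (cc_bra e _ _ (i n)) !DE !bmor_ra braDl braNl.
  by rewrite (hr b' b a p q n _ _ e (subrK 1 p) (subrK 1 n) e1) (cc_bra e1 _ _ (i' n)).
have [w [wl wr wd]] := hP (@bcone_acyclic 0) (bmor_of ul ud ula ura) (bzero 0).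
pose v b a n m (e : m + 1 = n) (x : P b a n) : M b a m := deg_cast (M b a) (j m) (w b a n m e x).1.
have vl b a n m (e : m + 1 = n) : linear (v b a n m e).
  by move=> t x y; rewrite /v linearP fstD fstZ linearP.
exists (fun b a n m e => lin_of (vl b a n m e)); split; rewrite /= /v.
- move=> b a a' p q n q' n' e eq en e' z x.
  rewrite (wl b a a' p q n _ _ e eq en e') fstZ linearZZ; congr (_ *: _).
  rewrite (cc_bla (cone_degl 0 e') e' (j q') (j n')); congr (deg_cast _ _ _).
  by rewrite /= mulr0 scale1r.
- move=> b' b a p q n p' n' e ep en e' x z.
  rewrite (wr b' b a p q n _ _ e ep en e').
  by rewrite (cc_bra (cone_degr 0 e') e' (j p') (j n')).
- move=> b a n m l e e' x.
  have E0 : deg_cast (M b a) (i n) (D b a n x) = (cxd (bcone s 0 b a) e (w b a n m e x)).1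
      + (w b a l n e' (cxd (P b a) e' x)).1.
    by rewrite -fstD -wd; apply/esym/subr0.
  rewrite (cone_d1 (f := s b a)) scale1r in E0.
  have {E0} /= E0 := congr1 (deg_cast (M b a) (j n)) E0.
  rewrite (cc_cc (i n) (j n) erefl) cc_id in E0.
  by rewrite -DE E0 linearD -(cc_d (j m) (cone_deg1 0 e) e (j n)).
Qed.
End Inj.
End Lifting.
End Homotopy.

(** * Functors on the localisation *)

Section Localisation.
Variables (k : comPzRingType) (A B : dgcat k).
Implicit Types M N P : bimod A B.

Section Functor.
Variables (El : bimod A B -> Type) (E : forall M, El M -> El M -> Prop)
  (act : forall M N, bmor M N -> El M -> El N).
Hypothesis E_sym : forall M (x y : El M), E x y -> E y x.
Hypothesis E_trans : forall M (y x z : El M), E x y -> E y z -> E x z.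
Hypothesis act_E : forall M N (f : bmor M N) x y, E x y -> E (act f x) (act f y).
Hypothesis act_id : forall M (x : El M), E x x -> E (act (bid M) x) x.
Hypothesis act_comp : forall M N P (g : bmor N P) (f : bmor M N) x, E x x ->
  E (act (bcompm g f) x) (act g (act f x)).
Hypothesis act_homotopic : forall M N (f g : bmor M N) x, bhomotopic f g -> E x x ->
  E (act f x) (act g x).
Hypothesis act_inj : forall M N (s : bmor M N) x y, bquasi_iso s -> E x x -> E y y ->
  E (act s x) (act s y) -> E x y.
Hypothesis act_surj : forall M N (s : bmor M N) y, bquasi_iso s -> E y y ->
  exists2 x, E x x & E (act s x) y.

(* A functor that sends quasi-isomorphisms to bijections extends to the
   localisation; the extension is given as a functional relation, so that no
   preimage is chosen.  [E] is a partial equivalence relation: [E x x] carves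
   out the elements that count (for cohomology, the cocycles). *)
Fixpoint drel M N (u : dmor M N) : El M -> El N -> Prop :=
  match u with
  | Dof _ _ f => fun x y => E x x /\ E (act f x) y
  | Dinv _ _ s _ => fun x y => E y y /\ E (act s y) x
  | Dcomp _ _ _ g f => fun x z => exists2 y, drel f x y & drel g y z
  end.

Let E_l M (x y : El M) : E x y -> E x x.
Proof. by move=> h; apply: E_trans (h) _; apply: E_sym. Qed.
Let E_r M (x y : El M) : E x y -> E y y.
Proof. by move/E_sym; apply: E_l. Qed.

Lemma drel_dom M N (u : dmor M N) x y : drel u x y -> E x x /\ E y y.
Proof.
elim: u x y => {M N} [M N f x y [h1 h2]|M N s hs x y [h1 h2]|M N P g hg f hf x z [y]].
- by split=> //; apply: E_r h2.
- by split=> //; apply: E_r h2.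
- by move=> /hf[h _] /hg[_ h'].
Qed.

Lemma drel_E M N (u : dmor M N) x x' y y' :
  drel u x y -> E x x' -> E y y' -> drel u x' y'.
Proof.
elim: u x x' y y' => {M N} [M N f|M N s hs|M N P g hg f hf] x x' y y'.
- move=> [h1 h2] hx hy; split; first exact: E_r hx.
  exact: E_trans (E_trans (act_E f (E_sym hx)) h2) hy.
- move=> [h1 h2] hx hy; split; first exact: E_r hy.
  exact: E_trans (E_trans (act_E s (E_sym hy)) h2) hx.
- move=> [z h1 h2] hx hy; have [_ hz] := drel_dom h1.
  by exists z; [apply: hf h1 hx hz|apply: hg h2 hz hy].
Qed.

Lemma drel_fun M N (u : dmor M N) x y y' : drel u x y -> drel u x y' -> E y y'.
Proof.
elim: u x y y' => {M N} [M N f|M N s hs|M N P g hg f hf] x y y'.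
- by move=> [h1 h2] [_ h3]; apply: E_trans (E_sym h2) h3.
- move=> [h1 h2] [h3 h4]; apply: (act_inj hs) => //.
  exact: E_trans h2 (E_sym h4).
- move=> [z h1 h2] [z' h3 h4]; have zz' := hf _ _ _ h1 h3.
  have [_ hy] := drel_dom h2; apply: (hg z') => //; exact: drel_E h2 zz' hy.
Qed.

Lemma drel_tot M N (u : dmor M N) x : E x x -> exists y, drel u x y.
Proof.
elim: u x => {M N} [M N f|M N s hs|M N P g hg f hf] x hx.
- by exists (act f x); split=> //; apply: act_E.
- by have [y hy yx] := act_surj hs hx; exists y.
- have [y hy] := hf x hx; have [_ yy] := drel_dom hy; have [z hz] := hg y yy.
  by exists z, y.
Qed.

(** The rules of [deq] are checked one by one. The two rules for formal inverses are where
    injectivity and surjectivity on quasi-isomorphisms enter; the others are functoriality. *)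
Lemma drel_deq M N (u v : dmor M N) : deq u v -> forall x y, drel u x y <-> drel v x y.
Proof.
elim=> {M N u v} //=.
- by move=> M N f g _ h x y; rewrite h.
- by move=> M N f g h _ h1 _ h2 x y; rewrite h1 h2.
- by move=> M N P g g' f f' _ h1 _ h2 x y; split=> -[z /h2 hz /h1 hz']; exists z.
- move=> M N P R h g f x y; split=> [[z [w hw hz] hy]|[w hw [z hz hy]]].
    by exists w => //; exists z.
  by exists z => //; exists w.
- move=> M N f x y; split=> [[z hz [hz' hy]]|h].
    apply: drel_E hz (proj1 (drel_dom hz)) _.
    exact: E_trans (E_sym (act_id hz')) hy.
  have [hx hy] := drel_dom h; exists y => //; split=> //; exact: act_id.
- move=> M N f x y; split=> [[z [hx hz] h]|h].
    have [_ hy] := drel_dom h.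
    apply: drel_E h _ hy; exact: E_trans (E_sym hz) (act_id hx).
  have [hx hy] := drel_dom h; exists x => //; split=> //; exact: act_id.
- move=> M N f g fg x y; split=> -[hx h]; split=> //.
    by apply: E_trans _ h; apply: E_sym; apply: act_homotopic.
  by apply: E_trans _ h; apply: act_homotopic.
- move=> M N P g f x y; split=> [[hx h]|[z [hx h] [hz h']]].
    exists (act f x); split=> //; rewrite ?act_E //; try exact: act_E.
    exact: E_trans (E_sym (act_comp _ _ hx)) h.
  split=> //; apply: E_trans (act_comp _ _ hx) _.
  exact: E_trans (act_E g h) h'.
- move=> M N s hs x y; split=> [[z [hx h] [hy h']]|[hx h]].
    split=> //; have := E_trans h (E_sym h') => h2.
    exact: E_trans (act_id hx) (act_inj hs hx hy h2).
  exists (act s x); split=> //; try exact: act_E.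
    exact: E_r h.
  apply: act_E; exact: E_trans (E_sym h) (act_id hx).
- move=> M N s hs x y; split=> [[z [hz h] [_ h']]|[hx h]].
    have hx := E_r h; split=> //.
    exact: E_trans (act_id hx) (E_trans (E_sym h) h').
  have [z hz hzx] := act_surj hs hx; exists z; split=> //.
  exact: E_trans hzx (E_trans (E_sym (act_id hx)) h).
Qed.
End Functor.

(** * Two instances: homotopy classes out of an h-projective bimodule, and cohomology *)

Section Faithful.
Variables (P : bimod A B) (hP : hproj P).

(** The functor K(P, -). That it inverts quasi-isomorphisms is [hproj_inj] and [hproj_lift]. *)
Definition hrel M N (u : dmor M N) : bmor P M -> bmor P N -> Prop :=
  @drel (fun M => bmor P M) (fun M => @bhomotopic _ _ _ P M) (fun M N => @bcompm _ _ _ P M N) M N u.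

Lemma hrel_deq M N (u v : dmor M N) f g : deq u v -> hrel u f g -> hrel v f g.
Proof.
move=> uv; apply: (proj1 (drel_deq _ _ _ _ _ _ _ _ uv f g)).
- by move=> *; apply: bh_sym.
- by move=> R h f' g'; apply: bh_trans.
- by move=> *; apply: bh_compl.
- by move=> *; apply: bh_ext.
- by move=> *; apply: bh_ext.
- by move=> *; apply: bh_compr.
- by move=> R R' s f' g' hs _ _; apply: hproj_inj.
- by move=> R R' s h hs _; have [f' hf'] := hproj_lift hP hs h; exists f' => //; apply: bh_refl.
Qed.

(** The Yoneda argument: both words act on the identity of [P], with results f and g. Thus
    localisation is faithful on morphisms out of [P]. *)
Lemma deq_homotopic_hproj M (f g : bmor P M) : deq (Dof f) (Dof g) -> bhomotopic f g.
Proof.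
move=> fg; have : hrel (Dof f) (bid P) f by split; [apply: bh_refl|apply: bh_ext].
move=> /(hrel_deq fg)[_ h]; apply: bh_trans (bh_sym h) _; exact: bh_ext.
Qed.
End Faithful.

Section CohRel.
Variables (b : B) (a : A) (n : int).
Definition ceq (M : bimod A B) (x y : M b a n) := cyc x /\ coh x y.
(** The action of a morphism of D on H^n of the component (b, a), as a relation between representing
    cocycles. In [ceq] only x is asked to be a cocycle, since y then is one too. *)
Definition crel M N (u : dmor M N) : M b a n -> N b a n -> Prop :=
  @drel (fun M => M b a n) ceq (fun M N f => f b a n) M N u.

Lemma ceq_sym M (x y : M b a n) : ceq x y -> ceq y x.
Proof. by move=> [hx h]; split; [apply: coh_cyc h hx|apply: coh_sym]. Qed.
Lemma ceq_trans M (y x z : M b a n) : ceq x y -> ceq y z -> ceq x z.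
Proof. by move=> [hx h] [_ h']; split=> //; apply: coh_trans h h'. Qed.
Lemma ceq_act M N (f : bmor M N) (x y : M b a n) : ceq x y -> ceq (f b a n x) (f b a n y).
Proof. by move=> [hx h]; split; [apply: cmor_cyc|apply: cmor_coh]. Qed.
Lemma ceq_refl M (x : M b a n) : cyc x -> ceq x x.
Proof. by split=> //; apply: coh_refl. Qed.
Lemma ceq_inj M N (s : bmor M N) (x y : M b a n) : bquasi_iso s -> ceq x x -> ceq y y ->
  ceq (s b a n x) (s b a n y) -> ceq x y.
Proof. by move=> hs [hx _] [hy _] [_ h]; split=> //; apply: (qi_coh (hs b a)). Qed.
Lemma ceq_surj M N (s : bmor M N) (y : N b a n) : bquasi_iso s -> ceq y y ->
  exists2 x, ceq x x & ceq (s b a n x) y.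
Proof.
move=> hs [hy _]; have [x hx h] := qi_surj (hs b a) hy.
by exists x; [apply: ceq_refl|split=> //; apply: cmor_cyc].
Qed.

Lemma crel_deq M N (u v : dmor M N) x y : deq u v -> crel u x y -> crel v x y.
Proof.
move=> uv; apply: (proj1 (drel_deq _ _ _ _ _ _ _ _ uv x y)).
- exact: ceq_sym.
- exact: ceq_trans.
- exact: ceq_act.
- by [].
- by move=> M' N' P' g f z hz; exact: (ceq_act (bcompm g f) hz).
- move=> M' N' f g z fg [hz _]; split; first exact: cmor_cyc.
  exact: bh_coh.
- exact: ceq_inj.
- exact: ceq_surj.
Qed.
Lemma crel_dom M N (u : dmor M N) x y : crel u x y -> cyc x /\ cyc y.
Proof. by case/(drel_dom ceq_sym ceq_trans) => -[] ? ? []. Qed.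
Lemma crel_coh M N (u : dmor M N) x x' y y' :
  crel u x y -> coh x x' -> coh y y' -> crel u x' y'.
Proof.
move=> h hx hy; have [cx cy] := crel_dom h.
by apply: (drel_E ceq_sym ceq_trans ceq_act h).
Qed.
Lemma crel_fun M N (u : dmor M N) x y y' : crel u x y -> crel u x y' -> coh y y'.
Proof. by move=> h h'; case: (drel_fun ceq_sym ceq_trans ceq_act ceq_inj h h'). Qed.
Lemma crel_tot M N (u : dmor M N) x : cyc x -> exists y, crel u x y.
Proof.
move=> hx; apply: (drel_tot ceq_sym ceq_trans ceq_act ceq_surj).
exact: ceq_refl.
Qed.
Lemma crel_of M N (f : bmor M N) (x : M b a n) : cyc x -> crel (Dof f) x (f b a n x).
Proof. by move=> hx; split; apply: ceq_refl => //; apply: cmor_cyc. Qed.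
Lemma crel_inv M N (s : bmor M N) (hs : bquasi_iso s) (x : M b a n) : cyc x ->
  crel (Dinv hs) (s b a n x) x.
Proof. by move=> hx; split; apply: ceq_refl => //; apply: cmor_cyc. Qed.
Lemma crel_comp M N P (v : dmor N P) (u : dmor M N) x y z :
  crel u x y -> crel v y z -> crel (Dcomp v u) x z.
Proof. by exists y. Qed.
End CohRel.
End Localisation.

(** * Complexes of graded maps *)

Section RmaBilin.
Variables (k : comPzRingType) (B : dgcat k) (M : rmod B).
Variables (x y : B) (p q n : int) (e : p + q = n).
Implicit Types (u : M y p) (v : hom x y q).
Lemma rmaZl t u v : rma e (t *: u) v = t *: rma e u v.
Proof. exact: (bilZl (rma_bilin M _ _ e)). Qed.
Lemma rmaZr t u v : rma e u (t *: v) = t *: rma e u v.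
Proof. exact: (bilZr (rma_bilin M _ _ e)). Qed.
Lemma rmaDl u u' v : rma e (u + u') v = rma e u v + rma e u' v.
Proof. exact: (bilDl (rma_bilin M _ _ e)). Qed.
Lemma rmaDr u v v' : rma e u (v + v') = rma e u v + rma e u v'.
Proof. exact: (bilDr (rma_bilin M _ _ e)). Qed.
Lemma rmaBl u u' v : rma e (u - u') v = rma e u v - rma e u' v.
Proof. by rewrite -scaleN1r rmaDl rmaZl scaleN1r. Qed.
Lemma rma0l v : rma e (0 : M y p) v = 0.
Proof. by rewrite -(scale0r 0) rmaZl scale0r. Qed.
End RmaBilin.

Section GradedMaps.
Variables (k : comPzRingType) (I : Type) (U V : I -> cochain k).

(** The index type serves two cases: a single point for Hom_k, and the objects of B for families of
    maps that are to be linear over B. *)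
Definition graw (n : int) := forall (i : I) (p q : int), p + n = q -> U i p -> V i q.

Fact gdeg1 (n m p q : int) : n + 1 = m -> p + m = q -> (p + n) + 1 = q. Proof. lia. Qed.
Fact gdeg2 (n m p q : int) : n + 1 = m -> p + m = q -> (p + 1) + n = q. Proof. lia. Qed.

(* Maps are thought of as acting on the right of their argument:
   d (x f) = (d x) f + (-1)^|x| x (d f). *)
Definition gdraw (n m : int) (e : n + 1 = m) (f : graw n) : graw m :=
  fun i p q e' x => ksign k p *: (cxd (V i) (gdeg1 e e') (f i p _ erefl x) -
                                  f i _ q (gdeg2 e e') (cxd (U i) erefl x)).

Definition glin (n : int) (f : graw n) := forall i p q e, linear (f i p q e).

Lemma gdrawE (n m : int) (e : n + 1 = m) (f : graw n) i (p q p' q' : int) (e' : p + m = q)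
    (i1 : p + n = q') (i2 : q' + 1 = q) (i3 : p + 1 = p') (i4 : p' + n = q) (x : U i p) :
  gdraw e f e' x = ksign k p *: (cxd (V i) i2 (f i p q' i1 x) - f i p' q i4 (cxd (U i) i3 x)).
Proof.
subst p' q'; rewrite /gdraw.
by rewrite (int_irr (gdeg1 e e') i2) (int_irr (gdeg2 e e') i4).
Qed.

(** A condition on families that cuts out a subcomplex. Stability under the differential is asked of
    linear families only: for linearity over B its verification uses additivity. *)
Record gsub := GSub {
  gs :> forall n, graw n -> Prop;
  gs0 : forall n, gs (fun (i : I) (p q : int) (_ : p + n = q) (_ : U i p) => 0 : V i q);
  gsP : forall n t (f g : graw n), gs f -> gs g ->
    gs (fun i p q (e : p + n = q) x => t *: f i p q e x + g i p q e x);
  gsd : forall n m (e : n + 1 = m) (f : graw n), glin f -> gs f -> gs (gdraw e f)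
}.

Definition gtotal : gsub.
Proof. by refine (@GSub (fun _ _ => True) _ _ _). Defined.

Variable R : gsub.
Record gmap (n : int) := GMap {
  gm :> forall (i : I) (p q : int), p + n = q -> U i p -> V i q;
  gm_lin : glin gm;
  gm_in : gs R gm
}.

Lemma gmap_ext n (f g : gmap n) : (forall i p q e x, f i p q e x = g i p q e x) -> f = g.
Proof.
case: f g => [f fl fi] [g gl gi] /= fg.
have E : f = g by do 4 (apply: functional_extensionality_dep => ?);
  apply: functional_extensionality_dep => x; apply: fg.
by subst g; congr GMap; apply: Prop_irrelevance.
Qed.

Fact gmP_lin n t (f g : gmap n) : glin (fun i p q (e : p + n = q) x => t *: f i p q e x + g i p q e x).
Proof.
move=> i p q e s x y; rewrite (gm_lin f) (gm_lin g) !scalerDr !scalerA addrACA.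
by congr (_ *: _ + _ + _); rewrite mulrC.
Qed.
Definition gmP n t (f g : gmap n) : gmap n := GMap (gmP_lin t f g) (gsP t (gm_in f) (gm_in g)).
Fact gm0_lin n : glin (fun (i : I) (p q : int) (_ : p + n = q) (_ : U i p) => 0 : V i q).
Proof. by move=> i p q e s x y; rewrite scaler0 addr0. Qed.
Definition gm0 n : gmap n := GMap (@gm0_lin n) (gs0 R n).

HB.instance Definition _ (n : int) := gen_eqMixin (gmap n).
HB.instance Definition _ (n : int) := gen_choiceMixin (gmap n).

Section Lmod.
Variable n : int.
Definition gm_add (f g : gmap n) := gmP 1 f g.
Definition gm_opp (f : gmap n) := gmP (-1) f (gm0 n).
Definition gm_scale t (f : gmap n) := gmP t f (gm0 n).
Fact gm_addA : associative gm_add.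
Proof. by move=> f g h; apply: gmap_ext => i p q e x /=; rewrite !scale1r addrA. Qed.
Fact gm_addC : commutative gm_add.
Proof. by move=> f g; apply: gmap_ext => i p q e x /=; rewrite !scale1r addrC. Qed.
Fact gm_add0 : left_id (gm0 n) gm_add.
Proof. by move=> f; apply: gmap_ext => i p q e x /=; rewrite !scale1r add0r. Qed.
Fact gm_addN : left_inverse (gm0 n) gm_opp gm_add.
Proof.
by move=> f; apply: gmap_ext => i p q e x /=; rewrite scale1r addr0 scaleN1r addNr.
Qed.
HB.instance Definition _ := GRing.isZmodule.Build (gmap n) gm_addA gm_addC gm_add0 gm_addN.
Fact gm_scaleA s t (f : gmap n) : gm_scale s (gm_scale t f) = gm_scale (s * t) f.
Proof. by apply: gmap_ext => i p q e x /=; rewrite !addr0 scalerA. Qed.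
Fact gm_scale1 : left_id 1 gm_scale.
Proof. by move=> f; apply: gmap_ext => i p q e x /=; rewrite addr0 scale1r. Qed.
Fact gm_scaleDr : right_distributive gm_scale +%R.
Proof.
by move=> t f g; apply: gmap_ext => i p q e x /=; rewrite !addr0 !scale1r scalerDr.
Qed.
Fact gm_scaleDl (f : gmap n) : {morph gm_scale^~ f : s t / s + t}.
Proof.
by move=> s t; apply: gmap_ext => i p q e x /=; rewrite !addr0 !scale1r scalerDl.
Qed.
HB.instance Definition _ := GRing.Zmodule_isLmodule.Build k (gmap n)
  gm_scaleA gm_scale1 gm_scaleDr gm_scaleDl.
End Lmod.

Lemma gmDE n (f g : gmap n) i p q (e : p + n = q) x : (f + g) i p q e x = f i p q e x + g i p q e x.
Proof. by rewrite /= scale1r. Qed.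
Lemma gmZE n t (f : gmap n) i p q (e : p + n = q) x : (t *: f) i p q e x = t *: f i p q e x.
Proof. by rewrite /= addr0. Qed.
Lemma gmNE n (f : gmap n) i p q (e : p + n = q) x : (- f) i p q e x = - f i p q e x.
Proof. by rewrite -scaleN1r gmZE scaleN1r. Qed.
Definition gm_at n (f : gmap n) i p q (e : p + n = q) : {linear U i p -> V i q} :=
  lin_of (gm_lin f e).
Lemma gm_atD n (f : gmap n) i p q (e : p + n = q) x y :
  f i p q e (x + y) = f i p q e x + f i p q e y.
Proof. exact: (linearD (@gm_at n f i p q e)). Qed.
Lemma gm_atB n (f : gmap n) i p q (e : p + n = q) x y :
  f i p q e (x - y) = f i p q e x - f i p q e y.
Proof. exact: (linearB (@gm_at n f i p q e)). Qed.
Lemma gm_atZ n (f : gmap n) i p q (e : p + n = q) t x :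
  f i p q e (t *: x) = t *: f i p q e x.
Proof. exact: (linearZZ (@gm_at n f i p q e)). Qed.

Lemma gm_at0 n (f : gmap n) i p q (e : p + n = q) : f i p q e 0 = 0.
Proof. exact: (linear0 (@gm_at n f i p q e)). Qed.

Fact gd_lin (n m : int) (e : n + 1 = m) (f : gmap n) : glin (gdraw e f).
Proof.
move=> i p q e' t x y; rewrite /gdraw linearP !(gm_lin f) linearP /=.
rewrite opprD addrACA -scalerBr scaleP; congr (_ + _).
Qed.
Definition gd_fun (n m : int) (e : n + 1 = m) (f : gmap n) : gmap m :=
  GMap (gd_lin e f) (gsd e (gm_lin f) (gm_in f)).
Fact gd_linear (n m : int) (e : n + 1 = m) : linear (gd_fun e).
Proof.
move=> t f g; apply: gmap_ext => i p q e' x; rewrite gmDE gmZE.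
change (gdraw e (t *: f + g : gmap n) e' x = t *: gdraw e f e' x + gdraw e g e' x).
rewrite /gdraw !gmDE !gmZE -scaleP; congr (_ *: _).
by rewrite linearP /= opprD addrACA scalerBr.
Qed.
Definition gd (n m : int) (e : n + 1 = m) := lin_of (gd_linear e).

Lemma gdE (n m : int) (e : n + 1 = m) (f : gmap n) i (p q p' q' : int) (e' : p + m = q)
    (i1 : p + n = q') (i2 : q' + 1 = q) (i3 : p + 1 = p') (i4 : p' + n = q) (x : U i p) :
  gd e f i p q e' x =
  ksign k p *: (cxd (V i) i2 (f i p q' i1 x) - f i p' q i4 (cxd (U i) i3 x)).
Proof. exact: gdrawE. Qed.

Fact gd_gd (n m l : int) (e : n + 1 = m) (e1 : m + 1 = l) f : gd e1 (gd e f) = 0.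
Proof.
apply: gmap_ext => i p q e2 x.
have i1 : p + n + 1 = p + m by lia.
have i2 : p + m + 1 = q by lia.
have i3 : p + 1 + n = p + m by lia.
have i4 : (p + 1) + m = q by lia.
have i5 : p + 1 + 1 + n = q by lia.
rewrite (gdE e1 _ e2 (erefl _) i2 (erefl _) i4).
rewrite (gdE e _ (erefl _) (erefl _) i1 (erefl _) i3).
rewrite (gdE e _ i4 i3 i2 (erefl _) i5).
rewrite linearZZ [cxd _ i2 (_ - _)]linearB /= !cxd_cxd gm_at0 sub0r subr0.
by rewrite ksignD ksign1 mulrN1 scaleNr opprK scalerN addNr scaler0.
Qed.
Definition gcx : cochain k := Cochain gd_gd.
End GradedMaps.

Lemma gm_cc (k : comPzRingType) (I : Type) (U V : I -> cochain k) (R : gsub U V) n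
    (g : gmap R n) i (p q q' : int) (e : p + n = q) (e' : p + n = q') (j : q = q') x :
  deg_cast (V i) j (g i p q e x) = g i p q' e' x.
Proof. by subst q q'; rewrite cc_id. Qed.

Lemma subr_mid (V : zmodType) (x y : V) : x - y - x = - y.
Proof. by rewrite addrAC subrr add0r. Qed.

(** * Hom_k out of an h-projective complex preserves quasi-isomorphisms *)

Section PostComposition.
Variables (k : comPzRingType) (U V W : cochain k) (f : cmor V W).

Fact homk_deg (n p q : int) : p + (n - 1) = q -> p - 1 + n = q. Proof. lia. Qed.

Notation homk X := (gcx (U := fun _ : unit => U) (V := fun _ : unit => X) (gtotal _ _)).

Fact post_lin n (g : homk V n) :
  glin (U := fun _ : unit => U) (V := fun _ : unit => W)
    (fun i p q (e : p + n = q) x => f q (g i p q e x)).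
Proof. by move=> i p q e t x y; rewrite (gm_lin g) linearP. Qed.
Definition post_fun n (g : homk V n) : homk W n := GMap (R := gtotal _ _) (post_lin g) I.
Fact post_linear n : linear (@post_fun n).
Proof. by move=> t g h; apply: gmap_ext => i p q e x; rewrite /= !addr0 !scale1r linearP. Qed.
Fact post_d (n m : int) (e : n + 1 = m) (g : homk V n) :
  post_fun (cxd (homk V) e g) = cxd (homk W) e (post_fun g).
Proof.
apply: gmap_ext => i p q e' x.
by rewrite /= /gdraw linearZZ linearB cmor_d.
Qed.
Definition post : cmor (homk V) (homk W) := cmor_of post_linear post_d.

Hypotheses (hU : hproj_complex U) (qf : cquasi_iso f).

Lemma null_homotopic (N : cochain k) (g : cmor U N) : acyclic N ->
  exists h : (forall n m : int, m + 1 = n -> {linear U n -> N m}),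
    forall (n m l : int) (e : m + 1 = n) (e' : n + 1 = l) (x : U n),
      g n x = cxd N e (h n m e x) + h l n e' (cxd U e' x).
Proof.
move=> hN.
have zl n : linear (fun _ : U n => 0 : N n) by exact: linear_zero.
have zd (n m : int) (e : n + 1 = m) (x : U n) : 0 = cxd N e 0 by rewrite linear0.
have [h hd] := hU hN g (cmor_of zl zd).
by exists h => n m l e e' x; rewrite -hd /= subr0.
Qed.

(** If phi is a cocycle and f phi = d zeta, then phi and zeta are together a morphism from U to the
    cone of f with j = n. The first component of a null-homotopy of it bounds phi. *)
Lemma post_inj n (phi : homk V n) : cyc phi -> bd (post n phi) -> bd phi.
Proof.
move=> cphi /(bdP (subrK 1 n)) [zeta hz].
have dphi p p' q q' (e : p + n = q) (e' : p' + n = q') (i : p + 1 = p') (j : q + 1 = q') x :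
    phi tt p' q' e' (cxd U i x) = cxd V j (phi tt p q e x).
  have i1 : p + (n + 1) = q' by lia.
  have := congr1 (fun g : homk V (n + 1) => ksign k p *: g tt p q' i1 x) (cphi _ erefl).
  rewrite /= (gdrawE _ _ _ e j i e') scalerA ksignMM scale1r scaler0 => /eqP.
  by rewrite subr_eq0 eq_sym => /eqP.
have i1 p : p + (n - 1) = p + n - 1 by lia.
have dzeta p p' q0 q (i : p + 1 = p') (i2 : p' + (n - 1) = q) (i3 : p + (n - 1) = q0)
    (i4 : p + n = q) (i5 : q0 + 1 = q) x :
    f _ (phi tt p q i4 x) = ksign k p *: (cxd W i5 (zeta tt p _ i3 x) - zeta tt p' q i2 (cxd U i x)).
  have := congr1 (fun g : homk W n => g tt p q i4 x) hz.
  by rewrite /= (gdrawE _ _ _ i3 i5 i i2).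
(* With maps acting on the right, a cocycle commutes with d without a sign, whereas d on this cone
   carries (-1)^n; the factor (-1)^(n p) makes up for it. The extra (-1)^p belongs to the (-1)^|x|
   in the differential of zeta. *)
pose u p (x : U p) : cone f n p :=
  (ksign k (n * p) *: phi tt p _ (erefl (p + n)) x,
   ksign k (n * p + p) *: zeta tt p _ (i1 p) x).
have ul p : linear (@u p).
  by move=> t x y; apply: injective_projections; rewrite /= (gm_lin _) scaleP.
have ud (p p' : int) (i : p + 1 = p') x : u p' (cxd U i x) = cxd (cone f n) i (u p x).
  apply: injective_projections; rewrite ?cone_d1 ?cone_d2 /=.
    rewrite (dphi _ _ _ _ (erefl (p + n)) _ _ (cone_deg1 n i)) linearZZ scalerA.
    by congr (_ *: _); subst p'; ksolve.
  have i4 : p + n = p' + n - 1 by lia.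
  rewrite -(cc_cmor f) (linearZZ (deg_cast V _)) (gm_cc _ _ i4) (linearZZ (f _)) (linearZZ (cxd W _)).
  rewrite (dzeta _ _ _ _ i (i1 p') (i1 p) _ (cone_deg2 n i)).
  move: (cxd W _ _) (zeta _ _ _ _ _) => D Z.
  rewrite !scalerBr !scalerA.
  have -> : ksign k n * ksign k (n * p) * ksign k p = ksign k n * ksign k (n * p + p).
    by rewrite -!ksignD addrA.
  by rewrite subr_mid -scaleNr; congr (_ *: _); subst p'; ksolve.
have [h hd] := null_homotopic (cmor_of ul ud) (cone_acyclic (j := n) qf).
pose psi (i : unit) p q (e : p + (n - 1) = q) (x : U p) : V q :=
  ksign k (n * p + n + p) *: deg_cast V (homk_deg e) (h p _ (subrK 1 p) x).1.
have psil : glin (U := fun=> U) (V := fun=> V) psi.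
  by move=> i p q e t x y; rewrite /psi linearP fstD fstZ linearP scaleP.
have psiE i p q (e : p + (n - 1) = q) m (e' : m + 1 = p) (j : m + n = q) x :
    psi i p q e x = ksign k (n * p + n + p) *: deg_cast V j (h p m e' x).1.
  have em : m = p - 1 by lia.
  by subst m; rewrite (int_irr e' (subrK 1 p)) (int_irr j (homk_deg e)).
exists (n - 1), (subrK 1 n), (GMap (R := gtotal _ _) psil I).
apply: gmap_ext => -[] p q e x.
have j1 : p + (n - 1) = q - 1 by lia.
have j2 : p + 1 + (n - 1) = q by lia.
have j3 : p - 1 + n = q - 1 by lia.
rewrite [RHS](gdrawE _ _ _ j1 (subrK _ _) erefl j2) /=.
rewrite (psiE _ _ _ j1 _ (subrK 1 p) j3) (psiE _ _ _ j2 _ erefl e).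
have := congr1 (fun z => z.1) (hd p _ _ (subrK 1 p) erefl x); rewrite fstD cone_d1 => E0.
have {E0} /= E0 := congr1 (fun z => deg_cast V e (ksign k (n * p) *: z)) E0.
rewrite scalerA ksignMM scale1r (gm_cc _ _ e) in E0.
rewrite E0 linearZZ linearD /= (linearZZ (deg_cast V e)) (linearZZ (cxd V _)).
rewrite (cc_d j3 (cone_deg1 n (subrK 1 p)) (subrK 1 q) e).
rewrite scalerDr scalerBr !scalerA -scaleNr.
by congr (_ *: _ + _ *: _); ksolve.
Qed.

(** The argument of [hproj_lift] in degree n: x |-> (0, psi x), up to sign, is a morphism into the
    cone with j = n + 1, and a null-homotopy provides a cocycle phi together with zeta such that f
    phi - psi = d zeta. *)
Lemma post_surj n (psi : homk W n) : cyc psi ->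
  exists2 phi : homk V n, cyc phi & coh (post n phi) psi.
Proof.
move=> cpsi.
have dpsi p p' q q' (e : p + n = q) (e' : p' + n = q') (i : p + 1 = p') (j : q + 1 = q') x :
    psi tt p' q' e' (cxd U i x) = cxd W j (psi tt p q e x).
  have i1 : p + (n + 1) = q' by lia.
  have := congr1 (fun g : homk W (n + 1) => ksign k p *: g tt p q' i1 x) (cpsi _ erefl).
  rewrite /= (gdrawE _ _ _ e j i e') scalerA ksignMM scale1r scaler0 => /eqP.
  by rewrite subr_eq0 eq_sym => /eqP.
have i1 p : p + n = p + (n + 1) - 1 by lia.
pose u p (x : U p) : cone f (n + 1) p := (0, ksign k (n * p) *: psi tt p _ (i1 p) x).
have ul p : linear (@u p).
  move=> t x y; apply: injective_projections; rewrite /= ?(gm_lin _) ?scaleP //.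
  by rewrite scaler0 addr0.
have ud (p p' : int) (i : p + 1 = p') x : u p' (cxd U i x) = cxd (cone f (n + 1)) i (u p x).
  apply: injective_projections; rewrite ?cone_d1 ?cone_d2 /= !linear0 ?scaler0 //.
  rewrite (dpsi _ _ _ _ (i1 p) _ _ (cone_deg2 (n + 1) i)) (linearZZ (cxd W _)) sub0r -scaleNr scalerA.
  by congr (_ *: _); subst p'; ksolve.
have [h hd] := null_homotopic (cmor_of ul ud) (cone_acyclic (j := n + 1) qf).
have jd p q (e : p + n = q) : p - 1 + (n + 1) = q by lia.
have jz p q (e : p + (n - 1) = q) : p - 1 + (n + 1) - 1 = q by lia.
pose phi (i : unit) p q (e : p + n = q) (x : U p) : V q :=
  ksign k (n * p + n + 1) *: deg_cast V (jd _ _ e) (h p _ (subrK 1 p) x).1.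
pose zeta (i : unit) p q (e : p + (n - 1) = q) (x : U p) : W q :=
  ksign k (n * p + n + p + 1) *: deg_cast W (jz _ _ e) (h p _ (subrK 1 p) x).2.
have phil : glin (U := fun=> U) (V := fun=> V) phi.
  by move=> i p q e t x y; rewrite /phi linearP fstD fstZ linearP scaleP.
have zetal : glin (U := fun=> U) (V := fun=> W) zeta.
  by move=> i p q e t x y; rewrite /zeta linearP sndD sndZ linearP scaleP.
have phiE i p q (e : p + n = q) m (e' : m + 1 = p) (j : m + (n + 1) = q) x :
    phi i p q e x = ksign k (n * p + n + 1) *: deg_cast V j (h p m e' x).1.
  have em : m = p - 1 by lia.
  by subst m; rewrite (int_irr e' (subrK 1 p)) (int_irr j (jd _ _ e)).
have zetaE i p q (e : p + (n - 1) = q) m (e' : m + 1 = p) (j : m + (n + 1) - 1 = q) x :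
    zeta i p q e x = ksign k (n * p + n + p + 1) *: deg_cast W j (h p m e' x).2.
  have em : m = p - 1 by lia.
  by subst m; rewrite (int_irr e' (subrK 1 p)) (int_irr j (jz _ _ e)).
have hd1 p x : cxd V (cone_deg1 (n + 1) (subrK 1 p)) (h p _ (subrK 1 p) x).1 =
    ksign k n *: (h _ p erefl (cxd U erefl x)).1.
  have /esym := congr1 (fun z => z.1) (hd p _ _ (subrK 1 p) erefl x).
  rewrite fstD cone_d1 /= => /eqP; rewrite addr_eq0 => /eqP E0.
  have := congr1 (fun z => ksign k (n + 1) *: z) E0.
  by rewrite /= scalerA ksignMM scale1r scalerN -scaleNr ksignN => ->; congr (_ *: _); ksolve.
exists (GMap (R := gtotal _ _) phil I).
  move=> m e; apply: gmap_ext => -[] p q e'.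
  move=> x; have j1 : p + n = q - 1 by lia.
  have j2 : p + 1 + n = q by lia.
  have j3 : p - 1 + (n + 1) = q - 1 by lia.
  have j4 : p + (n + 1) = q by lia.
  rewrite [LHS](gdrawE _ _ _ j1 (subrK _ _) erefl j2) /=.
  rewrite (phiE _ _ _ j1 _ (subrK 1 p) j3) (phiE _ _ _ j2 _ erefl j4) linearZZ.
  rewrite (cc_d j3 (cone_deg1 (n + 1) (subrK 1 p)) (subrK 1 q) j4) hd1.
  rewrite (linearZZ (deg_cast V _)) scalerA.
  have -> : ksign k (n * (p + 1) + n + 1) = ksign k (n * p + n + 1) * ksign k n by ksolve.
  by rewrite subrr scaler0.
exists (n - 1), (subrK 1 n), (GMap (R := gtotal _ _) zetal I).
apply: gmap_ext => -[] p q e x.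
have j1 : p + (n - 1) = q - 1 by lia.
have j2 : p + 1 + (n - 1) = q by lia.
have j3 : p - 1 + (n + 1) - 1 = q - 1 by lia.
have j4 : p + (n + 1) - 1 = q by lia.
have j5 : p - 1 + (n + 1) = q by lia.
rewrite gmDE gmNE [RHS](gdrawE _ _ _ j1 (subrK _ _) erefl j2) /=.
rewrite (zetaE _ _ _ j1 _ (subrK 1 p) j3) (zetaE _ _ _ j2 _ erefl j4).
rewrite (phiE _ _ _ e _ (subrK 1 p) j5).
have := congr1 (fun z => z.2) (hd p _ _ (subrK 1 p) erefl x); rewrite sndD cone_d2 => E0.
have {E0} /= E0 := congr1 (fun z => deg_cast W j4 (ksign k (n * p) *: z)) E0.
rewrite scalerA ksignMM scale1r (gm_cc _ _ e) in E0.
rewrite E0 linearZZ !linearD linearN /= !(linearZZ (deg_cast W _)) (linearZZ (cxd W _)).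
rewrite (cc_cc _ _ j5) (cc_d j3 (cone_deg2 (n + 1) (subrK 1 p)) (subrK 1 q) j4).
rewrite !(scalerDr, scalerN, scalerBr, opprD, opprK) !scalerA.
rewrite !(linearN (deg_cast W _)) opprK (linearZZ (deg_cast W _)) (cc_cmor f) !addrA.
have -> : ksign k (n * p) * ksign k (n + 1) = ksign k (n * p + n + 1) by ksolve.
rewrite subrr add0r -!scaleNr.
by congr (_ *: _ + _ *: _); ksolve.
Qed.

Lemma post_qi : cquasi_iso post.
Proof. by apply/cquasi_isoP => n; split; [apply: post_inj|apply: post_surj]. Qed.
End PostComposition.

(** * Bimodules of graded maps *)

Lemma subrD_mid (V : zmodType) (x u v : V) : x + (u - (v + x)) = u - v.
Proof. by rewrite opprD addrCA [x + _]addrC subrK. Qed.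

Section HomBimodule.
Variables (k : comPzRingType) (A C : dgcat k) (I : Type) (M : I -> rmod A) (N : I -> rmod C).

Notation raw a c n := (graw (fun i => M i a) (fun i => N i c) n).

Fact hdegl (r n m p q : int) : r + n = m -> p + m = q -> (p + r) + n = q. Proof. lia. Qed.
Fact hdegr (r n m p q : int) : n + r = m -> p + m = q -> (p + n) + r = q. Proof. lia. Qed.

(** With maps written on the right these are associativity rules, x (f g) = (x f) g and x (g f) = (x
    g) f, hence free of signs. *)
Definition hom_la a a' c (r n m : int) (e : r + n = m) (f : hom a a' r) (g : raw a c n) :
    raw a' c m :=
  fun i p q e' x => g i _ q (hdegl e e') (rma (erefl (p + r)) x f).
Definition hom_ra a c' c (n r m : int) (e : n + r = m) (g : raw a c n) (f : hom c' c r) :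
    raw a c' m :=
  fun i p q e' x => rma (hdegr e e') (g i p _ (erefl (p + n)) x) f.

Lemma hom_laE a a' c (r n m : int) (e : r + n = m) (f : hom a a' r) (g : raw a c n)
    i (p q pr : int) (e' : p + m = q) (j : p + r = pr) (l : pr + n = q) x :
  hom_la e f g e' x = g i pr q l (rma j x f).
Proof. by subst pr; rewrite /hom_la (int_irr (hdegl e e') l). Qed.
Lemma hom_raE a c' c (n r m : int) (e : n + r = m) (g : raw a c n) (f : hom c' c r)
    i (p q pn : int) (e' : p + m = q) (j : p + n = pn) (l : pn + r = q) x :
  hom_ra e g f e' x = rma l (g i p pn j x) f.
Proof. by subst pn; rewrite /hom_ra (int_irr (hdegr e e') l). Qed.

Variable R : forall c a, gsub (fun i => M i a) (fun i => N i c).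
Hypothesis Rla : forall a a' c (r n m : int) (e : r + n = m) (f : hom a a' r) (g : raw a c n),
  gs (R c a) g -> gs (R c a') (hom_la e f g).
Hypothesis Rra : forall a c' c (n r m : int) (e : n + r = m) (g : raw a c n) (f : hom c' c r),
  gs (R c a) g -> gs (R c' a) (hom_ra e g f).

Fact hla_lin a a' c (r n m : int) (e : r + n = m) (f : hom a a' r) (g : gmap (R c a) n) :
  glin (hom_la e f g).
Proof. by move=> i p q e' t x y; rewrite /hom_la rmaDl rmaZl (gm_lin g). Qed.
Fact hra_lin a c' c (n r m : int) (e : n + r = m) (g : gmap (R c a) n) (f : hom c' c r) :
  glin (hom_ra e g f).
Proof. by move=> i p q e' t x y; rewrite /hom_ra (gm_lin g) rmaDl rmaZl. Qed.

Definition hla c a a' (r n m : int) (e : r + n = m) (f : hom a a' r)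
    (g : gcx (R c a) n) : gcx (R c a') m :=
  GMap (hla_lin e f g) (Rla e f (gm_in g)).
Definition hra c' c a (n r m : int) (e : n + r = m) (g : gcx (R c a) n)
    (f : hom c' c r) : gcx (R c' a) m :=
  GMap (hra_lin e g f) (Rra e f (gm_in g)).

Lemma hlaE a a' c (r n m : int) (e : r + n = m) (f : hom a a' r) (g : gcx (R c a) n)
    i (p q pr : int) (e' : p + m = q) (j : p + r = pr) (l : pr + n = q) x :
  hla e f g i p q e' x = g i pr q l (rma j x f).
Proof. exact: hom_laE. Qed.
Lemma hraE a c' c (n r m : int) (e : n + r = m) (g : gcx (R c a) n) (f : hom c' c r)
    i (p q pn : int) (e' : p + m = q) (j : p + n = pn) (l : pn + r = q) x :
  hra e g f i p q e' x = rma l (g i p pn j x) f.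
Proof. exact: hom_raE. Qed.

Definition hom_bimod : bimod A C.
Proof.
refine (@Bimod k A C (fun c a => gcx (R c a)) hla hra _ _ _ _ _ _ _ _ _).
- move=> c a a' r n m e; split=> [f|g] t u v; apply: gmap_ext => i p q e' x;
    rewrite gmDE gmZE; have l : p + r + n = q by lia.
  + by rewrite !(hlaE _ _ _ e' (erefl _) l) gmDE gmZE.
  + by rewrite !(hlaE _ _ _ e' (erefl _) l) rmaDr rmaZr gm_atD gm_atZ.
- move=> c' c a n r m e; split=> [g|f] t u v; apply: gmap_ext => i p q e' x;
    rewrite gmDE gmZE; have l : p + n + r = q by lia.
  + by rewrite !(hraE _ _ _ e' (erefl _) l) rmaDr rmaZr.
  + by rewrite !(hraE _ _ _ e' (erefl _) l) gmDE gmZE rmaDl rmaZl.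
- move=> c a a' a'' p q r pq qr n e1 e2 e3 e4 g f h; apply: gmap_ext => i s t e' x.
  have l2 : s + p + qr = t by lia.
  have l3 : s + p + q = s + pq by lia.
  have l4 : s + pq + r = t by lia.
  rewrite (hlaE _ _ _ e' (erefl _) l2) (hlaE _ _ _ l2 l3 l4).
  by rewrite (hlaE _ _ _ e' (erefl _) l4) (rmaA (erefl _) l3 e1 (erefl _)).
- move=> c'' c' c a p q r pq qr n e1 e2 e3 e4 h g f; apply: gmap_ext => i s t e' x.
  have l1 : s + p + qr = t by lia.
  have l2 : s + p + q + r = t by lia.
  have l3 : s + pq = s + p + q by lia.
  rewrite (hraE _ _ _ e' (erefl _) l1) (hraE _ _ _ e' l3 l2).
  by rewrite (hraE _ _ _ l3 (erefl _) (erefl _)) (rmaA (erefl _) l2 e3 l1).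
- move=> c' c a a' p q r pq qr n e1 e2 e3 e4 f h g; apply: gmap_ext => i s t e' x.
  have l1 : s + p + qr = t by lia.
  have l2 : s + p + q + r = t by lia.
  have l3 : s + pq = s + p + q by lia.
  rewrite (hlaE _ _ _ e' (erefl _) l1) (hraE _ _ _ l1 (erefl _) l2).
  by rewrite (hraE _ _ _ e' l3 l2) (hlaE _ _ _ l3 (erefl _) (erefl _)).
- move=> c a n e h; apply: gmap_ext => i p q e' x.
  by rewrite (hlaE _ _ _ e' (addr0 p) e') rma1.
- move=> c a n e h; apply: gmap_ext => i p q e' x.
  by rewrite (hraE _ _ _ e' e' (addr0 q)) rma1.
- move=> c a a' p q n p' q' n' e ep eq en el er f h; apply: gmap_ext => i s t e' x.
  have i1 : s + n + 1 = t by lia.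
  have i2 : s + 1 + n = t by lia.
  have i3 : s + p' + q = t by lia.
  have i4 : s + p + q' = t by lia.
  have i5 : s + p + q = s + n by lia.
  have i6 : s + 1 + p = s + p' by lia.
  have i7 : s + p + 1 = s + p' by lia.
  rewrite gmDE gmZE (gdE en _ e' (erefl _) i1 (erefl _) i2).
  rewrite (hlaE _ _ _ _ (erefl _) i5) (hlaE _ _ _ _ i6 i3).
  rewrite (hlaE _ _ _ _ (erefl _) i3) (hlaE _ _ _ _ (erefl _) i4).
  rewrite (gdE eq _ i4 i5 i1 i7 i3).
  rewrite (rma_d (erefl _) (erefl _) ep i7 i6 (erefl _)) gm_atD gm_atZ.
  rewrite !(scalerBr, scalerDr) !scalerA.
  have -> : ksign k p * ksign k (s + p) = ksign k s by ksolve.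
  by rewrite ksignMM scale1r subrD_mid.
- move=> c' c a p q n p' q' n' e ep eq en el er h f; apply: gmap_ext => i s t e' x.
  have i1 : s + n + 1 = t by lia.
  have i2 : s + 1 + n = t by lia.
  have i3 : s + p' + q = t by lia.
  have i4 : s + p + q' = t by lia.
  have i5 : s + p + q = s + n by lia.
  have i6 : s + 1 + p = s + p' by lia.
  have i7 : s + p + 1 = s + p' by lia.
  rewrite gmDE gmZE (gdE en _ e' (erefl _) i1 (erefl _) i2).
  rewrite (hraE _ _ _ _ (erefl _) i5) (hraE _ _ _ _ i6 i3).
  rewrite (hraE _ _ _ _ (erefl _) i3) (hraE _ _ _ _ (erefl _) i4).
  rewrite (gdE ep _ (erefl _) (erefl _) i7 (erefl _) i6).
  rewrite (rma_d i5 i7 eq i1 i3 i4) rmaZl rmaBl.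
  rewrite [_ + _ *: _ - _]addrAC scalerDr scalerA.
  by congr (_ + _ *: _); ksolve.
Defined.
End HomBimodule.

Section Unop.
Variables (k : comPzRingType) (A B : dgcat k) (T : bimod (op A) (op B)).

(* The identity on complexes: T(b, a) is read as T(a, b).  As [op (op A)] is not
   [A], this cannot be had by taking opposites twice. *)
Definition unop_la (a : A) (b b' : B) (p q n : int) (e : p + q = n) (f : hom b b' p)
    (x : T b a q) : T b' a n :=
  ksign k (p * q) *: @bra k (op A) (op B) T b' b a q p n (etrans (addrC q p) e) x f.
Definition unop_ra (a' a : A) (b : B) (p q n : int) (e : p + q = n) (x : T b a p)
    (f : hom a' a q) : T b a' n :=
  ksign k (p * q) *: @bla k (op A) (op B) T b a a' q p n (etrans (addrC q p) e) f x.

Lemma unop_laE (a : A) (b b' : B) (p q n : int) (e : p + q = n) (i : q + p = n) (f : hom b b' p) (x : T b a q) :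
  unop_la e f x = ksign k (p * q) *: @bra k (op A) (op B) T b' b a q p n i x f.
Proof. by rewrite /unop_la (int_irr (etrans _ _) i). Qed.
Lemma unop_raE (a' a : A) (b : B) (p q n : int) (e : p + q = n) (i : q + p = n) (x : T b a p) (f : hom a' a q) :
  unop_ra e x f = ksign k (p * q) *: @bla k (op A) (op B) T b a a' q p n i f x.
Proof. by rewrite /unop_ra (int_irr (etrans _ _) i). Qed.

Definition unop : bimod B A.
Proof.
refine (@Bimod k B A (fun a b => T b a) unop_la unop_ra _ _ _ _ _ _ _ _ _).
- move=> a b b' p q n e; split=> u t v w; rewrite /unop_la;
    by rewrite ?(braDl, braDr, braZl, braZr) scaleP.
- move=> a' a b p q n e; split=> u t v w; rewrite /unop_ra;
    by rewrite ?(blaDl, blaDr, blaZl, blaZr) scaleP.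
- move=> a b b' b'' p q r pq qr n e1 e2 e3 e4 g f x.
  have i1 : r + q = qr by lia.
  have i2 : qr + p = n by lia.
  have i3 : r + pq = n by lia.
  have i4 : q + p = pq by lia.
  rewrite (unop_laE e4 i2) (unop_laE e3 i1) (unop_laE e2 i3) braZl.
  rewrite -(braA i1 i2 i4 i3 x (f : hom (d := op B) b' b q) (g : hom (d := op B) b'' b' p)).
  rewrite /= braZr (int_irr (etrans _ _) e1) !scalerA.
  by congr (_ *: _); ksolve.
- move=> a'' a' a b p q r pq qr n e1 e2 e3 e4 x g f.
  have i1 : q + p = pq by lia.
  have i2 : r + pq = n by lia.
  have i3 : r + q = qr by lia.
  have i4 : qr + p = n by lia.
  rewrite (unop_raE e4 i4) (unop_raE e2 i2) (unop_raE e1 i1) blaZr.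
  rewrite (blaA i3 i4 i1 i2 (f : hom (d := op A) a' a'' r) (g : hom (d := op A) a a' q) x).
  rewrite /= blaZl (int_irr (etrans _ _) e3) !scalerA.
  by congr (_ *: _); ksolve.
- move=> a' a b b' p q r pq qr n e1 e2 e3 e4 f x g.
  have i1 : r + q = qr by lia.
  have i2 : qr + p = n by lia.
  have i3 : q + p = pq by lia.
  have i4 : r + pq = n by lia.
  rewrite (unop_laE e4 i2) (unop_raE e3 i1) (unop_raE e2 i4) (unop_laE e1 i3) braZl blaZr.
  rewrite (blra i1 i2 i3 i4 (g : hom (d := op A) a a' r) x (f : hom (d := op B) b' b p)).
  by rewrite !scalerA; congr (_ *: _); ksolve.
- move=> a b p e x; rewrite (unop_laE e (addr0 p)) mul0r scale1r.
  exact: (bra1 (b0 := T)).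
- move=> a b p e x; rewrite (unop_raE e (add0r p)) mulr0 scale1r.
  exact: (bla1 (b0 := T)).
- move=> a b b' p q n p' q' n' e ep eq en el er f x.
  have i : q + p = n by lia.
  have i1 : q + p' = n' by lia.
  have i2 : q' + p = n' by lia.
  rewrite (unop_laE e i) (unop_laE el i1) (unop_laE er i2) linearZZ.
  rewrite (bra_d i eq ep en i2 i1 x (f : hom (d := op B) b' b p)).
  rewrite scalerDr !scalerA addrC.
  by congr (_ *: _ + _ *: _); subst; ksolve.
- move=> a' a b p q n p' q' n' e ep eq en el er x f.
  have i : q + p = n by lia.
  have i1 : q + p' = n' by lia.
  have i2 : q' + p = n' by lia.
  rewrite (unop_raE e i) (unop_raE el i1) (unop_raE er i2) linearZZ.
  rewrite (bla_d i eq ep en i2 i1 (f : hom (d := op A) a a' q) x).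
  rewrite scalerDr !scalerA addrC.
  by congr (_ *: _ + _ *: _); subst; ksolve.
Defined.
End Unop.

(** * Restriction of h-projective bimodules *)

Lemma dgid_cyc (k : comPzRingType) (A : dgcat k) (a : A) : cyc (dgid a).
Proof.
apply: (cycP (e := add0r 1)).
have := dgc_d (addr0 0) (add0r 1) (add0r 1) (add0r 1) (addr0 1) (add0r 1) (dgid a) (dgid a).
rewrite dgc1l dgc1r dgc1l scale1r => /eqP.
by rewrite -subr_eq0 opprD addrA subrr sub0r oppr_eq0 => /eqP.
Qed.

Section HomotopyInverse.
Variables (k : comPzRingType) (B : dgcat k) (N M : rmod B) (s : rmor N M).

Definition section_up_to_homotopy :=
  exists (g : rmor M N) (h : forall b (n m : int), m + 1 = n -> {linear M b n -> M b m}),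
  (forall x y (p q n p' n' : int) (e : p + q = n) (ep : p' + 1 = p) (en : n' + 1 = n)
     (e' : p' + q = n') (u : M y p) (f : hom x y q),
     h x n n' en (rma e u f) = rma e' (h y p p' ep u) f) /\
  (forall b (n m l : int) (e : m + 1 = n) (e' : n + 1 = l) (x : M b n),
     s b n (g b n x) - x = cxd _ e (h b n m e x) + h b l n e' (cxd _ e' x)).
End HomotopyInverse.

Section Coinduction.
Variables (k : comPzRingType) (A B : dgcat k).

(* Hom_k(A(-, a), N), right adjoint to restriction along [a] *)
Definition coind (N : rmod B) (a : A) : bimod A B :=
  @hom_bimod k A B unit (fun _ => representable a) (fun _ => N) (fun _ _ => gtotal _ _)
    (fun _ _ _ _ _ _ _ _ _ _ => I) (fun _ _ _ _ _ _ _ _ _ _ => I).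

Lemma coind_raE (N : rmod B) (a a' : A) b b' (n r m : int) (e : n + r = m) (g : coind N a b a' n)
    (f : hom b' b r) i (p q pn : int) (e' : p + m = q) (j : p + n = pn) (l : pn + r = q) x :
  (bra e g f : coind N a b' a' m) i p q e' x = rma l (g i p pn j x) f.
Proof. exact: hom_raE. Qed.
Lemma coind_laE (N : rmod B) (a a1 a2 : A) b (r n m : int) (e : r + n = m)
    (f : hom a1 a2 r) (g : coind N a b a1 n)
    i (p q pr : int) (e' : p + m = q) (j : p + r = pr) (l : pr + n = q) x :
  (bla e f g : coind N a b a2 m) i p q e' x = g i pr q l (dgc j x f).
Proof. exact: hom_laE. Qed.

Section Map.
Variables (N N' : rmod B) (s : rmor N N') (a : A).
Definition coind_map : bmor (coind N a) (coind N' a).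
Proof.
refine (@Bmor k A B (coind N a) (coind N' a) (fun b a' => post (hom a' a) (s b)) _ _).
- by move=> b a1 a2 p q n e f g; apply: gmap_ext.
- move=> b' b a1 p q n e g f; apply: gmap_ext => i t u e' x.
  by rewrite /= /hom_ra rmor_act.
Defined.
Lemma coind_map_qi : hproj_cat A -> rquasi_iso s -> bquasi_iso coind_map.
Proof. by move=> hA qs b a'; apply: post_qi; [apply: hA|apply: qs]. Qed.
End Map.

Section Unit.
Variables (P : bimod A B) (a : A).
Definition coind_unit_raw b a' n (x : P b a' n) :
    graw (fun _ : unit => hom a' a) (fun _ : unit => P b a) n :=
  fun i p q e f => bla e f x.
Fact coind_unit_lin b a' n (x : P b a' n) : glin (coind_unit_raw x).
Proof. by move=> i p q e t u v; rewrite /coind_unit_raw blaDl blaZl. Qed.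
Definition coind_unit_fun b a' n (x : P b a' n) : coind (bm_right P a) a b a' n :=
  GMap (R := gtotal _ _) (coind_unit_lin x) I.
Fact coind_unit_linear b a' n : linear (@coind_unit_fun b a' n).
Proof.
move=> t x y; apply: gmap_ext => i p q e f.
by rewrite gmDE gmZE /= /coind_unit_raw blaDr blaZr.
Qed.
Fact coind_unit_d b a' (n m : int) (e : n + 1 = m) x :
  coind_unit_fun (cxd (P b a') e x) = cxd (coind (bm_right P a) a b a') e (coind_unit_fun x).
Proof.
apply: gmap_ext => i p q e' f.
have i1 : p + n + 1 = q by lia.
have i2 : p + 1 + n = q by lia.
rewrite [RHS](gdrawE _ _ e' (erefl _) i1 (erefl _) i2) /= /coind_unit_raw.
rewrite (bla_d (erefl _) (erefl _) e i1 i2 e') addrBl.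
by rewrite scalerA ksignMM scale1r.
Qed.
Definition coind_unit : bmor P (coind (bm_right P a) a).
Proof.
apply: (bmor_of coind_unit_linear coind_unit_d).
- move=> b a1 a2 p q n e u x; apply: gmap_ext => i s t e' f.
  have l : s + p + q = t by lia.
  rewrite [RHS](hom_laE _ _ _ e' (erefl _) l) /= /coind_unit_raw.
  exact: blaA.
- move=> b' b a1 p q n e x u; apply: gmap_ext => i s t e' f.
  have l : s + p + q = t by lia.
  rewrite [RHS](hom_raE _ _ _ e' (erefl _) l) /= /coind_unit_raw.
  exact: blra.
Defined.
End Unit.

Section Right.
Variables (P : bimod A B) (a : A) (N : rmod B) (s : rmor N (bm_right P a)).
Hypotheses (hP : hproj P) (hA : hproj_cat A) (qs : rquasi_iso s).

(** Coinduction turns s into a quasi-isomorphism of bimodules, because the complexes A(a', a) are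
    h-projective. The unit x |-> (f |-> f x) lifts through it up to homotopy, as P is h-projective;
    transposing the lift back gives the section. *)
Lemma right_section : section_up_to_homotopy s.
Proof.
have [g [h [hl hr hd]]] := hproj_lift hP (coind_map_qi a hA qs) (coind_unit P a).
(* Evaluation at the identity of a is the counit of restriction and coinduction. It is right linear
   and commutes with d, so it carries both the lift and its homotopy over to modules. *)
pose ev (T : rmod B) b n (x : coind T a b a n) : T b n := x tt 0 n (add0r n) (dgid a).
have evl T b n : linear (@ev T b n) by move=> t x y; rewrite /ev gmDE gmZE.
have evD T b n x y : ev T b n (x + y) = ev T b n x + ev T b n y by rewrite /ev gmDE.
have evB T b n x y : ev T b n (x - y) = ev T b n x - ev T b n y by rewrite /ev gmDE gmNE.
have evr T x y (p q n : int) (e : p + q = n) (u : coind T a y a p) (f : hom x y q) :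
    ev T x n (bra e u f) = rma e (ev T y p u) f.
  exact: (hom_raE _ _ _ _ (add0r p) e).
have evd T b (n m : int) (e : n + 1 = m) x :
    ev T b m (cxd (coind T a b a) e x) = cxd (T b) e (ev T b n x).
  have i : 1 + n = m by lia.
  rewrite [LHS](gdrawE _ _ _ (add0r n) e (add0r 1) i) scale1r.
  by rewrite (dgid_cyc a) gm_at0 subr0.
have gl b n : linear (fun x => ev N b n (g b a n x)).
  by move=> t x y; rewrite (linearP (g b a n)) evl.
have gd b (n m : int) (e : n + 1 = m) x :
    ev N b m (g b a m (cxd (P b a) e x)) = cxd (N b) e (ev N b n (g b a n x)).
  by rewrite cmor_d evd.
pose g' b := cmor_of (gl b) (gd b).
have g'r x y (p q n : int) (e : p + q = n) (u : P y a p) (f : hom x y q) :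
    g' x n (bra e u f) = rma e (g' y p u) f.
  change (ev N x n (g x a n (bra e u f)) = rma e (ev N y p (g y a p u)) f).
  by rewrite bmor_ra evr.
exists (@RMor k B (bm_right P a) N g' g'r).
exists (fun b n m e => lin_of (linear_comp (lin_of (@evl (bm_right P a) b m)) (h b a n m e))).
split=> /=.
- by move=> x y p q n p' n' e ep en e' u f; rewrite (hr _ _ _ _ _ _ _ _ e ep en e') evr.
- move=> b n m l e e' x.
  have /(congr1 (ev (bm_right P a) b n)) := hd b a n m l e e' x.
  rewrite evB [X in _ = X -> _]evD evd => <-; congr (_ - _).
  exact/esym/bla1.
Qed.
End Right.
End Coinduction.

Section LeftUnit.
Variables (k : comPzRingType) (A B : dgcat k) (P : bimod B A) (a : A).
Notation N := (bm_left P a).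

Definition lcoind (M : rmod (op B)) : bimod B A := unop (coind (A := op A) M a).

(** The unit of coinduction for left modules, f |-> x f. The sign comes from exchanging f and x in
    the opposite category. *)
Definition lunit_raw (a' : A) (b : B) n (x : P a' b n) :
    graw (fun _ : unit => hom (d := op A) a' a) (fun _ : unit => N b) n :=
  fun i p q e f => ksign k (p * n) *: bra (etrans (addrC n p) e) x (f : hom a a' p).
Lemma lunit_rawE (a' : A) (b : B) n (x : P a' b n) i p q (e : p + n = q) (j : n + p = q) f :
  @lunit_raw a' b n x i p q e f = ksign k (p * n) *: bra j x (f : hom a a' p).
Proof. by rewrite /lunit_raw (int_irr (etrans _ _) j). Qed.
Fact lunit_lin a' b n (x : P a' b n) : glin (lunit_raw x).
Proof. by move=> i p q e t u v; rewrite /lunit_raw braDr braZr scaleP. Qed.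
Definition lunit_fun a' b n (x : P a' b n) : lcoind N a' b n :=
  GMap (R := gtotal _ _) (lunit_lin x) I.
Fact lunit_linear a' b n : linear (@lunit_fun a' b n).
Proof.
move=> t x y; apply: gmap_ext => i p q e f.
by rewrite gmDE gmZE /= /lunit_raw braDl braZl scaleP.
Qed.
Fact lunit_d a' b (n m : int) (e : n + 1 = m) x :
  lunit_fun (cxd (P a' b) e x) = cxd (lcoind N a' b) e (lunit_fun x).
Proof.
apply: gmap_ext => i p q e' f.
have i1 : p + n + 1 = q by lia.
have i2 : p + 1 + n = q by lia.
have j : n + p = p + n by lia.
have j1 : m + p = q by lia.
have j2 : n + (p + 1) = q by lia.
rewrite [RHS](gdrawE _ _ e' (erefl _) i1 (erefl _) i2) [LHS](lunit_rawE _ _ j1).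
rewrite /= (lunit_rawE _ _ j) (lunit_rawE _ _ j2) linearZZ.
rewrite (bra_d j e (erefl _) i1 j1 j2) !(scalerDr, scalerN) !scalerA.
have -> : ksign k p * ksign k ((p + 1) * n) = ksign k p * ksign k (p * n) * ksign k n by ksolve.
by rewrite addrK; congr (_ *: _); subst m; ksolve.
Qed.
Definition lunit : bmor P (lcoind N).
Proof.
apply: (bmor_of lunit_linear lunit_d).
- move=> a' b b' p q n e u x; apply: gmap_ext => i s t e' f.
  have l : q + p = n by lia.
  have l1 : s + q + p = t by lia.
  have l2 : q + s = s + q by lia.
  have l3 : n + s = t by lia.
  have l4 : p + (s + q) = t by lia.
  rewrite [LHS](lunit_rawE _ _ l3).
  rewrite -[RHS]/(unop_la e u (lunit_fun x) i s t e' f) (unop_laE _ l) gmZE.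
  rewrite (coind_raE (A := op A) _ _ _ _ (erefl (s + q)) l1) [X in rma _ X _](lunit_rawE _ _ l2) /=.
  rewrite blaZr !scalerA (int_irr (etrans _ _) l4) (blra e l3 l2 l4).
  by congr (_ *: _); subst; ksolve.
- move=> a1 a2 b p q n e x u; apply: gmap_ext => i s t e' f.
  have l : q + p = n by lia.
  have l1 : s + q + p = t by lia.
  have l2 : p + (q + s) = t by lia.
  have l3 : n + s = t by lia.
  have l4 : q + s = s + q by lia.
  have l5 : p + (s + q) = t by lia.
  rewrite [LHS](lunit_rawE _ _ l3).
  rewrite -[RHS]/(unop_ra e (lunit_fun x) u i s t e' f) (unop_raE _ l) gmZE.
  rewrite (coind_laE (A := op A) _ _ _ _ (erefl (s + q)) l1) [X in _ = _ *: X](lunit_rawE _ _ l5) /=.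
  rewrite (int_irr (addrC q s) l4) braZr !scalerA (braA e l3 l4 l5).
  by congr (_ *: _); subst; ksolve.
Defined.
End LeftUnit.

Section Left.
Variables (k : comPzRingType) (A B : dgcat k) (P : bimod B A) (a : A).
Variables (N : rmod (op B)) (s : rmor N (bm_left P a)).
Hypotheses (hP : hproj P) (hA : hproj_cat A) (qs : rquasi_iso s).

Definition lcoind_map : bmor (lcoind (A := A) a N) (lcoind a (bm_left P a)).
Proof.
refine (@Bmor k B A (lcoind a N) (lcoind a (bm_left P a)) (fun a' b => coind_map (A := op A) s a b a') _ _).
- move=> a' b b' p q n e u x.
  rewrite -[bla e u x]/(unop_la e u x) /unop_la linearZZ.
  rewrite (bmor_ra (coind_map (A := op A) s a)). exact: erefl.
- move=> a2 a1 b p q n e x u.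
  rewrite -[bra e x u]/(unop_ra e x u) /unop_ra linearZZ.
  rewrite (bmor_la (coind_map (A := op A) s a)); exact: erefl.
Defined.
Lemma lcoind_map_qi : bquasi_iso lcoind_map.
Proof. by move=> a' b; apply: (coind_map_qi (A := op A)); [move=> x y; apply: hA|]. Qed.

(** The argument of [right_section] over the opposite categories. The lifting takes place among
    B-A-bimodules, which is why coinduction is brought back by [unop]. *)
Lemma left_section : section_up_to_homotopy s.
Proof.
have [g [h [hl hr hd]]] := hproj_lift hP lcoind_map_qi (lunit P a).
pose ev (T : rmod (op B)) b n (x : lcoind (A := A) a T a b n) : T b n := x tt 0 n (add0r n) (dgid a).
have evl T b n : linear (@ev T b n) by move=> t x y; rewrite /ev gmDE gmZE.
have evD T b n x y : ev T b n (x + y) = ev T b n x + ev T b n y by rewrite /ev gmDE.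
have evB T b n x y : ev T b n (x - y) = ev T b n x - ev T b n y by rewrite /ev gmDE gmNE.
have evZ T b n t x : ev T b n (t *: x) = t *: ev T b n x by rewrite /ev gmZE.
have evr T (x y : B) (p q n : int) (e : q + p = n) (i : p + q = n) 
    (u : lcoind (A := A) a T a y p) (f : hom y x q) :
    ev T x n (bla e f u) = ksign k (q * p) *: rma i (ev T y p u) (f : hom (d := op B) x y q).
  rewrite -[bla e f u]/(unop_la e f u) (unop_laE _ i) evZ; congr (_ *: _).
  exact: (hom_raE _ _ _ _ (add0r p) i).
have evd T b (n m : int) (e : n + 1 = m) x :
    ev T b m (cxd (lcoind (A := A) a T a b) e x) = cxd (T b) e (ev T b n x).
  have i : 1 + n = m by lia.
  rewrite [LHS](gdrawE _ _ _ (add0r n) e (add0r 1) i) scale1r.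
  have -> : cxd (hom (d := op A) a a) (add0r 1) (dgid a) = 0 by apply: (dgid_cyc a).
  by rewrite gm_at0 subr0.
have gl b n : linear (fun x => ev N b n (g a b n x)).
  by move=> t x y; rewrite (linearP (g a b n)) evl.
have gd b (n m : int) (e : n + 1 = m) x :
    ev N b m (g a b m (cxd (P a b) e x)) = cxd (N b) e (ev N b n (g a b n x)).
  by rewrite cmor_d evd.
pose g' (b : op B) : cmor (P a b) (N b) := cmor_of (gl b) (gd b).
have g'r (x y : op B) (p q n : int) (e : p + q = n) (u : bm_left P a y p) (f : hom x y q) :
    g' x n (rma e u f) = rma e (g' y p u) f.
  change (ev N x n (g a x n (ksign k (p * q) *: bla (etrans (addrC q p) e) (f : hom (d := B) y x q) u)) = rma e (ev N y p (g a y p u)) f).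
  rewrite linearZZ bmor_la evZ (evr _ _ _ _ _ _ _ e) scalerA.
  by rewrite [q * p]mulrC ksignMM scale1r.
exists (@RMor k (op B) (bm_left P a) N g' g'r).
exists (fun b n m e => lin_of (linear_comp (lin_of (@evl (bm_left P a) b m)) (h a b n m e))).
split=> /=.
- move=> x y p q n p' n' e ep en e' u f.
  have i : q + p' = n' by lia.
  rewrite linearZZ evZ (hl _ _ _ _ _ _ _ _ _ ep en i) evZ (evr _ _ _ _ _ _ _ e') !scalerA.
  subst p; rewrite -!ksignD; congr (_ *: _); apply: ksign_odd; lia.
- move=> b n m l e e' x.
  have /(congr1 (ev (bm_left P a) b n)) := hd a b n m l e e' x.
  rewrite evB [X in _ = X -> _]evD evd => <-; congr (_ - _).
  have E := lunit_rawE (a := a) x (i := tt) (add0r n) (addr0 n) (dgid a).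
  apply/esym/(etrans E).
  by rewrite mul0r scale1r bra1.
Qed.
End Left.

(** * Modules represented up to homotopy *)

Section Generators.
Variables (k : comPzRingType) (B : dgcat k).
Implicit Types M N : rmod B.

Lemma rma0r M (x y : B) (p q n : int) (e : p + q = n) (u : M y p) :
  rma e u (0 : hom x y q) = 0.
Proof. by rewrite -(scale0r 0) rmaZr scale0r. Qed.

Lemma coh_rma M (x y : B) (p q n : int) (e : p + q = n) (u u' : M y p) (f : hom x y q) :
  coh u u' -> cyc f -> coh (rma e u f) (rma e u' f).
Proof.
move=> [m [i [w hw]]] hf; have j : m + q = n - 1 by lia.
exists (n - 1), (subrK 1 n), (rma j w f).
have l : m + (q + 1) = n by lia.
rewrite (rma_d j i (erefl _) (subrK 1 n) e l) hf.
by rewrite rma0r scaler0 addr0 -hw rmaBl.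
Qed.


Section Mul.
Variables (M : rmod B) (b : B) (u : M b 0) (hu : cyc u).
Fact rmul_linear x n : linear (fun f : hom x b n => rma (add0r n) u f).
Proof. by move=> t f g; rewrite rmaDr rmaZr. Qed.
Fact rmul_d x (n m : int) (e : n + 1 = m) (f : hom x b n) :
  rma (add0r m) u (cxd _ e f) = cxd (M x) e (rma (add0r n) u f).
Proof.
have i : 1 + n = m by lia.
by rewrite (rma_d (add0r n) (add0r 1) e e i (add0r m)) hu rma0l add0r scale1r.
Qed.
Definition rmul : rmor (representable b) M.
Proof.
refine (@RMor k B (representable b) M (fun x => cmor_of (@rmul_linear x) (@rmul_d x)) _).
by move=> x y p q n e f g; apply: rmaA.
Defined.
End Mul.


Definition generated M (b : B) := exists (u : M b 0) (hu : cyc u), rquasi_iso (rmul hu).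

(** Backwards, surjectivity yields only a cocycle v with f v cohomologous to u. This suffices, since
    the Yoneda maps of cohomologous elements agree on cohomology. *)
Lemma generated_qi M N (f : rmor M N) b : rquasi_iso f -> generated M b <-> generated N b.
Proof.
move=> qf; split=> -[u [hu qu]].
  exists (f b 0 u), (cmor_cyc (f b) hu) => x.
  apply: (qi_comp (f := rmul hu x) (g := f x)) => // n g hg.
  by rewrite /= rmor_act; apply: coh_refl.
have [v hv vu] := qi_surj (qf b) hu.
exists v, hv => x; apply: (qi_cancel_g (g := f x) (h := rmul hu x)) => // n g hg.
by rewrite /= rmor_act; apply: coh_rma => //; apply: coh_sym.
Qed.

(** A zigzag ending at a representable collapses to a single quasi-isomorphism out of it: being
    generated by a cocycle over b passes along every step in both directions, and the representable
    is generated by its identity. *)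
Lemma quasi_isomorphic_generated M b : quasi_isomorphic M (representable b) <-> generated M b.
Proof.
split=> [h|[u [hu qu]]]; last by apply: rst_sym; apply: rst_step; exists (rmul hu).
suff [_ E] : generated M b <-> generated (representable b) b.
  apply: E; exists (dgid b), (dgid_cyc b) => x; apply: (qi_id (g := cid_mor _)).
    by move=> n f _; rewrite /= dgc1l; apply: coh_refl.
  by move=> n f _; rewrite /= dgc1l; apply: coh_refl.
elim: h => {M} [M N [f qf]|M|M N _ h|M N P _ h1 _ h2]; first exact: generated_qi qf.
- by [].
- by rewrite h.
- by rewrite h1.
Qed.

(** The Yoneda map of u is a homotopy equivalence, with inverse [g] and homotopy [h] on [M]. On the
    representable side a homotopy amounts, by Yoneda, to the single element [v]. *)
Definition hrep M (b : B) (u : M b 0) := cyc u /\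
  exists (g : rmor M (representable b))
    (h : forall b (n m : int), m + 1 = n -> {linear M b n -> M b m}) (v : hom b b (-1)),
  [/\ forall x y (p q n p' n' : int) (e : p + q = n) (ep : p' + 1 = p) (en : n' + 1 = n)
        (e' : p' + q = n') (w : M y p) (f : hom x y q),
        h x n n' en (rma e w f) = rma e' (h y p p' ep w) f,
      forall x (n m l : int) (e : m + 1 = n) (e' : n + 1 = l) (w : M x n),
        rma (add0r n) u (g x n w) - w = cxd _ e (h x n m e w) + h x l n e' (cxd _ e' w) &
      g b 0 u - dgid b = cxd _ (addNr 1) v].

(** Evaluating the section property at u shows that u g(u) is cohomologous to u. As multiplication
    by u is injective on cohomology, g(u) is cohomologous to the identity, which gives the missing
    [v]. *)
Lemma section_hrep M b (u : M b 0) (hu : cyc u) : rquasi_iso (rmul hu) ->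
  section_up_to_homotopy (rmul hu) -> hrep u.
Proof.
move=> qu [g [h [hr hd]]]; split=> //; exists g, h.
have cg : cyc (g b 0 u - dgid b).
  by apply: cycB; [apply: cmor_cyc|apply: dgid_cyc].
have bg : bd (g b 0 u - dgid b).
  apply: (qi_inj (qu b)) => //; rewrite linearB /= rma1.
  have := hd b 0 _ _ (addNr 1) (add0r 1) u; rewrite /= hu linear0 addr0 => ->.
  exact: bd_d.
by have [v hv] := bdP (addNr 1) bg; exists v; split.
Qed.
End Generators.

Lemma hproj_hrep_right (k : comPzRingType) (A B : dgcat k) (P : bimod A B) a b
    (u : bm_right P a b 0) (hu : cyc u) :
  hproj P -> hproj_cat A -> rquasi_iso (rmul hu) -> hrep u.
Proof. by move=> hP hA qu; apply: section_hrep (qu) _; apply: right_section. Qed.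

Lemma hproj_hrep_left (k : comPzRingType) (A B : dgcat k) (P : bimod B A) a (b : op B)
    (u : bm_left P a b 0) (hu : cyc u) :
  hproj P -> hproj_cat A -> rquasi_iso (rmul hu) -> hrep u.
Proof. by move=> hP hA qu; apply: section_hrep (qu) _; apply: left_section. Qed.

Section RestrictQi.
Variables (k : comPzRingType) (A B : dgcat k) (M N : bimod A B) (s : bmor M N).
Definition bmor_right a : rmor (bm_right M a) (bm_right N a).
Proof. by refine (@RMor k B (bm_right M a) (bm_right N a) (fun b => s b a) _) => *; apply: bmor_ra. Defined.
Definition bmor_left b : rmor (bm_left M b) (bm_left N b).
Proof.
refine (@RMor k (op A) (bm_left M b) (bm_left N b) (fun a => s b a) _).
by move=> x y p q n e u f; rewrite /= linearZZ bmor_la.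
Defined.
End RestrictQi.

Section LeftRep.
Variables (k : comPzRingType) (A B : dgcat k) (P : bimod B A) (a : A) (b0 : B).
(** [hrep] for the left module P(a, -), rid of the signs of the opposite category. Only the sign of
    moving the homotopy, of degree -1, past a left factor remains. *)
Definition lrep (u : P a b0 0) := cyc u /\
  exists (g : forall b, cmor (P a b) (hom b0 b))
    (h : forall b (n m : int), m + 1 = n -> {linear P a b n -> P a b m}) (v : hom b0 b0 (-1)),
  [/\ forall b b' (p q n : int) (e : p + q = n) (f : hom b b' p) (x : P a b q),
        g b' n (bla e f x) = dgc e f (g b q x),
      forall b b' (p q n q' n' : int) (e : p + q = n) (eq : q' + 1 = q) (en : n' + 1 = n)
        (e' : p + q' = n') (f : hom b b' p) (x : P a b q),
        h b' n n' en (bla e f x) = ksign k p *: bla e' f (h b q q' eq x),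
      forall b (n m l : int) (e : m + 1 = n) (e' : n + 1 = l) (x : P a b n),
        bla (addr0 n) (g b n x) u - x = cxd _ e (h b n m e x) + h b l n e' (cxd _ e' x) &
      g b0 0 u - dgid b0 = cxd _ (addNr 1) v].

Lemma hrep_lrep (u : P a b0 0) : hrep (M := bm_left P a) (b := b0 : op B) u -> lrep u.
Proof.
move=> [hu [g [h [v [hr hd hv]]]]]; split=> //.
have sK (p q : int) (V : lmodType k) (x y : V) : ksign k (p * q) *: x = ksign k (p * q) *: y -> x = y.
  by move=> /(congr1 (fun z => ksign k (p * q) *: z)); rewrite !scalerA ksignMM !scale1r.
exists (fun b => g b), h, v; split=> //.
- move=> b b' p q n e f x; have i : q + p = n by lia.
  have := rmor_act g i x (f : hom (d := op B) b' b p).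
  rewrite /= linearZZ (int_irr (etrans _ _) e) => /sK ->.
  by congr (dgc _ _ _); apply: int_irr.
- move=> b b' p q n q' n' e eq en e' f x.
  have i : q + p = n by lia.
  have i' : q' + p = n' by lia.
  have := hr _ _ _ _ _ _ _ i eq en i' x (f : hom (d := op B) b' b p).
  rewrite /= linearZZ (int_irr (etrans _ _) e) (int_irr (etrans (addrC p q') _) e') => E.
  apply: (sK q p); rewrite E scalerA; congr (_ *: _).
  by subst q; ksolve.
- move=> b n m l e e' x; rewrite -hd /= mul0r scale1r.
  by congr (bla _ _ _ - _); apply: int_irr.
Qed.
End LeftRep.

(** * Tensor products with a represented module *)

Lemma tg_cc (k : comPzRingType) (A B C : dgcat k) (F : bimod A B) (G : bimod B C) a c
    (n n' : int) (j : n = n') b (p q : int) (e : p + q = n) (e' : p + q = n')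
    (x : F b a p) (y : G c b q) :
  deg_cast (btens F G c a) j (tg e x y) = tg e' x y.
Proof. by case: n' / j e' => e'; rewrite (int_irr e e'). Qed.

(* [x |-> u (x) x] and [x (x) y |-> g(x) y] are inverse up to homotopy, with
   homotopies [v] and [h (x) id]. *)
Section TensorRight.
Variables (k : comPzRingType) (A B C : dgcat k) (P : bimod A B) (a : A) (b0 : B).
Variables (u : P b0 a 0) (cu : cyc u).
Variables (g : rmor (bm_right P a) (representable b0))
  (h : forall b (n m : int), m + 1 = n -> {linear P b a n -> P b a m}) (v : hom b0 b0 (-1)).
Hypothesis hr : forall x y (p q n p' n' : int) (e : p + q = n) (ep : p' + 1 = p) (en : n' + 1 = n)
  (e' : p' + q = n') (w : P y a p) (f : hom x y q),
  @h x n n' en (bra e w f) = bra e' (@h y p p' ep w) f.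
Hypothesis hd : forall x (n m l : int) (e : m + 1 = n) (e' : n + 1 = l) (w : P x a n),
  bra (add0r n) u (g x n w) - w = cxd _ e (@h x n m e w) + @h x l n e' (cxd _ e' w).
Hypothesis hv : g b0 0 u - dgid b0 = cxd _ (addNr 1) v.

Section Comp.
Variables (M : bimod B C) (c : C).

Fact tr_in_linear n : linear (fun m : M c b0 n => tg (add0r n) u m : btens P M c a n).
Proof. by move=> t x y; rewrite /= tgDr tgZr. Qed.
Fact tr_in_d (n m : int) (e : n + 1 = m) (x : M c b0 n) :
  tg (add0r m) u (cxd _ e x) = cxd (btens P M c a) e (tg (add0r n) u x).
Proof.
have i : 1 + n = m by lia.
rewrite [RHS](td_tg e (add0r n) (add0r 1) e i (add0r m)) cu tg0l add0r.
by rewrite scale1r.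
Qed.
Definition tr_in : cmor (M c b0) (btens P M c a) := cmor_of tr_in_linear tr_in_d.

Definition tr_out_phi n (b : B) (p q : int) (e : p + q = n) (x : P b a p) (m : M c b q) :
  M c b0 n := bla e (g b p x) m.
Fact tr_out_bilin n b (p q : int) (e : p + q = n) : is_bilin (@tr_out_phi n b p q e).
Proof. by split=> x t y y'; rewrite /tr_out_phi ?linearP !(blaDl, blaZl, blaDr, blaZr). Qed.
Fact tr_out_bal n b1 b2 (p r q pr rq : int) (e1 : p + r = pr) (e2 : pr + q = n)
    (e3 : r + q = rq) (e4 : p + rq = n) (x : P b2 a p) (f : hom b1 b2 r) (y : M c b1 q) :
  tr_out_phi e2 (bra e1 x f) y = tr_out_phi e4 x (bla e3 f y).
Proof. by rewrite /tr_out_phi (rmor_act g e1 x f) (blaA e1 e2 e3 e4). Qed.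
Definition tr_out_lin n : {linear tens P M a c n -> M c b0 n} :=
  tlift (@tr_out_bilin n) (@tr_out_bal n).
Fact tr_out_d (n m : int) (e : n + 1 = m) (x : tens P M a c n) :
  tr_out_lin m (td P M a c e x) = cxd _ e (tr_out_lin n x).
Proof.
elim/tens_ind: x => [|x y hx hy|t x hx|b p q i x y].
- by rewrite !linear0.
- by rewrite !linearD hx hy.
- by rewrite tdZ !(linearZZ (tr_out_lin _)) (linearZZ (cxd _ e)) hx.
have l1 : (p + 1) + q = m by lia.
have l2 : p + (q + 1) = m by lia.
rewrite (td_tg e i (erefl _) (erefl _) l1 l2) linearD (linearZZ (tr_out_lin _)) !tlift_tg.
by rewrite /tr_out_phi cmor_d (bla_d i (erefl _) (erefl _) e l1 l2).
Qed.
Definition tr_out : cmor (btens P M c a) (M c b0) :=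
  @Cmor k (btens P M c a) (M c b0) tr_out_lin tr_out_d.

Fact tr_deg (n p q : int) : p + q = n -> p - 1 + q = n - 1. Proof. lia. Qed.
Definition tr_h_phi n (b : B) (p q : int) (e : p + q = n) (x : P b a p) (m : M c b q) :
  tens P M a c (n - 1) := tg (tr_deg e) (@h b p _ (subrK 1 p) x) m.
Lemma tr_h_phiE n (b : B) (p q p' : int) (e : p + q = n) (i : p' + 1 = p) (j : p' + q = n - 1)
    (x : P b a p) (m : M c b q) : tr_h_phi e x m = tg j (@h b p p' i x) m.
Proof.
have ep : p' = p - 1 by lia.
by subst p'; rewrite /tr_h_phi (int_irr (subrK 1 p) i) (int_irr (tr_deg e) j).
Qed.
Fact tr_h_bilin n b (p q : int) (e : p + q = n) : is_bilin (@tr_h_phi n b p q e).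
Proof. by split=> x t y y'; rewrite /tr_h_phi ?linearP !(tgDl, tgZl, tgDr, tgZr). Qed.
Fact tr_h_bal n b1 b2 (p r q pr rq : int) (e1 : p + r = pr) (e2 : pr + q = n)
    (e3 : r + q = rq) (e4 : p + rq = n) (x : P b2 a p) (f : hom b1 b2 r) (y : M c b1 q) :
  tr_h_phi e2 (bra e1 x f) y = tr_h_phi e4 x (bla e3 f y).
Proof.
have l1 : p - 1 + r = pr - 1 by lia.
rewrite /tr_h_phi (hr e1 (subrK 1 p) (subrK 1 pr) l1).
by rewrite (tg_bal l1 (tr_deg e2) e3 (tr_deg e4)).
Qed.
Definition tr_h n : {linear tens P M a c n -> tens P M a c (n - 1)} :=
  tlift (@tr_h_bilin n) (@tr_h_bal n).

Lemma tr_hd (n m : int) (e : n + 1 = m) (j : m - 1 = n) (x : btens P M c a n) :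
  tr_in n (tr_out n x) - x =
  td P M a c (subrK 1 n) (tr_h n x) + deg_cast (btens P M c a) j (tr_h m (td P M a c e x)).
Proof.
change (tr_in n (tr_out_lin n x) - x =
  td P M a c (subrK 1 n) (tr_h n x) + deg_cast (btens P M c a) j (tr_h m (td P M a c e x))).
elim/tens_ind: x => [|x y hx hy|t x hx|b p q i x y].
- by rewrite !linear0 /= ?oppr0 ?addr0.
- by rewrite !linearD /= addrACA hx hy addrACA.
- rewrite tdZ (linearZZ (tr_out_lin _)) (linearZZ (tr_in _)) -scalerBr hx.
  by rewrite !(linearZZ (tr_h _)) tdZ (linearZZ (deg_cast _ _)) scalerDr.
have l1 : (p + 1) + q = m by lia.
have l2 : p + (q + 1) = m by lia.
have l3 : p + q = m - 1 by lia.
have l4 : (p - 1) + (q + 1) = n by lia.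
have l5 : (p - 1) + (q + 1) = m - 1 by lia.
subst m; rewrite (int_irr j (addrK 1 n)) [tr_out_lin n _]tlift_tg.
rewrite (td_tg (erefl _) i (erefl _) (erefl _) l1 l2) linearD (linearZZ (tr_h _)) linearD (linearZZ (deg_cast _ _)).
rewrite !tlift_tg (tr_h_phiE l1 (erefl _) l3) (tr_h_phiE l2 (subrK 1 p) l5).
rewrite (tg_cc _ l3 i) (tg_cc _ l5 l4) /tr_h_phi.
rewrite (tdphiE (subrK 1 n) (tr_deg i) (subrK 1 p) (erefl _) i l4).
rewrite -[tr_in n _]/(tg (add0r n) u (bla i (g b p x) y)) -(tg_bal (add0r p) i i (add0r n)).
rewrite -[tg i x y]scale1r -scaleNr -tgZl -tgDl scaleN1r (hd (subrK 1 p) (erefl _)) tgDl.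
(* The two terms that contain d y cancel, because the homotopy lowers the degree of x by one. *)
rewrite addrACA; have -> : ksign k (p - 1) = - ksign k p by rewrite ksignN; ksolve.
by rewrite scaleNr addNr addr0.
Qed.

Lemma tr_in_qi : cquasi_iso tr_in.
Proof.
apply: (qi_id (g := tr_out)) => n x hx; last first.
  have i : n + 1 - 1 = n by lia.
  rewrite /coh (tr_hd (erefl _) i) [td _ _ _ _ _ x]hx !linear0 addr0.
  exact: bd_d.
have -> : tr_out n (tr_in n x) = bla (add0r n) (g b0 0 u) x by exact: tlift_tg.
have l : -1 + n = n - 1 by lia.
have l' : -1 + (n + 1) = n by lia.
exists (n - 1), (subrK 1 n), (bla l v x).
rewrite (bla_d l (addNr 1) (erefl _) (subrK 1 n) (add0r n) l') hx bla0r scaler0 addr0.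
by rewrite -hv blaDl blaNl bla1.
Qed.
End Comp.

(** The quasi-isomorphisms [tr_in] for M and M' intertwine t at b0 with id (x) t, so two out of
    three applies. *)
Lemma tens_right_qi_rep (M M' : bimod B C) (t : bmor M M') c : bquasi_iso t ->
  cquasi_iso (btens_map (bid P) t c a).
Proof.
move=> qt; apply: (qi_cancel_f (f := tr_in M c) (h := ccomp_mor (tr_in M' c) (t c b0))).
- by move=> n x _; rewrite /= tm_tg; apply: coh_refl.
- exact: tr_in_qi.
- by apply: (qi_comp (f := t c b0) (g := tr_in M' c)) (qt _ _) (tr_in_qi _ _) => n x _; apply: coh_refl.
Qed.
End TensorRight.

Lemma tens_right_qi (k : comPzRingType) (A B C : dgcat k) (P : bimod A B) (a : A) (b0 : B)
    (u : P b0 a 0) (M M' : bimod B C) (t : bmor M M') c :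
  hrep (M := bm_right P a) u -> bquasi_iso t -> cquasi_iso (btens_map (bid P) t c a).
Proof.
by move=> [cu [g [h [v [hr hd hv]]]]]; apply: (tens_right_qi_rep cu hr hd hv).
Qed.

(** Applied to the image of id_a under the unit, with u the generator of QS(-, a), this provides the
    second tensor factor. *)
Lemma tens_right_elt (k : comPzRingType) (A B C : dgcat k) (P : bimod A B) (a : A) (b0 : B)
    (u : P b0 a 0) (M : bimod B C) c n (w : btens P M c a n) :
  hrep (M := bm_right P a) u -> cyc w ->
  exists2 m : M c b0 n, cyc m & coh (tg (add0r n) u m : btens P M c a n) w.
Proof.
move=> [cu [g [h [v [hr hd hv]]]]] hw.
exact: (qi_surj (tr_in_qi cu hr hd hv M c) hw).
Qed.

Section TensorLeft.
Variables (k : comPzRingType) (A B X : dgcat k) (P : bimod B A) (a : A) (b0 : B).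
Variables (u : P a b0 0) (cu : cyc u).
Variables (g : forall b, cmor (P a b) (hom b0 b))
  (h : forall b (n m : int), m + 1 = n -> {linear P a b n -> P a b m}) (v : hom b0 b0 (-1)).
Hypothesis gl : forall b b' (p q n : int) (e : p + q = n) (f : hom b b' p) (x : P a b q),
  g b' n (bla e f x) = dgc e f (g b q x).
Hypothesis hl : forall b b' (p q n q' n' : int) (e : p + q = n) (eq : q' + 1 = q) (en : n' + 1 = n)
  (e' : p + q' = n') (f : hom b b' p) (x : P a b q),
  @h b' n n' en (bla e f x) = ksign k p *: bla e' f (@h b q q' eq x).
Hypothesis hd : forall b (n m l : int) (e : m + 1 = n) (e' : n + 1 = l) (x : P a b n),
  bla (addr0 n) (g b n x) u - x = cxd _ e (@h b n m e x) + @h b l n e' (cxd _ e' x).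
Hypothesis hv : g b0 0 u - dgid b0 = cxd _ (addNr 1) v.

Section Comp.
Variables (M : bimod X B) (x0 : X).

Fact tl_in_linear n :
  linear (fun m : M b0 x0 n => tg (addr0 n) m u : btens M P a x0 n).
Proof. by move=> t x y; rewrite /= tgDl tgZl. Qed.
Fact tl_in_d (n m : int) (e : n + 1 = m) (x : M b0 x0 n) :
  tg (addr0 m) (cxd _ e x) u = cxd (btens M P a x0) e (tg (addr0 n) x u).
Proof.
have i : n + 1 = m by lia.
rewrite [RHS](td_tg e (addr0 n) e (add0r 1) (addr0 m) i) cu tg0r scaler0.
by rewrite addr0.
Qed.
Definition tl_in : cmor (M b0 x0) (btens M P a x0) := cmor_of tl_in_linear tl_in_d.

Definition tl_out_phi n (b : B) (p q : int) (e : p + q = n) (m : M b x0 p) (x : P a b q) :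
  M b0 x0 n := bra e m (g b q x).
Fact tl_out_bilin n b (p q : int) (e : p + q = n) : is_bilin (@tl_out_phi n b p q e).
Proof. by split=> x t y y'; rewrite /tl_out_phi ?linearP !(braDl, braZl, braDr, braZr). Qed.
Fact tl_out_bal n b1 b2 (p r q pr rq : int) (e1 : p + r = pr) (e2 : pr + q = n)
    (e3 : r + q = rq) (e4 : p + rq = n) (x : M b2 x0 p) (f : hom b1 b2 r) (y : P a b1 q) :
  tl_out_phi e2 (bra e1 x f) y = tl_out_phi e4 x (bla e3 f y).
Proof. by rewrite /tl_out_phi gl (braA e1 e2 e3 e4). Qed.
Definition tl_out_lin n : {linear tens M P x0 a n -> M b0 x0 n} :=
  tlift (@tl_out_bilin n) (@tl_out_bal n).
Fact tl_out_d (n m : int) (e : n + 1 = m) (x : tens M P x0 a n) :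
  tl_out_lin m (td M P x0 a e x) = cxd _ e (tl_out_lin n x).
Proof.
elim/tens_ind: x => [|x y hx hy|t x hx|b p q i x y].
- by rewrite !linear0.
- by rewrite !linearD hx hy.
- by rewrite tdZ !(linearZZ (tl_out_lin _)) (linearZZ (cxd _ e)) hx.
have l1 : (p + 1) + q = m by lia.
have l2 : p + (q + 1) = m by lia.
rewrite (td_tg e i (erefl _) (erefl _) l1 l2) linearD (linearZZ (tl_out_lin _)) !tlift_tg.
by rewrite /tl_out_phi cmor_d (bra_d i (erefl _) (erefl _) e l1 l2).
Qed.
Definition tl_out : cmor (btens M P a x0) (M b0 x0) :=
  @Cmor k (btens M P a x0) (M b0 x0) tl_out_lin tl_out_d.

Fact tl_deg (n p q : int) : p + q = n -> p + (q - 1) = n - 1. Proof. lia. Qed.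
(** The sign is that of moving the homotopy, of degree -1, past [m]. *)
Definition tl_h_phi n (b : B) (p q : int) (e : p + q = n) (m : M b x0 p) (x : P a b q) :
  tens M P x0 a (n - 1) := ksign k p *: tg (tl_deg e) m (@h b q _ (subrK 1 q) x).
Lemma tl_h_phiE n (b : B) (p q q' : int) (e : p + q = n) (i : q' + 1 = q) (j : p + q' = n - 1)
    (m : M b x0 p) (x : P a b q) : tl_h_phi e m x = ksign k p *: tg j m (@h b q q' i x).
Proof.
have eq : q' = q - 1 by lia.
by subst q'; rewrite /tl_h_phi (int_irr (subrK 1 q) i) (int_irr (tl_deg e) j).
Qed.
Fact tl_h_bilin n b (p q : int) (e : p + q = n) : is_bilin (@tl_h_phi n b p q e).
Proof. by split=> x t y y'; rewrite /tl_h_phi ?linearP !(tgDl, tgZl, tgDr, tgZr) scaleP. Qed.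
Fact tl_h_bal n b1 b2 (p r q pr rq : int) (e1 : p + r = pr) (e2 : pr + q = n)
    (e3 : r + q = rq) (e4 : p + rq = n) (x : M b2 x0 p) (f : hom b1 b2 r) (y : P a b1 q) :
  tl_h_phi e2 (bra e1 x f) y = tl_h_phi e4 x (bla e3 f y).
Proof.
have l1 : r + (q - 1) = rq - 1 by lia.
rewrite /tl_h_phi (hl e3 (subrK 1 q) (subrK 1 rq) l1).
rewrite (tg_bal e1 (tl_deg e2) l1 (tl_deg e4)) tgZr scalerA.
by congr (_ *: _); ksolve.
Qed.
Definition tl_h n : {linear tens M P x0 a n -> tens M P x0 a (n - 1)} :=
  tlift (@tl_h_bilin n) (@tl_h_bal n).

Lemma tl_hd (n m : int) (e : n + 1 = m) (j : m - 1 = n) (x : btens M P a x0 n) :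
  tl_in n (tl_out n x) - x =
  td M P x0 a (subrK 1 n) (tl_h n x) + deg_cast (btens M P a x0) j (tl_h m (td M P x0 a e x)).
Proof.
change (tl_in n (tl_out_lin n x) - x =
  td M P x0 a (subrK 1 n) (tl_h n x) + deg_cast (btens M P a x0) j (tl_h m (td M P x0 a e x))).
elim/tens_ind: x => [|x y hx hy|t x hx|b p q i x y].
- by rewrite !linear0 /= ?oppr0 ?addr0.
- by rewrite !linearD /= addrACA hx hy addrACA.
- rewrite tdZ (linearZZ (tl_out_lin _)) (linearZZ (tl_in _)) -scalerBr hx.
  by rewrite !(linearZZ (tl_h _)) tdZ (linearZZ (deg_cast _ _)) scalerDr.
have l1 : (p + 1) + q = m by lia.
have l2 : p + (q + 1) = m by lia.
have l3 : p + q = m - 1 by lia.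
have l4 : (p + 1) + (q - 1) = n by lia.
have l5 : (p + 1) + (q - 1) = m - 1 by lia.
subst m; rewrite (int_irr j (addrK 1 n)) [tl_out_lin n _]tlift_tg.
rewrite (td_tg (erefl _) i (erefl _) (erefl _) l1 l2) linearD (linearZZ (tl_h _)) linearD (linearZZ (deg_cast _ _)).
rewrite !tlift_tg (tl_h_phiE l1 (subrK 1 q) l5) (tl_h_phiE l2 (erefl _) l3).
rewrite !(linearZZ (deg_cast _ _)) (tg_cc _ l3 i) (tg_cc _ l5 l4) /tl_h_phi tdZ.
rewrite (td_tg (subrK 1 n) (tl_deg i) (erefl _) (subrK 1 q) l4 i).
rewrite -[tl_in n _]/(tg (addr0 n) (bra i x (g b q y)) u) (tg_bal i (addr0 n) (addr0 q) i).
rewrite -[tg i x y]scale1r -scaleNr -tgZr -tgDr scaleN1r (hd (subrK 1 q) (erefl _)) tgDr.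
rewrite scalerDr !scalerA ksignMM !scale1r addrACA.
have -> : ksign k (p + 1) = - ksign k p by rewrite ksignN.
by rewrite scaleNr subrr add0r.
Qed.

Lemma tl_in_qi : cquasi_iso tl_in.
Proof.
apply: (qi_id (g := tl_out)) => n x hx; last first.
  have i : n + 1 - 1 = n by lia.
  rewrite /coh (tl_hd (erefl _) i) [td _ _ _ _ _ x]hx !linear0 addr0.
  exact: bd_d.
have -> : tl_out n (tl_in n x) = bra (addr0 n) x (g b0 0 u) by exact: tlift_tg.
exists (n - 1), (subrK 1 n), (ksign k n *: bra (erefl (n - 1)) x v).
have l : n + 1 - 1 = n by lia.
rewrite linearZZ (bra_d (erefl (n - 1)) (erefl _) (addNr 1) (subrK 1 n) l (addr0 n)).
rewrite hx bra0l add0r scalerA ksignMM scale1r.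
by rewrite -hv braDr braNr bra1.
Qed.
End Comp.

Lemma tens_left_qi_rep (M M' : bimod X B) (t : bmor M M') x0 : bquasi_iso t ->
  cquasi_iso (btens_map t (bid P) a x0).
Proof.
move=> qt; apply: (qi_cancel_f (f := tl_in M x0) (h := ccomp_mor (tl_in M' x0) (t b0 x0))).
- by move=> n x _; rewrite /= tm_tg; apply: coh_refl.
- exact: tl_in_qi.
- by apply: (qi_comp (f := t b0 x0) (g := tl_in M' x0)) (qt _ _) (tl_in_qi _ _) => n x _; apply: coh_refl.
Qed.
End TensorLeft.

Lemma tens_left_qi (k : comPzRingType) (A B X : dgcat k) (P : bimod B A) (a : A) (b0 : B)
    (u : P a b0 0) (M M' : bimod X B) (t : bmor M M') x0 :
  lrep u -> bquasi_iso t -> cquasi_iso (btens_map t (bid P) a x0).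
Proof.
move=> [cu [g [h [v [hg hl hd hv]]]]] qt; exact: (tens_left_qi_rep cu hg hl hd hv).
Qed.

(** * Actions, tensors and resolutions on cohomology classes *)

Section CohActions.
Variables (k : comPzRingType).

(** One factor is replaced at a time: if x - x' = d w, then (x - x') y = d (w y) as y is a cocycle;
    likewise x' (d w) is d (x' w) up to sign. *)
Lemma coh_bilin (U V W : cochain k) (p q n : int) (e : p + q = n)
    (m : forall p q n : int, p + q = n -> U p -> V q -> W n)
    (mb : forall (p q n : int) (e : p + q = n), is_bilin (@m p q n e))
    (md : forall (p q n p' q' n' : int) (e : p + q = n) (ep : p + 1 = p')
      (eq : q + 1 = q') (en : n + 1 = n') (el : p' + q = n') (er : p + q' = n') x y,
      cxd W en (m _ _ _ e x y) = m _ _ _ el (cxd U ep x) y + ksign k p *: m _ _ _ er x (cxd V eq y))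
    (x x' : U p) (y y' : V q) :
  cyc x -> cyc x' -> cyc y -> coh x x' -> coh y y' -> coh (m _ _ _ e x y) (m _ _ _ e x' y').
Proof.
move=> hx hx' hy xx yy.
have z0l p1 q1 n1 e1 w : m p1 q1 n1 e1 0 w = 0.
  by rewrite -(scale0r 0) (bilZl (mb _ _ _ e1)) scale0r.
have z0r p1 q1 n1 e1 w : m p1 q1 n1 e1 w 0 = 0.
  by rewrite -(scale0r 0) (bilZr (mb _ _ _ e1)) scale0r.
have bl t w w' z : m p q n e (t *: w + w') z = t *: m p q n e w z + m p q n e w' z.
  exact: (mb p q n e).2.
have br t z w w' : m p q n e z (t *: w + w') = t *: m p q n e z w + m p q n e z w'.
  exact: (mb p q n e).1.
apply: (coh_trans (y := m _ _ _ e x' y)).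
  have [w hw] := bdP (subrK 1 p) xx.
  have i : (p - 1) + q = n - 1 by lia.
  have j : (p - 1) + (q + 1) = n by lia.
  exists (n - 1), (subrK 1 n), (m _ _ _ i w y).
  rewrite (md _ _ _ _ _ _ i (subrK 1 p) (erefl _) (subrK 1 n) e j) hy z0r scaler0 addr0 -hw.
  by rewrite [x - x']addrC -[- x']scaleN1r bl scaleN1r addrC.
have [w hw] := bdP (subrK 1 q) yy.
have i : p + (q - 1) = n - 1 by lia.
have j : (p + 1) + (q - 1) = n by lia.
exists (n - 1), (subrK 1 n), (ksign k p *: m _ _ _ i x' w).
rewrite linearZZ (md _ _ _ _ _ _ i (erefl _) (subrK 1 q) (subrK 1 n) j e) hx' z0l add0r.
rewrite scalerA ksignMM scale1r -hw.
by rewrite [y - y']addrC -[- y']scaleN1r br scaleN1r addrC.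
Qed.

Lemma cyc_bilin (U V W : cochain k) (p q n : int) (e : p + q = n)
    (m : forall p q n : int, p + q = n -> U p -> V q -> W n)
    (mb : forall (p q n : int) (e : p + q = n), is_bilin (@m p q n e))
    (md : forall (p q n p' q' n' : int) (e : p + q = n) (ep : p + 1 = p')
      (eq : q + 1 = q') (en : n + 1 = n') (el : p' + q = n') (er : p + q' = n') x y,
      cxd W en (m _ _ _ e x y) = m _ _ _ el (cxd U ep x) y + ksign k p *: m _ _ _ er x (cxd V eq y))
    (x : U p) (y : V q) :
  cyc x -> cyc y -> cyc (m _ _ _ e x y).
Proof.
move=> hx hy; apply: (cycP (e := erefl (n + 1))).
have i : (p + 1) + q = n + 1 by lia.
have j : p + (q + 1) = n + 1 by lia.
rewrite (md _ _ _ _ _ _ e (erefl _) (erefl _) _ i j) hx hy.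
have -> : m _ _ _ i 0 y = 0 by rewrite -(scale0r 0) (bilZl (mb _ _ _ i)) scale0r.
have -> : m _ _ _ j x 0 = 0 by rewrite -(scale0r 0) (bilZr (mb _ _ _ j)) scale0r.
by rewrite scaler0 addr0.
Qed.

Section Bimod.
Variables (A B : dgcat k) (T : bimod A B).
Lemma coh_bla b a a' (p q n : int) (e : p + q = n) (f f' : hom a a' p) (x x' : T b a q) :
  cyc f -> cyc f' -> cyc x -> coh f f' -> coh x x' -> coh (bla e f x) (bla e f' x').
Proof.
by apply: (@coh_bilin _ _ _ _ _ _ e (@bla k A B T b a a')); [apply: bla_bilin|apply: bla_d].
Qed.
Lemma coh_bra b' b a (p q n : int) (e : p + q = n) (x x' : T b a p) (f f' : hom b' b q) :
  cyc x -> cyc x' -> cyc f -> coh x x' -> coh f f' -> coh (bra e x f) (bra e x' f').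
Proof.
by apply: (@coh_bilin _ _ _ _ _ _ e (@bra k A B T b' b a)); [apply: bra_bilin|apply: bra_d].
Qed.
Lemma cyc_bla b a a' (p q n : int) (e : p + q = n) (f : hom a a' p) (x : T b a q) :
  cyc f -> cyc x -> cyc (bla e f x).
Proof.
by apply: (@cyc_bilin _ _ _ _ _ _ e (@bla k A B T b a a')); [apply: bla_bilin|apply: bla_d].
Qed.
Lemma cyc_bra b' b a (p q n : int) (e : p + q = n) (x : T b a p) (f : hom b' b q) :
  cyc x -> cyc f -> cyc (bra e x f).
Proof.
by apply: (@cyc_bilin _ _ _ _ _ _ e (@bra k A B T b' b a)); [apply: bra_bilin|apply: bra_d].
Qed.
End Bimod.

Section Tens.
Variables (A B C : dgcat k) (F : bimod A B) (G : bimod B C) (a : A) (b : B) (c : C).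
Let m (p q n : int) (e : p + q = n) (x : F b a p) (y : G c b q) : btens F G c a n := tg e x y.
Lemma coh_tg (p q n : int) (e : p + q = n) (x x' : F b a p) (y y' : G c b q) :
  cyc x -> cyc x' -> cyc y -> coh x x' -> coh y y' ->
  coh (tg e x y : btens F G c a n) (tg e x' y').
Proof.
apply: (@coh_bilin _ _ _ _ _ _ e m) => [*|p0 q0 n0 p' q' n' e0 ep eq en el er w z].
  exact: tg_bilin.
exact: td_tg.
Qed.
Lemma cyc_tg (p q n : int) (e : p + q = n) (x : F b a p) (y : G c b q) :
  cyc x -> cyc y -> cyc (tg e x y : btens F G c a n).
Proof.
apply: (@cyc_bilin _ _ _ _ _ _ e m) => [*|p0 q0 n0 p' q' n' e0 ep eq en el er w z].
  exact: tg_bilin.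
exact: td_tg.
Qed.
End Tens.
End CohActions.

(** Morphisms of D are linear on cohomology over the cohomology of A. By this the counit is computed
    on f (e (x) s) from its value on e (x) s. *)
Lemma crel_la (k : comPzRingType) (A B : dgcat k) (M N : bimod A B) (u : dmor M N)
    b a a' (p q n : int) (e : p + q = n) (f : hom a a' p) (x : M b a q) (y : N b a q) :
  cyc f -> crel u x y -> crel u (bla e f x) (bla e f y).
Proof.
move=> hf; elim: u x y => {M N} [M N g|M N s hs|M N P g hg h hh] x y.
- move=> [[hx _] [_ h]]; have hy := coh_cyc h (cmor_cyc _ hx).
  split; first by apply: ceq_refl; apply: cyc_bla.
  split; first by apply: cmor_cyc; apply: cyc_bla.
  rewrite bmor_la; apply: coh_bla => //; first exact: cmor_cyc.
  exact: coh_refl.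
- move=> [[hy _] [_ h]]; split; first by apply: ceq_refl; apply: cyc_bla.
  split; first by apply: cmor_cyc; apply: cyc_bla.
  rewrite bmor_la; apply: coh_bla => //; first exact: cmor_cyc.
  exact: coh_refl.
- by move=> [z /hh h1 /hg h2]; exists (bla e f z).
Qed.

(** The resolution of a morphism is known only through its naturality square in D. On classes this
    determines it, as soon as the result is sent back by [res_mor]. *)
Lemma res_map_crel (k : comPzRingType) (A B : dgcat k) (Q : bimod_resolution A B)
    (M N : bimod A B) (u : dmor M N) b a n (x : Q M b a n) (y : N b a n) :
  cyc x -> crel u (res_mor Q M b a n x) y ->
  coh (res_mor Q N b a n (res_map Q u b a n x)) y.
Proof.
move=> hx h.
have : crel (Dcomp u (Dof (res_mor Q M))) x y.
  by apply: crel_comp h; apply: crel_of.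
move=> /(crel_deq (deq_sym (res_natural Q u))) [z [_ [_ xz]] [_ [_ zy]]].
exact: coh_trans (cmor_coh _ xz) zy.
Qed.

Lemma res_map_id (k : comPzRingType) (A B : dgcat k) (Q : bimod_resolution A B)
    (M : bimod A B) b a n (x : Q M b a n) :
  cyc x -> coh (res_map Q (Dof (bid M)) b a n x) x.
Proof.
move=> hx; apply: (qi_coh (res_quasi_iso Q M b a)) => //; first exact: cmor_cyc.
by apply: res_map_crel => //; apply: (crel_of (bid M)); apply: cmor_cyc.
Qed.

(** * Left-linear maps *)

Lemma addrDB (V : zmodType) (x y z : V) : x + y - (x + z) = y - z.
Proof. by rewrite opprD addrACA subrr add0r. Qed.

Section TensExt.
Variables (k : comPzRingType) (A B C : dgcat k) (F : bimod A B) (G : bimod B C).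
Lemma tens_ext a c n (W : lmodType k) (f g : {linear btens F G c a n -> W}) :
  (forall b p q (e : p + q = n) (x : F b a p) (y : G c b q), f (tg e x y) = g (tg e x y)) ->
  f =1 g.
Proof.
move=> fg x; elim/(@tens_ind k A B C F G a c n): x => [|x y hx hy|t x hx|//].
- by rewrite !linear0.
- by rewrite !linearD hx hy.
- by rewrite (linearZZ f) (linearZZ g) hx.
Qed.
End TensExt.

Section LeftHom.
Variables (k : comPzRingType) (A B C : dgcat k) (M : bimod B A) (N : bimod B C).

(** No sign appears, since the map acts on the right and u stands on the left. *)
Definition llin c a n (f : graw (fun b => M a b) (fun b => N c b) n) :=
  forall b b' (r p q p' q' : int) (e : r + p = p') (e1 : p' + n = q') (e2 : p + n = q)
    (e3 : r + q = q') (u : hom b b' r) (x : M a b p),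
  f b' p' q' e1 (bla e u x) = bla e3 u (f b p q e2 x).

Definition left_linear c a : gsub (fun b => M a b) (fun b => N c b).
Proof.
refine (@GSub k B (fun b => M a b) (fun b => N c b) (@llin c a) _ _ _).
- by move=> n b b' r p q p' q' e e1 e2 e3 u x; rewrite bla0r.
- move=> n t f g hf hg b b' r p q p' q' e e1 e2 e3 u x.
  by rewrite (hf _ _ _ _ _ _ _ e e1 e2 e3) (hg _ _ _ _ _ _ _ e e1 e2 e3) blaDr blaZr.
- move=> n m e f fl hf b b' r p q p' q' i e1 e2 e3 u x.
  have i1 : p + n + 1 = q by lia.
  have i2 : p + 1 + n = q by lia.
  have i3 : p' + n + 1 = q' by lia.
  have i4 : p' + 1 + n = q' by lia.
  have i5 : r + (p + n) = p' + n by lia.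
  have i6 : r + 1 + p = p' + 1 by lia.
  have i7 : r + (p + 1) = p' + 1 by lia.
  have i8 : r + 1 + (p + n) = q' by lia.
  rewrite (gdrawE e f e1 (erefl _) i3 (erefl _) i4) (gdrawE e f e2 (erefl _) i1 (erefl _) i2).
  rewrite (hf _ _ _ _ _ _ _ i (erefl _) (erefl _) i5).
  rewrite (bla_d i5 (erefl _) i1 i3 i8 e3) (bla_d i (erefl _) (erefl _) (erefl _) i6 i7).
  have fD w w' : f b' (p' + 1) q' i4 (w + ksign k r *: w') =
      f b' _ _ i4 w + ksign k r *: f b' _ _ i4 w'.
    by have := fl b' (p' + 1) q' i4 (ksign k r) w' w; rewrite [_ *: w' + w]addrC => ->; exact: addrC.
  rewrite fD.
  rewrite (hf _ _ _ _ _ _ _ i6 i4 (erefl _) i8) (hf _ _ _ _ _ _ _ i7 i4 i2 e3).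
  rewrite addrDB -scalerBr scalerA blaZr blaDr blaNr.
  by congr (_ *: _); ksolve.
Defined.

Fact left_linear_la a a' c (r n m : int) (e : r + n = m) (f : hom a a' r)
    (g : graw (fun b => bm_right M b a) (fun b => bm_right N b c) n) :
  gs (left_linear c a) g -> gs (left_linear c a') (hom_la (M := bm_right M) (N := bm_right N) e f g).
Proof.
move=> hg b b' s p q p' q' i e1 e2 e3 u x.
have i1 : p + r + n = q by lia.
have i2 : p' + r + n = q' by lia.
have i3 : s + (p + r) = p' + r by lia.
rewrite (hom_laE _ _ _ e1 (erefl _) i2) (hom_laE _ _ _ e2 (erefl _) i1) /=.
by rewrite -(blra i (erefl _) (erefl _) i3) (hg _ _ _ _ _ _ _ i3 i2 i1 e3).
Qed.
Fact left_linear_ra a c' c (n r m : int) (e : n + r = m)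
    (g : graw (fun b => bm_right M b a) (fun b => bm_right N b c) n) (f : hom c' c r) :
  gs (left_linear c a) g -> gs (left_linear c' a) (hom_ra (M := bm_right M) (N := bm_right N) e g f).
Proof.
move=> hg b b' s p q p' q' i e1 e2 e3 u x.
have i1 : p + n + r = q by lia.
have i2 : p' + n + r = q' by lia.
have i3 : s + (p + n) = p' + n by lia.
rewrite (hom_raE _ _ _ e1 (erefl _) i2) (hom_raE _ _ _ e2 (erefl _) i1) /=.
by rewrite (hg _ _ _ _ _ _ _ i (erefl _) (erefl _) i3) (blra i3 i2 i1 e3).
Qed.

(** Hom_B(M(a, -), N(c, -)). As M is contravariant in a, this is covariant in a. *)
Definition LHom : bimod A C :=
  @hom_bimod k A C B (bm_right M) (bm_right N) left_linear left_linear_la left_linear_ra.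

Lemma LHom_laE a a' c (r n m : int) (e : r + n = m) (f : hom a a' r) (g : LHom c a n)
    b (p q pr : int) (e' : p + m = q) (j : p + r = pr) (l : pr + n = q) (x : M a' b p) :
  (bla e f g : LHom c a' m) b p q e' x = g b pr q l (bra j x f).
Proof. exact: hom_laE. Qed.
Lemma LHom_raE a c' c (n r m : int) (e : n + r = m) (g : LHom c a n) (f : hom c' c r)
    b (p q pn : int) (e' : p + m = q) (j : p + n = pn) (l : pn + r = q) (x : M a b p) :
  (bra e g f : LHom c' a m) b p q e' x = bra l (g b p pn j x) f.
Proof. exact: hom_raE. Qed.
Lemma LHom_dE a c (n m : int) (e : n + 1 = m) (f : LHom c a n) b (p q p' q' : int) (e' : p + m = q)
    (i1 : p + n = q') (i2 : q' + 1 = q) (i3 : p + 1 = p') (i4 : p' + n = q) (x : M a b p) :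
  (cxd (LHom c a) e f : LHom c a m) b p q e' x =
  ksign k p *: (cxd (N c b) i2 (f b p q' i1 x) - f b p' q i4 (cxd (M a b) i3 x)).
Proof. exact: gdrawE. Qed.
Lemma LHom_lin a c n (f : LHom c a n) b b' (r p q p' q' : int) (e : r + p = p') (e1 : p' + n = q')
    (e2 : p + n = q) (e3 : r + q = q') (u : hom b b' r) (x : M a b p) :
  f b' p' q' e1 (bla e u x) = bla e3 u (f b p q e2 x).
Proof. exact: (gm_in f). Qed.

End LeftHom.

Section TensLift.
Variables (k : comPzRingType) (A B C : dgcat k) (F : bimod A B) (G : bimod B C) (T : bimod A C).
Variable phi : forall (a : A) (b : B) (c : C) (p q n : int), p + q = n -> F b a p -> G c b q -> T c a n.
Arguments phi {a b c p q n}.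
Hypothesis phi_bilin : forall a b c p q n (e : p + q = n), is_bilin (@phi a b c p q n e).
Hypothesis phi_bal : forall a c b1 b2 (p r q pr rq n : int) (e1 : p + r = pr) (e2 : pr + q = n)
    (e3 : r + q = rq) (e4 : p + rq = n)
    (x : F b2 a p) (f : hom b1 b2 r) (y : G c b1 q),
  phi e2 (bra e1 x f) y = phi e4 x (bla e3 f y).
Hypothesis phi_d : forall a b c (p q n p' q' n' : int) (e : p + q = n) (ep : p + 1 = p')
    (eq : q + 1 = q') (en : n + 1 = n') (el : p' + q = n') (er : p + q' = n')
    (x : F b a p) (y : G c b q),
  cxd (T c a) en (phi e x y) = phi el (cxd _ ep x) y + ksign k p *: phi er x (cxd _ eq y).
Hypothesis phi_la : forall a a' b c (r p q n m rp : int) (e : p + q = n) (i : r + n = m)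
    (j : r + p = rp) (l : rp + q = m) (f : hom a a' r) (x : F b a p) (y : G c b q),
  phi l (bla j f x) y = bla i f (phi e x y).
Hypothesis phi_ra : forall a b c c' (r p q n m qr : int) (e : p + q = n) (i : n + r = m)
    (j : q + r = qr) (l : p + qr = m) (x : F b a p) (y : G c b q) (f : hom c' c r),
  phi l x (bra j y f) = bra i (phi e x y) f.

Definition blift_lin c a n : {linear tens F G a c n -> T c a n} :=
  tlift (fun b p q (e : p + q = n) => @phi_bilin a b c p q n e)
    (fun b1 b2 p r q pr rq => @phi_bal a c b1 b2 p r q pr rq n).
Lemma blift_tg a b c (p q n : int) (e : p + q = n) (x : F b a p) (y : G c b q) :
  blift_lin c a n (tg e x y) = phi e x y.
Proof. exact: tlift_tg. Qed.
Fact blift_d c a (n m : int) (e : n + 1 = m) x :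
  blift_lin c a m (td F G a c e x) = cxd (T c a) e (blift_lin c a n x).
Proof.
apply: (tens_ext (f := lin_of (linear_comp (blift_lin c a m) (td F G a c e)))
  (g := lin_of (linear_comp (cxd (T c a) e) (blift_lin c a n)))) => {x} b p q i x y.
change (blift_lin c a m (td F G a c e (tg i x y)) = cxd (T c a) e (blift_lin c a n (tg i x y))).
have l1 : (p + 1) + q = m by lia.
have l2 : p + (q + 1) = m by lia.
rewrite (td_tg e i (erefl _) (erefl _) l1 l2) (linearD (blift_lin c a m)).
by rewrite (linearZZ (blift_lin c a m)) !blift_tg (phi_d i (erefl _) (erefl _) e l1 l2).
Qed.
Definition blift : bmor (btens F G) T.
Proof.
refine (@Bmor k A C (btens F G) T (fun c a =>
  @Cmor k (btens F G c a) (T c a) (blift_lin c a) (@blift_d c a)) _ _).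
- move=> c a a' r n m e u x.
  apply: (tens_ext (f := lin_of (linear_comp (blift_lin c a' m) (tla F G c e u)))
    (g := lin_of (linear_comp (lin_of ((bla_bilin T c _ _ e).1 u)) (blift_lin c a n)))) => {x} b p q i x f /=.
  have l : r + p + q = m by lia.
  by rewrite (tla_tg e u i (erefl _) l) !blift_tg (phi_la i e).
- move=> c' c a n r m e x u.
  apply: (tens_ext (f := lin_of (linear_comp (blift_lin c' a m) (tra F G a e u)))
    (g := lin_of (linear_comp (lin_of ((bra_bilin T _ _ _ e).2 u)) (blift_lin c a n)))) => {x} b p q i x f /=.
  have l : p + (q + r) = m by lia.
  by rewrite (tra_tg e u i (erefl _) l) !blift_tg (phi_ra i e).
Defined.
Lemma bliftE a b c (p q n : int) (e : p + q = n) (x : F b a p) (y : G c b q) :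
  blift c a n (tg e x y) = phi e x y.
Proof. exact: tlift_tg. Qed.
End TensLift.

(** * Evaluation, composition, the action of A and the dual *)

Section Evaluation.
Variables (k : comPzRingType) (A B C : dgcat k) (M : bimod B A) (N : bimod B C).
Let phi (b : B) (a : A) (c : C) (p q n : int) (e : p + q = n) (x : M a b p) (f : LHom M N c a q) :
  N c b n := f b p n e x.
Definition lev : bmor (btens M (LHom M N)) N.
Proof.
apply: (@blift k B A C M (LHom M N) N phi); rewrite /phi.
- move=> b a c p q n e; split=> [x|f] t u v; first by rewrite gmDE gmZE.
  by rewrite gm_atD gm_atZ.
- by move=> *; apply/esym/LHom_laE.
- move=> b a c p q n p' q' n' e ep eq en el er x f.
  rewrite (LHom_dE eq f er e en ep el).
  by rewrite scalerA ksignMM scale1r addrC subrK.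
- by move=> *; apply: LHom_lin.
- by move=> *; apply: LHom_raE.
Defined.
Lemma lev_tg b a c (p q n : int) (e : p + q = n) (x : M a b p) (f : LHom M N c a q) :
  lev c b n (tg e x f) = f b p n e x.
Proof. exact: bliftE. Qed.
End Evaluation.

Section Composition.
Variables (k : comPzRingType) (A B C : dgcat k) (M : bimod B A) (N : bimod B C).

Section Elements.
Variables (a a' : A) (c : C) (p q n : int) (e : p + q = n).
Variables (f : LHom M M a' a p) (g : LHom M N c a' q).
Fact lcomp_deg s t : s + n = t -> s + p + q = t. Proof. lia. Qed.
Definition lcomp_raw : graw (fun b => M a b) (fun b => N c b) n :=
  fun b s t i z => g b _ t (lcomp_deg i) (f b s _ (erefl _) z).
Lemma lcomp_rawE b (s t u : int) (i : s + n = t) (j : s + p = u) (l : u + q = t) z :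
  lcomp_raw i z = g b u t l (f b s u j z).
Proof. by subst u; rewrite /lcomp_raw (int_irr (lcomp_deg i) l). Qed.
Fact lcomp_lin : glin lcomp_raw.
Proof. by move=> b s t i r x y; rewrite /lcomp_raw (gm_lin f) (gm_lin g). Qed.
Fact lcomp_llin : llin lcomp_raw.
Proof.
move=> b b' r s t s' t' i e1 e2 e3 u x.
have j : r + (s + p) = s' + p by lia.
rewrite /lcomp_raw (LHom_lin f i (erefl _) (erefl _) j).
exact: LHom_lin.
Qed.
Definition lcomp_elt : LHom M N c a n := GMap (R := left_linear M N c a) lcomp_lin lcomp_llin.
End Elements.

Lemma lcomp_eltE a a' c (p q n : int) (e : p + q = n) (f : LHom M M a' a p) (g : LHom M N c a' q)
    b (s t u : int) (i : s + n = t) (j : s + p = u) (l : u + q = t) z :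
  lcomp_elt e f g b s t i z = g b u t l (f b s u j z).
Proof. exact: lcomp_rawE. Qed.

(** The tensor f (x) g goes to f followed by g, the order dictated by maps acting on the right. *)
Definition lcomp : bmor (btens (LHom M M) (LHom M N)) (LHom M N).
Proof.
apply: (@blift k A A C (LHom M M) (LHom M N) (LHom M N) (fun a a' c => @lcomp_elt a a' c)).
- move=> a a' c p q n e; split=> [x|g] r u v; apply: gmap_ext => b s t i z;
    rewrite gmDE gmZE; have l : s + p + q = t by lia.
  + by rewrite !(lcomp_eltE _ _ _ i (erefl _) l) gmDE gmZE.
  + by rewrite !(lcomp_eltE _ _ _ i (erefl _) l) gmDE gmZE gm_atD gm_atZ.
- move=> a c a1 a2 p r q pr rq n e1 e2 e3 e4 x f y; apply: gmap_ext => b s t i z.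
  have l1 : s + pr + q = t by lia.
  have l2 : s + p + rq = t by lia.
  have l3 : s + p + r = s + pr by lia.
  rewrite (lcomp_eltE _ _ _ i (erefl _) l1) (lcomp_eltE _ _ _ i (erefl _) l2).
  by rewrite (LHom_raE e1 x f _ (erefl _) l3) (LHom_laE e3 f y l2 l3 l1).
- move=> a a' c p q n p' q' n' e ep eq en el er f g; apply: gmap_ext => b s t i z.
  have i1 : s + n + 1 = t by lia.
  have i2 : s + 1 + n = t by lia.
  have i3 : s + p' + q = t by lia.
  have i4 : s + p + q' = t by lia.
  have i5 : s + p + q = s + n by lia.
  have i6 : s + 1 + p = s + p' by lia.
  have i7 : s + p + 1 = s + p' by lia.
  rewrite gmDE gmZE (LHom_dE en _ i (erefl _) i1 (erefl _) i2).
  rewrite (lcomp_eltE e f g _ (erefl _) i5) (lcomp_eltE e f g _ i6 i3).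
  rewrite (lcomp_eltE el _ _ _ (erefl _) i3) (lcomp_eltE er _ _ _ (erefl _) i4).
  rewrite (LHom_dE ep f (erefl _) (erefl _) i7 (erefl _) i6).
  rewrite (LHom_dE eq g i4 i5 i1 i7 i3) gm_atZ gm_atB.
  rewrite scalerA; have -> : ksign k p * ksign k (s + p) = ksign k s by ksolve.
  by rewrite -scalerDr [X in _ = _ *: X]addrC subrKA.
- move=> a a1 a2 c r p q n m rp e i j l f x y; apply: gmap_ext => b s t e' z.
  have l1 : s + rp + q = t by lia.
  have l2 : s + r + n = t by lia.
  have l3 : s + r + p = s + rp by lia.
  rewrite (lcomp_eltE _ _ _ e' (erefl _) l1) (LHom_laE i f _ e' (erefl _) l2).
  by rewrite (lcomp_eltE _ _ _ l2 l3 l1) (LHom_laE j f x _ (erefl _) l3).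
- move=> a a1 c c' r p q n m qr e i j l x y f; apply: gmap_ext => b s t e' z.
  have l1 : s + p + qr = t by lia.
  have l2 : s + n + r = t by lia.
  have l3 : s + p + q = s + n by lia.
  rewrite (lcomp_eltE _ _ _ e' (erefl _) l1) (LHom_raE i _ f e' (erefl _) l2).
  by rewrite (lcomp_eltE _ _ _ _ (erefl _) l3) (LHom_raE j y f l1 l3 l2).
Defined.
Lemma lcomp_tg a a' c (p q n : int) (e : p + q = n) (f : LHom M M a' a p) (g : LHom M N c a' q) :
  lcomp c a n (tg e f g) = lcomp_elt e f g.
Proof. exact: bliftE. Qed.
End Composition.

Section Unit.
Variables (k : comPzRingType) (A B : dgcat k) (M : bimod B A).
Section Elements.
Variables (a a' : A) (n : int) (f : hom a' a n).
Definition lunit_elt_raw : graw (fun b => M a b) (fun b => M a' b) n :=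
  fun b p q e z => bra e z f.
Fact lunit_elt_lin : glin lunit_elt_raw.
Proof. by move=> b p q e t x y; rewrite /lunit_elt_raw braDl braZl. Qed.
Fact lunit_elt_llin : llin lunit_elt_raw.
Proof. by move=> b b' r p q p' q' e e1 e2 e3 u x; rewrite /lunit_elt_raw (blra e e1 e2 e3). Qed.
Definition lunit_elt : LHom M M a' a n := GMap (R := left_linear M M a' a) lunit_elt_lin lunit_elt_llin.
End Elements.

Fact lhom_unit_linear a' a n : linear (@lunit_elt a a' n).
Proof.
by move=> t f g; apply: gmap_ext => b p q e z; rewrite gmDE gmZE /= /lunit_elt_raw braDr braZr.
Qed.
Fact lhom_unit_d a' a (n m : int) (e : n + 1 = m) (f : hom a' a n) :
  lunit_elt (cxd (hom a' a) e f) = cxd (LHom M M a' a) e (lunit_elt f).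
Proof.
apply: gmap_ext => b p q i z.
have i1 : p + n + 1 = q by lia.
have i2 : p + 1 + n = q by lia.
rewrite (LHom_dE e _ i (erefl _) i1 (erefl _) i2) /= /lunit_elt_raw.
by rewrite (bra_d (erefl _) (erefl _) e i1 i2 i) addrBl scalerA ksignMM scale1r.
Qed.
Definition lhom_unit : bmor (diag A) (LHom M M).
Proof.
apply: (@bmor_of k A A (diag A) (LHom M M) (fun a' a n (f : hom a' a n) => lunit_elt f) lhom_unit_linear lhom_unit_d).
- move=> a b c p q n e u x; apply: gmap_ext => i s t e' z.
  have l : s + p + q = t by lia.
  by rewrite (LHom_laE e u _ e' (erefl _) l) /= /lunit_elt_raw (braA (erefl _) l e e').
- move=> a b c p q n e x u; apply: gmap_ext => i s t e' z.
  have l : s + p + q = t by lia.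
  by rewrite (LHom_raE e _ u e' (erefl _) l) /= /lunit_elt_raw (braA (erefl _) l e e').
Defined.
End Unit.

Section DualTensor.
Variables (k : comPzRingType) (A B C : dgcat k) (M : bimod B A) (N : bimod B C).

Section Elements.
Variables (a : A) (b0 : B) (c : C) (p q n : int) (e : p + q = n).
Variables (f : LHom M (diag B) b0 a p) (y : N c b0 q).
Fact ldual_deg s t : s + n = t -> s + p + q = t. Proof. lia. Qed.
Definition ldual_raw : graw (fun b => M a b) (fun b => N c b) n :=
  fun b s t i z => bla (ldual_deg i) (f b s _ (erefl _) z : hom b0 b _) y.
Lemma ldual_rawE b (s t u : int) (i : s + n = t) (j : s + p = u) (l : u + q = t) z :
  ldual_raw i z = bla l (f b s u j z : hom b0 b _) y.
Proof. by subst u; rewrite /ldual_raw (int_irr (ldual_deg i) l). Qed.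
Fact ldual_lin : glin ldual_raw.
Proof. by move=> b s t i r x x'; rewrite /ldual_raw (gm_lin f) blaDl blaZl. Qed.
Fact ldual_llin : llin ldual_raw.
Proof.
move=> b b' r s t s' t' i e1 e2 e3 u x.
have j : r + (s + p) = s' + p by lia.
rewrite /ldual_raw (LHom_lin f i (erefl _) (erefl _) j).
exact/esym/blaA.
Qed.
Definition ldual_elt : LHom M N c a n := GMap (R := left_linear M N c a) ldual_lin ldual_llin.
End Elements.

Lemma ldual_eltE a b0 c (p q n : int) (e : p + q = n) (f : LHom M (diag B) b0 a p) (y : N c b0 q)
    b (s t u : int) (i : s + n = t) (j : s + p = u) (l : u + q = t) z :
  ldual_elt e f y b s t i z = bla l (f b s u j z : hom b0 b _) y.
Proof. exact: ldual_rawE. Qed.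

(** The canonical map from M^dual (x)_B N to Hom_B(M, N), taking f (x) y to z |-> f(z) y. *)
Definition ldual : bmor (btens (LHom M (diag B)) N) (LHom M N).
Proof.
apply: (@blift k A B C (LHom M (diag B)) N (LHom M N) (fun a b c => @ldual_elt a b c)).
- move=> a b0 c p q n e; split=> [x|g] r u v; apply: gmap_ext => b s t i z;
    rewrite gmDE gmZE; have l : s + p + q = t by lia.
  + by rewrite !(ldual_eltE _ _ _ i (erefl _) l) blaDr blaZr.
  + by rewrite !(ldual_eltE _ _ _ i (erefl _) l) gmDE gmZE blaDl blaZl.
- move=> a c b1 b2 p r q pr rq n e1 e2 e3 e4 x f y; apply: gmap_ext => b s t i z.
  have l1 : s + pr + q = t by lia.
  have l2 : s + p + rq = t by lia.
  have l3 : s + p + r = s + pr by lia.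
  rewrite (ldual_eltE _ _ _ i (erefl _) l1) (ldual_eltE _ _ _ i (erefl _) l2).
  by rewrite (LHom_raE e1 x f _ (erefl _) l3) (blaA l3 l1 e3 l2).
- move=> a b0 c p q n p' q' n' e ep eq en el er f y; apply: gmap_ext => b s t i z.
  have i1 : s + n + 1 = t by lia.
  have i2 : s + 1 + n = t by lia.
  have i3 : s + p' + q = t by lia.
  have i4 : s + p + q' = t by lia.
  have i5 : s + p + q = s + n by lia.
  have i6 : s + 1 + p = s + p' by lia.
  have i7 : s + p + 1 = s + p' by lia.
  rewrite gmDE gmZE (LHom_dE en _ i (erefl _) i1 (erefl _) i2).
  rewrite (ldual_eltE e f y _ (erefl _) i5) (ldual_eltE e f y _ i6 i3).
  rewrite (ldual_eltE el _ _ _ (erefl _) i3) (ldual_eltE er _ _ _ (erefl _) i4).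
  rewrite (LHom_dE ep f (erefl _) (erefl _) i7 (erefl _) i6).
  rewrite (bla_d i5 i7 eq i1 i3 i4) blaZl blaDl blaNl.
  have -> : ksign k p = ksign k s * ksign k (s + p) by ksolve.
  by rewrite -scalerA -scalerDr addrAC.
- move=> a a1 b0 c r p q n m rp e i j l f x y; apply: gmap_ext => b s t e' z.
  have l1 : s + rp + q = t by lia.
  have l2 : s + r + n = t by lia.
  have l3 : s + r + p = s + rp by lia.
  rewrite (ldual_eltE _ _ _ e' (erefl _) l1) (LHom_laE i f _ e' (erefl _) l2).
  by rewrite (ldual_eltE _ _ _ l2 l3 l1) (LHom_laE j f x _ (erefl _) l3).
- move=> a b0 c c' r p q n m qr e i j l x y f; apply: gmap_ext => b s t e' z.
  have l1 : s + p + qr = t by lia.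
  have l2 : s + n + r = t by lia.
  have l3 : s + p + q = s + n by lia.
  rewrite (ldual_eltE _ _ _ e' (erefl _) l1) (LHom_raE i _ f e' (erefl _) l2).
  by rewrite (ldual_eltE _ _ _ _ (erefl _) l3) (blra l3 l2 j l1).
Defined.
Lemma ldual_tg a b0 c (p q n : int) (e : p + q = n) (f : LHom M (diag B) b0 a p) (y : N c b0 q) :
  ldual c a n (tg e f y) = ldual_elt e f y.
Proof. exact: bliftE. Qed.
End DualTensor.

(** * The Yoneda lemma up to homotopy for left-linear maps *)

Section EvalQi.
Variables (k : comPzRingType) (A B C : dgcat k) (P : bimod B A) (N : bimod B C).
Variables (a : A) (b0 : B) (u : P a b0 0) (cu : cyc u) (c : C).

Fact ev_at_linear n : linear (fun f : LHom P N c a n => f b0 0 n (add0r n) u).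
Proof. by move=> t f g; rewrite gmDE gmZE. Qed.
Fact ev_at_d (n m : int) (e : n + 1 = m) (f : LHom P N c a n) :
  (cxd (LHom P N c a) e f : LHom P N c a m) b0 0 m (add0r m) u =
  cxd (N c b0) e (f b0 0 n (add0r n) u).
Proof.
have i : 1 + n = m by lia.
by rewrite (LHom_dE e f _ (add0r n) e (add0r 1) i) cu gm_at0 subr0 scale1r.
Qed.
Definition ev_at : cmor (LHom P N c a) (N c b0) := cmor_of ev_at_linear ev_at_d.

Variables (g : forall b, cmor (P a b) (hom b0 b))
  (h : forall b (n m : int), m + 1 = n -> {linear P a b n -> P a b m}) (v : hom b0 b0 (-1)).
Hypothesis gl : forall b b' (p q n : int) (e : p + q = n) (f : hom b b' p) (x : P a b q),
  g b' n (bla e f x) = dgc e f (g b q x).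
Hypothesis hl : forall b b' (p q n q' n' : int) (e : p + q = n) (eq : q' + 1 = q) (en : n' + 1 = n)
  (e' : p + q' = n') (f : hom b b' p) (x : P a b q),
  @h b' n n' en (bla e f x) = ksign k p *: bla e' f (@h b q q' eq x).
Hypothesis hd : forall b (n m l : int) (e : m + 1 = n) (e' : n + 1 = l) (x : P a b n),
  bla (addr0 n) (g b n x) u - x = cxd _ e (@h b n m e x) + @h b l n e' (cxd _ e' x).
Hypothesis hv : g b0 0 u - dgid b0 = cxd _ (addNr 1) v.

Section Elt.
Variables (n : int) (y : N c b0 n).
Definition mul_raw : graw (fun b => P a b) (fun b => N c b) n := fun b p q e z => bla e (g b p z) y.
Fact mul_lin : glin mul_raw.
Proof. by move=> b p q e t x x'; rewrite /mul_raw linearP blaDl blaZl. Qed.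
Fact mul_llin : llin mul_raw.
Proof. by move=> b b' r p q p' q' e e1 e2 e3 f x; rewrite /mul_raw gl (blaA e e1 e2 e3). Qed.
Definition mul_elt : LHom P N c a n := GMap (R := left_linear P N c a) mul_lin mul_llin.
End Elt.
Fact mul_linear n : linear (@mul_elt n).
Proof.
by move=> t x y; apply: gmap_ext => b p q e z; rewrite gmDE gmZE /= /mul_raw blaDr blaZr.
Qed.
Fact mul_d (n m : int) (e : n + 1 = m) (y : N c b0 n) :
  mul_elt (cxd (N c b0) e y) = cxd (LHom P N c a) e (mul_elt y).
Proof.
apply: gmap_ext => b p q i z.
have i1 : p + n + 1 = q by lia.
have i2 : p + 1 + n = q by lia.
rewrite (LHom_dE e _ i (erefl _) i1 (erefl _) i2) /= /mul_raw.
by rewrite (bla_d (erefl _) (erefl _) e i1 i2 i) cmor_d addrBl scalerA ksignMM scale1r.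
Qed.
Definition rep_mul : cmor (N c b0) (LHom P N c a) := cmor_of mul_linear mul_d.

Lemma ev_mul n (y : N c b0 n) : cyc y -> coh (ev_at n (rep_mul n y)) y.
Proof.
move=> cy; have l : -1 + n = n - 1 by lia.
have l' : -1 + (n + 1) = n by lia.
exists (n - 1), (subrK 1 n), (bla l v y).
rewrite (bla_d l (addNr 1) (erefl _) (subrK 1 n) (add0r n) l') cy bla0r scaler0 addr0.
by rewrite -hv blaDl blaNl bla1.
Qed.

Section Htpy.
Variables (n : int) (f : LHom P N c a n).
Fact lh_deg p q : p + (n - 1) = q -> p - 1 + n = q. Proof. lia. Qed.
(** The homotopy [h] followed by f. The sign (-1)^p makes the result left linear, as [h] commutes
    with a left factor only up to the sign of its degree. *)
Definition lh_raw : graw (fun b => P a b) (fun b => N c b) (n - 1) :=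
  fun b p q e z => ksign k p *: f b (p - 1) q (lh_deg e) (@h b p _ (subrK 1 p) z).
Lemma lh_rawE b (p q p' : int) (e : p + (n - 1) = q) (j : p' + 1 = p) (i : p' + n = q) z :
  lh_raw e z = ksign k p *: f b p' q i (@h b p p' j z).
Proof.
have ep : p' = p - 1 by lia.
by subst p'; rewrite /lh_raw (int_irr (subrK 1 p) j) (int_irr (lh_deg e) i).
Qed.
Fact lh_lin : glin lh_raw.
Proof. by move=> b p q e t x x'; rewrite /lh_raw linearP gm_atD gm_atZ scaleP. Qed.
Fact lh_llin : llin lh_raw.
Proof.
move=> b b' r p q p' q' e e1 e2 e3 w x.
have j : r + (p - 1) = p' - 1 by lia.
rewrite /lh_raw (hl e (subrK 1 p) (subrK 1 p') j) gm_atZ.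
rewrite (LHom_lin f j (lh_deg e1) (lh_deg e2) e3) blaZr scalerA.
by congr (_ *: _); ksolve.
Qed.
Definition lh_elt : LHom P N c a (n - 1) := GMap (R := left_linear P N c a) lh_lin lh_llin.
End Htpy.

(** By linearity g(x) f(u) = f(g(x) u), so the difference of the two sides at x is f applied to d h
    x + h d x. Since f is a cocycle, this is the differential of h followed by f. *)
Lemma mul_ev n (f : LHom P N c a n) : cyc f -> coh (rep_mul n (ev_at n f)) f.
Proof.
move=> cf; exists (n - 1), (subrK 1 n), (lh_elt f).
apply: gmap_ext => b p q e z.
have l1 : p + (n - 1) = q - 1 by lia.
have l2 : p + 1 + (n - 1) = q by lia.
have l3 : p - 1 + n = q - 1 by lia.
have l4 : p - 1 + (n + 1) = q by lia.
rewrite gmDE gmNE (LHom_dE (subrK 1 n) (lh_elt f) e l1 (subrK 1 q) (erefl _) l2).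
rewrite [X in cxd _ _ X](lh_rawE _ l1 (subrK 1 p) l3) [X in _ = _ *: (_ - X)](lh_rawE _ l2 (erefl _) e).
(* The cocycle condition is evaluated at h z, of degree p - 1; it gives d (f (h z)) = f (d (h
   z)). *)
have := congr1 (fun F : LHom P N c a (n + 1) => F b (p - 1) q l4 (@h b p _ (subrK 1 p) z)) (cf _ (erefl _)).
rewrite (LHom_dE (erefl _) f l4 l3 (subrK 1 q) (subrK 1 p) e) => /(congr1 (fun w => ksign k (p - 1) *: w)).
rewrite scalerA ksignMM scale1r [RHS]scaler0 => /eqP; rewrite subr_eq0 => /eqP E.
rewrite (linearZZ (cxd _ _)) E.
have -> : ksign k (p + 1) = - ksign k p by rewrite ksignN.
rewrite scaleNr opprK -scalerDr scalerA ksignMM scale1r -(gm_atD f) -(hd (subrK 1 p) (erefl _)).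
rewrite (gm_atB f); congr (_ - _).
exact/esym/LHom_lin.
Qed.

Lemma ev_at_qi : cquasi_iso ev_at.
Proof. by apply: (qi_id (g := rep_mul)); [apply: mul_ev|apply: ev_mul]. Qed.
Lemma mul_qi : cquasi_iso rep_mul.
Proof. by apply: (qi_id (g := ev_at)); [apply: ev_mul|apply: mul_ev]. Qed.
End EvalQi.

(** * Homotopies of tensor products *)

Section TensHomotopy.
Variables (k : comPzRingType) (A B C : dgcat k) (F F' : bimod A B) (G G' : bimod B C).

Lemma bh_tens_l (f f' : bmor F F') (g : bmor G G') :
  bhomotopic f f' -> bhomotopic (btens_map f g) (btens_map f' g).
Proof.
move=> [h [hl hr hd]].
have deg (n m p q : int) : m + 1 = n -> p + q = n -> p - 1 + q = m by lia.
pose phi (a : A) (c : C) (n m : int) (e : m + 1 = n) (b : B) (p q : int) (i : p + q = n)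
    (x : F b a p) (y : G c b q) : tens F' G' a c m :=
  tg (deg _ _ _ _ e i) (h b a p _ (subrK 1 p) x) (g c b q y).
have phiE a c n m e b p q i p' (ep : p' + 1 = p) (l : p' + q = m) x y :
    phi a c n m e b p q i x y = tg l (h b a p p' ep x) (g c b q y).
  have E : p' = p - 1 by lia.
  by subst p'; rewrite /phi (int_irr (subrK 1 p) ep) (int_irr (deg _ _ _ _ e i) l).
have phi_bilin a c n m e b p q i : is_bilin (phi a c n m e b p q i).
  by split=> x t y y'; rewrite /phi ?linearP !(tgDl, tgZl, tgDr, tgZr).
have phi_bal a c n m e b1 b2 (p r q pr rq : int) (e1 : p + r = pr) (e2 : pr + q = n)
    (e3 : r + q = rq) (e4 : p + rq = n) (x : F b2 a p) (w : hom b1 b2 r) (y : G c b1 q) :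
  phi a c n m e b1 pr q e2 (bra e1 x w) y = phi a c n m e b2 p rq e4 x (bla e3 w y).
  have l : p - 1 + r = pr - 1 by lia.
  rewrite /phi (hr _ _ _ _ _ _ _ _ e1 (subrK 1 p) (subrK 1 pr) l) bmor_la.
  exact: tg_bal.
pose K c a n m e : {linear btens F G c a n -> btens F' G' c a m} :=
  tlift (phi_bilin a c n m e) (phi_bal a c n m e).
have KE c a n m e b p q i x y : K c a n m e (@tg k A B C F G a c n b p q i x y) = phi a c n m e b p q i x y.
  exact: tlift_tg.
exists K; split.
- move=> c a a' r n m n' m' e en em e' u x.
  apply: (tens_ext (f := lin_of (linear_comp (K c a' m m' em) (tla F G c e u)))
    (g := lin_of (linear_scale (ksign k r) (lin_of (linear_comp (tla F' G' c e' u) (K c a n n' en)))))).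
  move=> {x} b p q i x y /=.
  have l : r + p + q = m by lia.
  have l1 : p - 1 + q = n' by lia.
  have l2 : r + (p - 1) + q = m' by lia.
  have l3 : r + (p - 1) + 1 = r + p by lia.
  rewrite (tla_tg e u i (erefl _) l) !KE (phiE _ _ _ _ _ _ _ _ _ _ (subrK 1 p) l1).
  rewrite (phiE _ _ _ _ _ _ _ _ _ _ l3 l2) (tla_tg e' u l1 (erefl _) l2).
  by rewrite (hl _ _ _ _ _ _ _ _ (erefl _) (subrK 1 p) l3 (erefl _)) tgZl.
- move=> c' c a n r m n' m' e en em e' x u.
  apply: (tens_ext (f := lin_of (linear_comp (K c' a m m' em) (tra F G a e u)))
    (g := lin_of (linear_comp (tra F' G' a e' u) (K c a n n' en)))).
  move=> {x} b p q i x y /=.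
  have l : p + (q + r) = m by lia.
  have l1 : p - 1 + q = n' by lia.
  have l2 : p - 1 + (q + r) = m' by lia.
  rewrite (tra_tg e u i (erefl _) l) !KE !(phiE _ _ _ _ _ _ _ _ _ _ (subrK 1 p) l1).
  by rewrite (phiE _ _ _ _ _ _ _ _ _ _ (subrK 1 p) l2) (tra_tg e' u l1 (erefl _) l2) bmor_ra.
- move=> c a n m l e e' x.
  pose D := lin_of (linear_add (tm f g c a n) (lin_of (linear_scale (-1) (tm f' g c a n)))).
  pose D' := lin_of (linear_add (lin_of (linear_comp (td F' G' a c e) (K c a n m e)))
    (lin_of (linear_comp (K c a l n e') (td F G a c e')))).
  suff E : D =1 D' by have := E x; rewrite /D /= scaleN1r.
  apply: tens_ext => {x} b p q i x y; rewrite /D /D' /= scaleN1r.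
  have l1 : p + 1 + q = l by lia.
  have l2 : p + (q + 1) = l by lia.
  have l3 : p - 1 + q = m by lia.
  have l4 : p - 1 + (q + 1) = n by lia.
  rewrite !tm_tg (td_tg e' i (erefl _) (erefl _) l1 l2) (linearD (K c a l n e')) (linearZZ (K c a l n e')).
  rewrite !KE (phiE _ _ _ _ _ _ _ _ _ _ (subrK 1 p) l3) (phiE _ _ _ _ _ _ _ _ _ _ (erefl (p + 1)) i).
  rewrite (phiE _ _ _ _ _ _ _ _ _ _ (subrK 1 p) l4) (td_tg e l3 (subrK 1 p) (erefl _) i l4) cmor_d.
  rewrite addrACA; have -> : ksign k (p - 1) = - ksign k p by rewrite ksignN; ksolve.
  rewrite scaleNr addNr addr0 -tgDl -(hd b a p _ _ (subrK 1 p) (erefl _)).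
  by rewrite -[- tg _ _ _]scaleN1r -tgZl scaleN1r -tgDl.
Qed.

Lemma bh_tens_r (f : bmor F F') (g g' : bmor G G') :
  bhomotopic g g' -> bhomotopic (btens_map f g) (btens_map f g').
Proof.
move=> [h [hl hr hd]].
have deg (n m p q : int) : m + 1 = n -> p + q = n -> p + (q - 1) = m by lia.
pose phi (a : A) (c : C) (n m : int) (e : m + 1 = n) (b : B) (p q : int) (i : p + q = n)
    (x : F b a p) (y : G c b q) : tens F' G' a c m :=
  ksign k p *: tg (deg _ _ _ _ e i) (f b a p x) (h c b q _ (subrK 1 q) y).
have phiE a c n m e b p q i q' (eq : q' + 1 = q) (l : p + q' = m) x y :
    phi a c n m e b p q i x y = ksign k p *: tg l (f b a p x) (h c b q q' eq y).
  have E : q' = q - 1 by lia.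
  by subst q'; rewrite /phi (int_irr (subrK 1 q) eq) (int_irr (deg _ _ _ _ e i) l).
have phi_bilin a c n m e b p q i : is_bilin (phi a c n m e b p q i).
  by split=> x t y y'; rewrite /phi ?linearP !(tgDl, tgZl, tgDr, tgZr) scaleP.
have phi_bal a c n m e b1 b2 (p r q pr rq : int) (e1 : p + r = pr) (e2 : pr + q = n)
    (e3 : r + q = rq) (e4 : p + rq = n) (x : F b2 a p) (w : hom b1 b2 r) (y : G c b1 q) :
  phi a c n m e b1 pr q e2 (bra e1 x w) y = phi a c n m e b2 p rq e4 x (bla e3 w y).
  have l : r + (q - 1) = rq - 1 by lia.
  rewrite /phi (hl _ _ _ _ _ _ _ _ e3 (subrK 1 q) (subrK 1 rq) l) bmor_ra tgZr scalerA.
  rewrite (tg_bal e1 _ l (deg _ _ _ _ e e4)).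
  by congr (_ *: _); ksolve.
pose K c a n m e : {linear btens F G c a n -> btens F' G' c a m} :=
  tlift (phi_bilin a c n m e) (phi_bal a c n m e).
have KE c a n m e b p q i x y : K c a n m e (@tg k A B C F G a c n b p q i x y) = phi a c n m e b p q i x y.
  exact: tlift_tg.
exists K; split.
- move=> c a a' r n m n' m' e en em e' u x.
  apply: (tens_ext (f := lin_of (linear_comp (K c a' m m' em) (tla F G c e u)))
    (g := lin_of (linear_scale (ksign k r) (lin_of (linear_comp (tla F' G' c e' u) (K c a n n' en)))))).
  move=> {x} b p q i x y /=.
  have l : r + p + q = m by lia.
  have l1 : p + (q - 1) = n' by lia.
  have l2 : r + p + (q - 1) = m' by lia.
  rewrite (tla_tg e u i (erefl _) l) !KE (phiE _ _ _ _ _ _ _ _ _ _ (subrK 1 q) l1).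
  rewrite (phiE _ _ _ _ _ _ _ _ _ _ (subrK 1 q) l2) tlaZ (tla_tg e' u l1 (erefl _) l2).
  by rewrite bmor_la scalerA ksignD.
- move=> c' c a n r m n' m' e en em e' x u.
  apply: (tens_ext (f := lin_of (linear_comp (K c' a m m' em) (tra F G a e u)))
    (g := lin_of (linear_comp (tra F' G' a e' u) (K c a n n' en)))).
  move=> {x} b p q i x y /=.
  have l : p + (q + r) = m by lia.
  have l1 : p + (q - 1) = n' by lia.
  have l2 : p + (q - 1 + r) = m' by lia.
  have l3 : q - 1 + r + 1 = q + r by lia.
  rewrite (tra_tg e u i (erefl _) l) !KE (phiE _ _ _ _ _ _ _ _ _ _ (subrK 1 q) l1).
  rewrite (phiE _ _ _ _ _ _ _ _ _ _ l3 l2) traZ (tra_tg e' u l1 (erefl _) l2).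
  by rewrite (hr _ _ _ _ _ _ _ _ (erefl _) (subrK 1 q) l3 (erefl _)).
- move=> c a n m l e e' x.
  pose D := lin_of (linear_add (tm f g c a n) (lin_of (linear_scale (-1) (tm f g' c a n)))).
  pose D' := lin_of (linear_add (lin_of (linear_comp (td F' G' a c e) (K c a n m e)))
    (lin_of (linear_comp (K c a l n e') (td F G a c e')))).
  suff E : D =1 D' by have := E x; rewrite /D /= scaleN1r.
  apply: tens_ext => {x} b p q i x y; rewrite /D /D' /= scaleN1r.
  have l1 : p + 1 + q = l by lia.
  have l2 : p + (q + 1) = l by lia.
  have l3 : p + (q - 1) = m by lia.
  have l4 : p + 1 + (q - 1) = n by lia.
  rewrite !tm_tg (td_tg e' i (erefl _) (erefl _) l1 l2) (linearD (K c a l n e')) (linearZZ (K c a l n e')).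
  rewrite !KE (phiE _ _ _ _ _ _ _ _ _ _ (subrK 1 q) l3) (phiE _ _ _ _ _ _ _ _ _ _ (subrK 1 q) l4).
  rewrite (phiE _ _ _ _ _ _ _ _ _ _ (erefl (q + 1)) i) tdZ (td_tg e l3 (erefl _) (subrK 1 q) l4 i) cmor_d.
  rewrite scalerDr !scalerA ksignMM !scale1r addrACA.
  have -> : ksign k (p + 1) = - ksign k p by rewrite ksignN.
  rewrite scaleNr subrr add0r -tgDr -(hd c b q _ _ (subrK 1 q) (erefl _)).
  by rewrite -[- tg _ _ _]scaleN1r -tgZr scaleN1r -tgDr.
Qed.
End TensHomotopy.

Lemma btens_map_comp (k : comPzRingType) (A B C : dgcat k) (F F' F'' : bimod A B)
    (G G' G'' : bimod B C) (f : bmor F F') (f' : bmor F' F'') (g : bmor G G') (g' : bmor G' G'')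
    c a n (x : btens F G c a n) :
  btens_map f' g' c a n (btens_map f g c a n x) =
  btens_map (bcompm f' f) (bcompm g' g) c a n x.
Proof.
apply: (tens_ext (f := lin_of (linear_comp (tm f' g' c a n) (tm f g c a n)))
  (g := tm (bcompm f' f) (bcompm g' g) c a n)) => b p q e x' y /=.
by rewrite !tm_tg.
Qed.

Lemma bh_btens_comp (k : comPzRingType) (A B C : dgcat k) (F F' F'' : bimod A B)
    (G G' G'' : bimod B C) (f : bmor F F') (f' : bmor F' F'') (f'' : bmor F F'')
    (g : bmor G G') (g' : bmor G' G'') (g'' : bmor G G'') :
  bhomotopic (bcompm f' f) f'' -> bhomotopic (bcompm g' g) g'' ->
  bhomotopic (bcompm (btens_map f' g') (btens_map f g)) (btens_map f'' g'').
Proof.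
move=> hf hg; apply: (bh_trans (g := btens_map (bcompm f' f) (bcompm g' g))).
  by apply: bh_ext => c a n x; apply: btens_map_comp.
by apply: bh_trans (bh_tens_l _ hf) (bh_tens_r _ hg).
Qed.

(** * From equalities in D to homotopies *)

Section DerivedCategory.
Variables (k : comPzRingType) (A B : dgcat k) (Q : bimod_resolution A B).

(** Naturality of the resolution holds in D only. Out of the h-projective [Q M] it becomes a
    homotopy, even when u contains formal inverses, provided that following it by f removes them. *)
Lemma res_map_hproj (M N P : bimod A B) (hM : hproj (Q M)) (u : dmor M N) (f : bmor N P)
    (v : bmor (Q M) P) :
  deq (Dcomp (Dof f) (Dcomp u (Dof (res_mor Q M)))) (Dof v) ->
  bhomotopic (bcompm f (bcompm (res_mor Q N) (res_map Q u))) v.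
Proof.
move=> h; apply: (deq_homotopic_hproj hM); apply: deq_trans h.
apply: deq_trans (deq_Dof_comp _ _) _; apply: deq_Dcomp; first exact: deq_refl.
by apply: deq_trans (deq_Dof_comp _ _) _; apply: res_natural.
Qed.

Lemma res_map_of (M N : bimod A B) (f : bmor M N) :
  bhomotopic (bcompm (res_mor Q N) (res_map Q (Dof f))) (bcompm f (res_mor Q M)).
Proof.
apply: (deq_homotopic_hproj (@res_hproj _ _ _ Q M)).
apply: deq_trans (deq_Dof_comp _ _) _; apply: deq_trans (res_natural _ _) _.
exact/deq_sym/deq_Dof_comp.
Qed.

Lemma res_map_bid (M : bimod A B) : bhomotopic (res_map Q (Dof (bid M))) (bid (Q M)).
Proof.
apply: (hproj_inj (@res_hproj _ _ _ Q M) (res_quasi_iso Q M)).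
apply: bh_trans (res_map_of _) _; exact: bh_ext.
Qed.

(** The formal inverse of [cl] cancels as soon as what follows it factors, up to homotopy, through
    [cl]. Both triangular identities of the constructed adjunction are thereby reduced to a pair of
    homotopies. *)
Lemma deq_cancel (M0 M1 M2 M3 M4 M5 : bimod A B) (m0 : bmor M0 M1) (ac : bmor M1 M2)
    (cl : bmor M3 M2) (w : bquasi_iso cl) (m1 : bmor M3 M4) (lu : bmor M4 M5) (q : bmor M2 M5)
    (ru : bmor M0 M5) :
  bhomotopic (bcompm lu m1) (bcompm q cl) -> bhomotopic (bcompm q (bcompm ac m0)) ru ->
  deq (Dcomp (Dof lu) (Dcomp (Dof m1) (Dcomp (Dcomp (Dinv w) (Dof ac)) (Dof m0)))) (Dof ru).
Proof.
move=> h1 h2; apply: deq_trans (deq_homotopic h2).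
apply: deq_trans (deq_assoc _ _ _) _.
apply: deq_trans (deq_Dcomp (deq_sym (deq_Dof_comp _ _)) (deq_refl _)) _.
apply: deq_trans (deq_Dcomp (deq_homotopic h1) (deq_sym (deq_assoc _ _ _))) _.
apply: deq_trans (deq_Dcomp (deq_Dof_comp _ _) (deq_refl _)) _.
apply: deq_trans (deq_sym (deq_assoc _ _ _)) _.
apply: deq_trans (deq_Dcomp (deq_refl _) (deq_assoc _ _ _)) _.
apply: deq_trans (deq_Dcomp (deq_refl _) (deq_Dcomp (deq_inv_r w) (deq_refl _))) _.
apply: deq_trans (deq_Dcomp (deq_refl _) (deq_id_l _)) _.
apply: deq_trans (deq_sym (deq_Dof_comp _ _)).
by apply: deq_Dcomp; [apply: deq_refl|apply/deq_sym/deq_Dof_comp].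
Qed.
End DerivedCategory.

(** * From an adjunction to left quasi-representability *)

Section Forward.
Variables (k : comPzRingType) (A B : dgcat k).
Variables (Q : forall X Y : dgcat k, bimod_resolution X Y).
Variables (S : bimod A B) (G : bimod B A).
Notation QS := (Q A B S).
Notation QG := (Q B A G).
Notation rS := (res_mor (Q A B) S).
Notation rG := (res_mor (Q B A) G).
Variables (eta : dmor (diag A) (dcomp Q G S)) (eps : dmor (dcomp Q S G) (diag B)).
Variables (a : A) (b0 : B) (s : QS b0 a 0) (e : QG a b0 0).
Hypotheses (cs : cyc s) (ce : cyc e).
Hypothesis eta_id : crel eta (dgid a) (tg (addr0 0) s e : dcomp Q G S a a 0).

(** The derived composites involve the resolution of the diagonal rather than the diagonal, so id_a
    is represented there by a cocycle i. *)
Lemma unit_lift : exists2 i : Q A A (diag A) a a 0, cyc i &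
  coh (res_mor (Q A A) (diag A) a a 0 i) (dgid a).
Proof. exact: (qi_surj (res_quasi_iso (Q A A) (diag A) a a) (dgid_cyc a)). Qed.

(** The triangle is followed on classes, starting from i (x) s: it passes through (s (x) e) (x) s,
    then s (x) (e (x) s), then s (x) c, and ends at s c, whereas the right unitor sends i (x) s to
    s. *)
Lemma triangle_l_eval c : triangle_l eta eps ->
  crel eps (tg (addr0 0) e s : dcomp Q S G b0 b0 0) c ->
  coh (bra (addr0 0) (rS b0 a 0 s) c) (rS b0 a 0 s).
Proof.
move=> [w tri] epsc; have [i ci ii] := unit_lift.
have [_ cc0] := crel_dom epsc.
have es_c : cyc (tg (addr0 0) e s : btens QG QS b0 b0 0) by apply: cyc_tg.
have [e' ce' ee'] := qi_surj (res_quasi_iso (Q B B) (dcomp Q S G) b0 b0) es_c.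
pose w0 : dcomp Q S (diag A) b0 a 0 := tg (addr0 0) i s.
have cw0 : cyc w0 by apply: cyc_tg.
have R0 : crel (dright_unitor Q S) w0 (rS b0 a 0 s).
  apply: (crel_coh (crel_of _ cw0)); first exact: coh_refl.
  rewrite /= tm_tg run_tg -{2}(bla1 (add0r 0) (rS b0 a 0 s)).
  rewrite (int_irr (addr0 0) (add0r 0)); apply: coh_bla => //.
  - by apply: cmor_cyc.
  - exact: dgid_cyc.
  - by apply: cmor_cyc.
  - exact: coh_refl.
pose ri := res_map (Q A A) eta a a 0 i.
pose rs := res_map (Q A B) (Dof (bid S)) b0 a 0 s.
have cri : cyc ri by apply: cmor_cyc.
have crs : cyc rs by apply: cmor_cyc.
have rss : coh rs s by apply: res_map_id.
have riE : coh (res_mor (Q A A) (dcomp Q G S) a a 0 ri) (tg (addr0 0) s e).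
  by apply: res_map_crel => //; apply: crel_coh eta_id (coh_sym ii) (coh_refl _).
pose y : dcomp Q S (dcomp Q G S) b0 a 0 := tg (addr0 0) ri rs.
have cy : cyc y by apply: cyc_tg.
have L1 : crel (dhcomp Q (Dof (bid S)) eta) w0 y.
  apply: (crel_coh (crel_of _ cw0)); first exact: coh_refl.
  by rewrite /= tm_tg; apply: coh_refl.
pose y2 : btens QS (btens QG QS) b0 a 0 := tg (addr0 0) s (tg (addr0 0) e s : btens QG QS b0 b0 0).
have L2 : coh (bcompm (associator_r _ _ _) (compare_r Q S G S) b0 a 0 y) y2.
  have -> : y2 = associator_r QS QG QS b0 a 0 (tg (addr0 0) (tg (addr0 0) s e : btens QS QG a a 0) s).
    by apply/esym; rewrite /= asr_tg (as2_tg _ _ _ (addr0 0) (addr0 0)).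
  apply: (cmor_coh (associator_r QS QG QS b0 a)).
  have -> : compare_r Q S G S b0 a 0 y =
      tg (addr0 0) (res_mor (Q A A) (dcomp Q G S) a a 0 ri) rs by exact: tm_tg.
  apply: coh_tg => //; first exact: cmor_cyc.
  by apply: cyc_tg.
(* The formal inverse in the associator is evaluated by naming its value: [compare_l] sends s (x) e'
   to a class equal to that of [y2], because e' lifts e (x) s to the resolution. *)
pose y3 : dcomp Q (dcomp Q S G) S b0 a 0 := tg (addr0 0) s e'.
have cy3 : cyc y3 by apply: cyc_tg.
have L3 : crel (dassociator_inv w) y y3.
  apply: (crel_comp (crel_of _ cy)); apply: (crel_coh (crel_inv w cy3)); last exact: coh_refl.
  have -> : compare_l Q S G S b0 a 0 y3 =
      tg (addr0 0) s (res_mor (Q B B) (dcomp Q S G) b0 b0 0 e') by exact: tm_tg.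
  apply: coh_trans (coh_sym L2).
  by apply: coh_tg => //; [apply: cmor_cyc|apply: coh_refl].
pose re := res_map (Q B B) eps b0 b0 0 e'.
have reE : coh (res_mor (Q B B) (diag B) b0 b0 0 re) c.
  by apply: res_map_crel => //; apply: crel_coh epsc (coh_sym ee') (coh_refl _).
have cre : cyc re by apply: cmor_cyc.
pose y4 : dcomp Q (diag B) S b0 a 0 := tg (addr0 0) rs re.
have cy4 : cyc y4 by apply: cyc_tg.
have L4 : crel (dhcomp Q eps (Dof (bid S))) y3 y4.
  apply: (crel_coh (crel_of _ cy3)); first exact: coh_refl.
  by rewrite /= tm_tg; apply: coh_refl.
have L5 : crel (dleft_unitor Q S) y4 (bra (addr0 0) (rS b0 a 0 s) c).
  apply: (crel_coh (crel_of _ cy4)); first exact: coh_refl.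
  rewrite /= tm_tg lun_tg; apply: coh_bra => //; try exact: cmor_cyc.
  exact: cmor_coh.
have L : crel (Dcomp (dleft_unitor Q S) (Dcomp (dhcomp Q eps (Dof (bid S)))
    (Dcomp (dassociator_inv w) (dhcomp Q (Dof (bid S)) eta)))) w0 (bra (addr0 0) (rS b0 a 0 s) c).
  exact: crel_comp (crel_comp (crel_comp L1 L3) L4) L5.
exact: crel_fun (crel_deq tri L) R0.
Qed.

(** The other triangle, followed from x (x) i: it passes through x (x) (s (x) e), then (x (x) s) (x)
    e, then c (x) e, and ends at c e, whereas the left unitor gives x. *)
Lemma triangle_r_eval b n (x : QG a b n) c : triangle_r eta eps -> cyc x ->
  crel eps (tg (addr0 n) x s : dcomp Q S G b0 b n) c ->
  coh (bla (addr0 n) c e) x.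
Proof.
move=> [w tri] cx epsc; have [i ci ii] := unit_lift.
have [_ cc0] := crel_dom epsc.
have xs_c : cyc (tg (addr0 n) x s : btens QG QS b0 b n) by apply: cyc_tg.
have [e' ce' ee'] := qi_surj (res_quasi_iso (Q B B) (dcomp Q S G) b0 b) xs_c.
pose w0 : dcomp Q (diag A) G a b n := tg (addr0 n) x i.
have cw0 : cyc w0 by apply: cyc_tg.
have R0 : crel (dleft_unitor Q G) w0 (rG a b n x).
  apply: (crel_coh (crel_of _ cw0)); first exact: coh_refl.
  rewrite /= tm_tg lun_tg -{2}(bra1 (addr0 n) (rG a b n x)).
  apply: coh_bra => //; try exact: cmor_cyc.
  exact: coh_refl.
pose ri := res_map (Q A A) eta a a 0 i.
pose rx := res_map (Q B A) (Dof (bid G)) a b n x.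
have cri : cyc ri by apply: cmor_cyc.
have crx : cyc rx by apply: cmor_cyc.
have rxx : coh rx x by apply: res_map_id.
have riE : coh (res_mor (Q A A) (dcomp Q G S) a a 0 ri) (tg (addr0 0) s e).
  by apply: res_map_crel => //; apply: crel_coh eta_id (coh_sym ii) (coh_refl _).
pose y : dcomp Q (dcomp Q G S) G a b n := tg (addr0 n) rx ri.
have cy : cyc y by apply: cyc_tg.
have L1 : crel (dhcomp Q eta (Dof (bid G))) w0 y.
  apply: (crel_coh (crel_of _ cw0)); first exact: coh_refl.
  by rewrite /= tm_tg; apply: coh_refl.
pose y2 : btens (btens QG QS) QG a b n := tg (addr0 n) (tg (addr0 n) x s : btens QG QS b0 b n) e.
have L2 : coh (bcompm (associator_l _ _ _) (compare_l Q G S G) a b n y) y2.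
  have -> : y2 = associator_l QG QS QG a b n (tg (addr0 n) x (tg (addr0 0) s e : btens QS QG a a 0)).
    by apply/esym; rewrite /= asl_tg (as1_tg _ _ _ (addr0 n) (addr0 n)).
  apply: (cmor_coh (associator_l QG QS QG a b)).
  have -> : compare_l Q G S G a b n y =
      tg (addr0 n) rx (res_mor (Q A A) (dcomp Q G S) a a 0 ri) by exact: tm_tg.
  by apply: coh_tg => //; apply: cmor_cyc.
pose y3 : dcomp Q G (dcomp Q S G) a b n := tg (addr0 n) e' e.
have cy3 : cyc y3 by apply: cyc_tg.
have L3 : crel (dassociator w) y y3.
  apply: (crel_comp (crel_of _ cy)); apply: (crel_coh (crel_inv w cy3)); last exact: coh_refl.
  have -> : compare_r Q G S G a b n y3 =
      tg (addr0 n) (res_mor (Q B B) (dcomp Q S G) b0 b n e') e by exact: tm_tg.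
  apply: coh_trans (coh_sym L2).
  by apply: coh_tg => //; [apply: cmor_cyc|apply: coh_refl].
pose re := res_map (Q B B) eps b0 b n e'.
pose r1 := res_map (Q B A) (Dof (bid G)) a b0 0 e.
have reE : coh (res_mor (Q B B) (diag B) b0 b n re) c.
  by apply: res_map_crel => //; apply: crel_coh epsc (coh_sym ee') (coh_refl _).
have cre : cyc re by apply: cmor_cyc.
have cr1 : cyc r1 by apply: cmor_cyc.
have r1E : coh r1 e by apply: res_map_id.
pose y4 : dcomp Q G (diag B) a b n := tg (addr0 n) re r1.
have cy4 : cyc y4 by apply: cyc_tg.
have L4 : crel (dhcomp Q (Dof (bid G)) eps) y3 y4.
  apply: (crel_coh (crel_of _ cy3)); first exact: coh_refl.
  by rewrite /= tm_tg; apply: coh_refl.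
have L5 : crel (dright_unitor Q G) y4 (rG a b n (bla (addr0 n) c e)).
  apply: (crel_coh (crel_of _ cy4)); first exact: coh_refl.
  rewrite /= tm_tg run_tg bmor_la; apply: coh_bla => //; try exact: cmor_cyc.
  exact: cmor_coh.
have L : crel (Dcomp (dright_unitor Q G) (Dcomp (dhcomp Q (Dof (bid G)) eps)
    (Dcomp (dassociator w) (dhcomp Q eta (Dof (bid G)))))) w0 (rG a b n (bla (addr0 n) c e)).
  exact: crel_comp (crel_comp (crel_comp L1 L3) L4) L5.
have := crel_fun (crel_deq tri L) R0.
by apply: (qi_coh (res_quasi_iso (Q B A) G a b)) => //; apply: cyc_bla.
Qed.
End Forward.

Section LeftQuasiRepr.
Variables (k : comPzRingType) (A B : dgcat k) (hA : hproj_cat A).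
Variables (Q : forall X Y : dgcat k, bimod_resolution X Y).
Variables (S : bimod A B) (G : bimod B A).

Lemma left_quasi_repr_of_adjoint :
  quasi_functor S -> left_adjoint Q S G -> left_quasi_repr G.
Proof.
move=> qS [eta [eps [tl tr]]] a.
have [b0 /quasi_isomorphic_generated gS] := qS a.
have qr : rquasi_iso (bmor_right (res_mor (Q A B) S) a) by move=> b; apply: res_quasi_iso.
have [s [cs qs]] := proj2 (generated_qi b0 qr) gS.
have hs : hrep s by apply: hproj_hrep_right qs => //; apply: res_hproj.
have [y etay] := crel_tot eta (dgid_cyc a).
have [e ce ey] := tens_right_elt hs (proj2 (crel_dom etay)).
have eta_id : crel eta (dgid a) (tg (addr0 0) s e : dcomp Q G S a a 0).
  rewrite (int_irr (addr0 0) (add0r 0)).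
  by apply: crel_coh etay (coh_refl _) (coh_sym ey).
exists b0; apply/quasi_isomorphic_generated.
have ql : rquasi_iso (bmor_left (res_mor (Q B A) G) a) by move=> b; apply: res_quasi_iso.
apply/(generated_qi (b0 : op B) ql).
have ce' : cyc (e : bm_left (Q B A G) a (b0 : op B) 0) by [].
exists e, ce'; suff H (b : B) : cquasi_iso (rmul ce' b) by exact: H.
have ces : cyc (tg (addr0 0) e s : dcomp Q S G b0 b0 0) by apply: cyc_tg.
have [c epsc] := crel_tot eps ces; have [_ cc0] := crel_dom epsc.
(* The left triangle gives s c = s on cohomology, and multiplication by s is injective there because
   s generates QS(-, a). *)
have c1 : coh c (dgid b0).
  have := triangle_l_eval cs ce eta_id tl epsc.
  rewrite -{2}(bra1 (addr0 0) (res_mor (Q A B) S b0 a 0 s)) -!bmor_ra.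
  move/(qi_coh (res_quasi_iso (Q A B) S b0 a)) => /(_ (cyc_bra _ cs cc0)).
  move=> /(_ (cyc_bra _ cs (dgid_cyc b0))).
  rewrite (int_irr (addr0 0) (add0r 0)) => h.
  by apply: (qi_coh (qs b0)) => //; apply: dgid_cyc.
have rE n (f : hom b0 b n) : rmul ce' b n f = bla (addr0 n) f e.
  by rewrite /= mul0r scale1r; congr (bla _ _ _); apply: int_irr.
(* The counit sends (f e) (x) s = f (e (x) s) to f c, hence to the class of f; if f e is a
   coboundary, this class vanishes. *)
have inj n (f : hom (d := B) b0 b n) : cyc f -> bd (bla (addr0 n) f e) -> bd f.
  move=> cf fe.
  have h1 : crel eps (bla (addr0 n) f (tg (addr0 0) e s : dcomp Q S G b0 b0 0)) (dgc (addr0 n) f c).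
    exact: (crel_la (addr0 n) cf epsc).
  (* That the counit relates 0 to 0 is obtained from its linearity, by acting with the zero morphism
     on e (x) s. *)
  have h0 : crel eps (0 : dcomp Q S G b0 b n) (0 : diag B b0 b n).
    have := crel_la (addr0 n) (@cyc0 _ (hom b0 b) n) epsc.
    by rewrite !bla0l.
  have h2 : coh (bla (addr0 n) f (tg (addr0 0) e s : dcomp Q S G b0 b0 0)) 0.
    rewrite [bla _ _ _](tla_tg (addr0 n) f (addr0 0) (addr0 n) (addr0 n)).
    have <- : tg (addr0 n) (0 : Q B A G a b n) s = (0 : dcomp Q S G b0 b n) by exact: tg0l.
    apply: coh_tg => //; [exact: cyc_bla|exact: cyc0| |exact: coh_refl].
    exact/coh0.
  have := crel_fun (crel_coh h1 h2 (coh_refl _)) h0 => /coh0 h3.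
  apply: coh_bd h3; rewrite -{2}(dgc1r (addr0 n) f).
  apply: (coh_bla (T := diag B)) => //; exact: coh_refl.
apply/cquasi_isoP => n; split=> [f cf|x cx].
  by rewrite rE; apply: inj.
have [y0 epsy] := crel_tot eps (cyc_tg (addr0 n) cx cs).
exists y0; first exact: (proj2 (crel_dom epsy)).
by rewrite rE; apply: (triangle_r_eval cs ce eta_id tr cx epsy).
Qed.
End LeftQuasiRepr.

(** * The left adjoint of a left quasi-representable quasi-functor *)

Section LrepMul.
Variables (k : comPzRingType) (A B : dgcat k) (P : bimod B A) (a : A) (b0 : B) (u : P a b0 0).
Variable cu : cyc u.
Fact lmul_linear b n : linear (fun f : hom b0 b n => bla (addr0 n) f u).
Proof. by move=> t f g; rewrite blaDl blaZl. Qed.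
Fact lmul_d b (n m : int) (e : n + 1 = m) (f : hom b0 b n) :
  bla (addr0 m) (cxd _ e f) u = cxd (P a b) e (bla (addr0 n) f u).
Proof.
have i : n + 1 = m by [].
by rewrite (bla_d (addr0 n) e (add0r 1) e (addr0 m) i) cu bla0r scaler0 addr0.
Qed.
Definition lmul b : cmor (hom b0 b) (P a b) := cmor_of (@lmul_linear b) (@lmul_d b).
Lemma lmul_qi b : lrep u -> cquasi_iso (lmul b).
Proof.
move=> [_ [g [h [v [hg hl hd hv]]]]]; apply: (qi_id (g := g b)) => n x cx.
  rewrite /= hg -{2}(dgc1r (addr0 n) x).
  apply: (coh_bla (T := diag B)) => //; first exact: cmor_cyc.
    exact: coh_refl.
  by exists (-1), (addNr 1), v.
rewrite /coh /= (hd b n _ _ (subrK 1 n) (erefl _)) cx linear0 addr0.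
exact: bd_d.
Qed.
End LrepMul.

Section Reverse.
Variables (k : comPzRingType) (A B : dgcat k) (hA : hproj_cat A).
Variables (Q : forall X Y : dgcat k, bimod_resolution X Y) (G : bimod B A).
Hypothesis qG : left_quasi_repr G.

Notation QG := (Q B A G).
Definition left_dual : bimod A B := LHom QG (diag B).
Notation S := left_dual.
Notation QS := (Q A B S).
Notation rS := (res_mor (Q A B) S).

Lemma left_rep a : exists (b0 : B) (e : QG a b0 0), lrep e.
Proof.
have [b0 /quasi_isomorphic_generated gG] := qG a.
have ql : rquasi_iso (bmor_left (res_mor (Q B A) G) a) by move=> b; apply: res_quasi_iso.
have [e [ce qe]] := proj2 (generated_qi b0 ql) gG.
exists b0, e; apply: hrep_lrep; apply: hproj_hrep_left qe => //.
exact: res_hproj.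
Qed.

(** The generator is the homotopy inverse g from QG(a, -) to B(b0, -), seen as an element of S(b0,
    a). Its Yoneda map sends f to z |-> g(z) f, which is [rep_mul]. *)
Lemma left_dual_generated a (b0 : B) (e : QG a b0 0) : lrep e -> generated (bm_right S a) b0.
Proof.
move=> [ce [g [h [v [hg hl hd hv]]]]].
pose be : bm_right S a b0 0 := rep_mul (diag B) b0 hg 0 (dgid b0).
have cbe : cyc be by apply: cmor_cyc; apply: dgid_cyc.
exists be, cbe => b.
apply: (qi_comp (f := cid_mor _) (g := rep_mul (diag B) b hg)); last 1 first.
- exact: (mul_qi (diag B) ce b hg hl hd hv).
- move=> n f _; rewrite (_ : rmul cbe b n f = rep_mul (diag B) b hg n f); first exact: coh_refl.
  apply: gmap_ext => b' p q i z; rewrite /= /mul_raw.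
  rewrite [LHS](LHom_raE (add0r n) be f i (addr0 p) i).
  change (dgc i (dgc (addr0 p) (g b' p z) (dgid b0)) f = dgc i (g b' p z) f).
  by rewrite dgc1r.
- by apply: (qi_id (g := cid_mor _)) => *; apply: coh_refl.
Qed.

Lemma left_dual_quasi_functor : quasi_functor S.
Proof.
move=> a; have [b0 [e he]] := left_rep a.
by exists b0; apply/quasi_isomorphic_generated; apply: left_dual_generated he.
Qed.

Lemma left_dual_hrep a : exists (b0 : B) (s : QS b0 a 0), hrep (M := bm_right QS a) s.
Proof.
have [b0 [e he]] := left_rep a; exists b0.
have qr : rquasi_iso (bmor_right rS a) by move=> b; apply: res_quasi_iso.
have [s [cs qs]] := proj2 (generated_qi b0 qr) (left_dual_generated he).
by exists s; apply: hproj_hrep_right qs => //; apply: res_hproj.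
Qed.

Lemma compare_l_qi : bquasi_iso (compare_l Q S G S).
Proof.
move=> b a; have [b0 [s hs]] := left_dual_hrep a.
by apply: tens_right_qi hs _; apply: res_quasi_iso.
Qed.
Lemma compare_r_qi : bquasi_iso (compare_r Q G S G).
Proof.
move=> a b; have [b0 [e he]] := left_rep a.
by apply: tens_left_qi he _; apply: res_quasi_iso.
Qed.

Definition counit0 : bmor (dcomp Q S G) (diag B) :=
  bcompm (lev QG (diag B)) (btens_map (bid QG) rS).
Definition coev : bmor (dcomp Q G S) (LHom QG QG) :=
  bcompm (ldual QG QG) (btens_map rS (bid QG)).

(** With e and e1 representing QG(a, -) and QG(a', -), the composite of x |-> x (x) e1, [coev] and
    evaluation at e sends x to x(e) e1. That is a resolution, an evaluation and a multiplication in
    turn, all quasi-isomorphisms; two out of three, used twice, isolates [coev]. *)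
Lemma coev_qi : bquasi_iso coev.
Proof.
move=> a' a; have [b0 [e he]] := left_rep a; have [b1 [e1 he1]] := left_rep a'.
have [ce [g [h [v [hg hl hd hv]]]]] := he; have [ce1 [g1 [h1 [v1 [hg1 hl1 hd1 hv1]]]]] := he1.
pose inn : cmor (QS b1 a) (dcomp Q G S a' a) := tl_in ce1 QS a.
have q_in : cquasi_iso inn by apply: (tl_in_qi ce1 hg1 hl1 hd1 hv1 QS a).
have q_ev : cquasi_iso (ev_at QG ce a') by apply: (ev_at_qi _ ce _ hg hl hd hv).
have q_ev1 : cquasi_iso (ev_at (diag B) ce b1) by apply: (ev_at_qi _ ce _ hg hl hd hv).
have q_mul : cquasi_iso (lmul ce1 b0) by apply: lmul_qi.
have q_1 : cquasi_iso (ccomp_mor (ev_at (diag B) ce b1) (rS b1 a)).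
  apply: (qi_comp (f := rS b1 a) (g := ev_at (diag B) ce b1)) => //.
    by move=> n x _; apply: coh_refl.
  exact: res_quasi_iso.
have q_2 : cquasi_iso (ccomp_mor (lmul ce1 b0) (ccomp_mor (ev_at (diag B) ce b1) (rS b1 a))).
  by apply: (qi_comp _ q_1 q_mul) => n x _; apply: coh_refl.
have q_3 : cquasi_iso (ccomp_mor (coev a' a) inn).
  apply: (qi_cancel_g _ q_ev q_2) => n x _.
  have -> : ccomp_mor (coev a' a) inn n x = ldual_elt (addr0 n) (rS b1 a n x) e1.
    rewrite /= -[tg _ _ _]/(tg (addr0 n) x e1) tm_tg; exact: ldual_tg.
  rewrite /= [X in coh _ X](ldual_eltE _ _ _ (add0r n) (add0r n) (addr0 n)).
  exact: coh_refl.
by apply: (qi_cancel_f _ q_in q_3) => n x _; apply: coh_refl.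
Qed.

Definition adj_unit : dmor (diag A) (dcomp Q G S) :=
  Dcomp (Dinv coev_qi) (Dof (lhom_unit QG)).
Definition adj_counit : dmor (dcomp Q S G) (diag B) := Dof counit0.

(** * The triangular identities for the left dual *)

Notation rG := (res_mor (Q B A) G).
Notation rdA := (res_mor (Q A A) (diag A)).
Notation reta := (res_map (Q A A) adj_unit).

(** Following the unit by [coev] removes the formal inverse it contains, so h-projectivity of the
    resolved diagonal makes the identity a homotopy. *)
Lemma coev_unit : bhomotopic (bcompm coev (bcompm (res_mor (Q A A) _) reta))
  (bcompm (lhom_unit QG) rdA).
Proof.
apply: res_map_hproj; first exact: res_hproj.
apply: deq_trans (deq_Dcomp (deq_refl _) (deq_sym (deq_assoc _ _ _))) _.
apply: deq_trans (deq_assoc _ _ _) _.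
apply: deq_trans (deq_Dcomp (deq_inv_r coev_qi) (deq_refl _)) _.
by apply: deq_trans (deq_id_l _) _; apply/deq_sym/deq_Dof_comp.
Qed.

Lemma res_id_S : bhomotopic (bcompm rS (res_map (Q A B) (Dof (bid S)))) rS.
Proof. by apply: bh_trans (res_map_of _ _) _; apply: bh_ext. Qed.
Lemma res_id_G : bhomotopic (bcompm rG (res_map (Q B A) (Dof (bid G)))) rG.
Proof. by apply: bh_trans (res_map_of _ _) _; apply: bh_ext. Qed.

Lemma counit_tg b a c (p q n : int) (e : p + q = n) (z : QG a b p) (x : QS c a q) :
  counit0 c b n (tg e z x) = (rS c a q x : S c a q) b p n e z.
Proof.
apply: (etrans (congr1 (lev QG (diag B) c b n) (tm_tg (bid QG) rS e z x))).
exact: lev_tg.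
Qed.
Lemma coev_tg a b a' (p q n : int) (e : p + q = n) (x : QS b a p) (y : QG a' b q) :
  coev a' a n (tg e x y) = ldual_elt e (rS b a p x) y.
Proof.
apply: (etrans (congr1 (ldual QG QG a' a n) (tm_tg rS (bid QG) e x y))).
exact: ldual_tg.
Qed.

(** On (x (x) y) (x) x', with x and x' read as maps, the left side is z |-> x(z) x'(y) and the right
    side z |-> x'(x(z) y). They agree because x' is left linear. *)
Lemma counit_coev_l b a n (w : btens (btens QS QG) QS b a n) :
  left_unitor S b a n (btens_map rS counit0 b a n (associator_r QS QG QS b a n w)) =
  lcomp QG (diag B) b a n (btens_map coev rS b a n w).
Proof.
pose f1 := lin_of (linear_comp (left_unitor S b a n)
  (lin_of (linear_comp (btens_map rS counit0 b a n) (associator_r QS QG QS b a n)))).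
pose f2 := lin_of (linear_comp (lcomp QG (diag B) b a n) (btens_map coev rS b a n)).
apply: (tens_ext (f := f1) (g := f2)) => {w} a' p q e w x'.
pose g1 := lin_of (linear_comp f1 (lin_of ((tg_bilin (btens QS QG) QS a b a' e).2 x'))).
pose g2 := lin_of (linear_comp f2 (lin_of ((tg_bilin (btens QS QG) QS a b a' e).2 x'))).
apply: (tens_ext (f := g1) (g := g2)) => {w} b1 r s i x y.
have l : r + (s + q) = n by lia.
change (left_unitor S b a n (btens_map rS counit0 b a n
    (associator_r QS QG QS b a n (tg e (tg i x y : btens QS QG a' a p) x'))) =
  lcomp QG (diag B) b a n (btens_map coev rS b a n (tg e (tg i x y : btens QS QG a' a p) x'))).
have -> : associator_r QS QG QS b a n (tg e (tg i x y : btens QS QG a' a p) x') =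
    tg l x (tg (erefl _) y x' : btens QG QS b b1 (s + q)).
  by apply: (etrans (asr_tg e _ x')); apply: as2_tg.
have -> : btens_map rS counit0 b a n (tg l x (tg (erefl _) y x' : btens QG QS b b1 (s + q))) =
    tg l (rS b1 a r x) (counit0 b b1 (s + q) (tg (erefl _) y x')) by exact: tm_tg.
have -> : btens_map coev rS b a n (tg e (tg i x y : btens QS QG a' a p) x') =
    tg e (coev a' a p (tg i x y)) (rS b a' q x') by exact: tm_tg.
rewrite counit_tg coev_tg lcomp_tg.
apply: (etrans (lun_tg l _ _)); apply: gmap_ext => b' t t' j z.
have l1 : t + r + (s + q) = t' by lia.
have l2 : t + p + q = t' by lia.
have l3 : t + r + s = t + p by lia.
rewrite (LHom_raE l _ _ j (erefl _) l1) (lcomp_eltE _ _ _ j (erefl _) l2).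
by rewrite (ldual_eltE _ _ _ _ (erefl _) l3) (LHom_lin _ l3 l2 (erefl _) l1).
Qed.

(** On z (x) (x (x) y), with x read as a map, both sides are the image of x(z) y in G. *)
Lemma counit_coev_r a b n (w : btens QG (btens QS QG) a b n) :
  right_unitor G a b n (btens_map counit0 rG a b n (associator_l QG QS QG a b n w)) =
  rG a b n (lev QG QG a b n (btens_map (bid QG) coev a b n w)).
Proof.
pose f1 := lin_of (linear_comp (right_unitor G a b n)
  (lin_of (linear_comp (btens_map counit0 rG a b n) (associator_l QG QS QG a b n)))).
pose f2 := lin_of (linear_comp (rG a b n)
  (lin_of (linear_comp (lev QG QG a b n) (btens_map (bid QG) coev a b n)))).
apply: (tens_ext (f := f1) (g := f2)) => {w} a' p q e z w.
pose g1 := lin_of (linear_comp f1 (lin_of ((tg_bilin QG (btens QS QG) b a a' e).1 z))).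
pose g2 := lin_of (linear_comp f2 (lin_of ((tg_bilin QG (btens QS QG) b a a' e).1 z))).
apply: (tens_ext (f := g1) (g := g2)) => {w} b1 r s i x y.
have l : p + r + s = n by lia.
change (right_unitor G a b n (btens_map counit0 rG a b n
    (associator_l QG QS QG a b n (tg e z (tg i x y : btens QS QG a a' q)))) =
  rG a b n (lev QG QG a b n (btens_map (bid QG) coev a b n (tg e z (tg i x y : btens QS QG a a' q))))).
have -> : associator_l QG QS QG a b n (tg e z (tg i x y : btens QS QG a a' q)) =
    tg l (tg (erefl _) z x : btens QG QS b1 b (p + r)) y.
  by apply: (etrans (asl_tg e z _)); apply: as1_tg.
have -> : btens_map counit0 rG a b n (tg l (tg (erefl _) z x : btens QG QS b1 b (p + r)) y) =
    tg l (counit0 b1 b (p + r) (tg (erefl _) z x)) (rG a b1 s y) by exact: tm_tg.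
have -> : btens_map (bid QG) coev a b n (tg e z (tg i x y : btens QS QG a a' q)) =
    tg e z (coev a a' q (tg i x y)) by exact: tm_tg.
rewrite counit_tg coev_tg lev_tg (ldual_eltE _ _ _ e (erefl _) l) bmor_la.
exact: run_tg.
Qed.

Lemma lcomp_unit b a n (w : btens (diag A) S b a n) :
  lcomp QG (diag B) b a n (btens_map (lhom_unit QG) (bid S) b a n w) = right_unitor S b a n w.
Proof.
pose f1 := lin_of (linear_comp (lcomp QG (diag B) b a n) (btens_map (lhom_unit QG) (bid S) b a n)).
apply: (tens_ext (f := f1) (g := right_unitor S b a n)) => {w} a' p q e f x.
change (lcomp QG (diag B) b a n (btens_map (lhom_unit QG) (bid S) b a n (tg e f x)) =
  right_unitor S b a n (tg e f x)).
have -> : btens_map (lhom_unit QG) (bid S) b a n (tg e f x) =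
    tg e (lhom_unit QG a' a p f) x by exact: tm_tg.
rewrite lcomp_tg; apply: etrans (esym (run_tg e f x)); apply: gmap_ext => b' s t i z.
have l : s + p + q = t by lia.
by rewrite (lcomp_eltE _ _ _ i (erefl _) l) (LHom_laE e f x i (erefl _) l).
Qed.

Lemma lev_unit a b n (w : btens QG (Q A A (diag A)) a b n) :
  rG a b n (lev QG QG a b n (btens_map (bid QG) (bcompm (lhom_unit QG) rdA) a b n w)) =
  left_unitor G a b n (btens_map rG rdA a b n w).
Proof.
pose f1 := lin_of (linear_comp (rG a b n) (lin_of (linear_comp (lev QG QG a b n)
  (btens_map (bid QG) (bcompm (lhom_unit QG) rdA) a b n)))).
pose f2 := lin_of (linear_comp (left_unitor G a b n) (btens_map rG rdA a b n)).
apply: (tens_ext (f := f1) (g := f2)) => {w} a' p q e z f.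
change (rG a b n (lev QG QG a b n (btens_map (bid QG) (bcompm (lhom_unit QG) rdA) a b n (tg e z f))) =
  left_unitor G a b n (btens_map rG rdA a b n (tg e z f))).
have -> : btens_map (bid QG) (bcompm (lhom_unit QG) rdA) a b n (tg e z f) =
    tg e z (lhom_unit QG a a' q (rdA a a' q f)) by exact: tm_tg.
have -> : btens_map rG rdA a b n (tg e z f) = tg e (rG a' b p z) (rdA a a' q f) by exact: tm_tg.
rewrite lev_tg; apply: etrans (esym (lun_tg e _ _)); exact: bmor_ra.
Qed.

Lemma counit_res : bhomotopic
  (bcompm (res_mor (Q B B) (diag B)) (res_map (Q B B) adj_counit))
  (bcompm counit0 (res_mor (Q B B) (dcomp Q S G))).
Proof. exact: res_map_of. Qed.

Lemma adj_triangle_l : triangle_l adj_unit adj_counit.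
Proof.
exists compare_l_qi.
(* The map that factors the tail through [compare_l] is the same tail with the counit applied
   directly to QG (x)_B QS, before its resolution is inserted. *)
apply: (@deq_cancel _ _ _ _ _ _ _ _ _ _ _ _ _ _ _ (bcompm (left_unitor S) (btens_map rS counit0))).
  pose mid := btens_map rS (bcompm counit0 (res_mor (Q B B) (dcomp Q S G))).
  apply: (bh_trans (g := bcompm (left_unitor S) mid)).
    apply: bh_trans (bh_compl (left_unitor S) (bh_btens_comp res_id_S counit_res)).
    exact: bh_ext.
  have h : bhomotopic (bcompm rS (bid QS)) rS by exact: bh_ext.
  apply: bh_sym; apply: bh_trans (bh_compl (left_unitor S) (bh_btens_comp h (bh_refl _))).
  exact: bh_ext.
(* For the second homotopy, [counit_coev_l] trades associator and counit for [coev] followed by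
   composition. Then [coev_unit] replaces the unit by the action of A, and composing with this
   action is the right unitor. *)
pose r1 := res_map (Q A B) (Dof (bid S)).
pose r2 := bcompm (res_mor (Q A A) (dcomp Q G S)) reta.
have h1 : bhomotopic (bcompm (compare_r Q S G S) (btens_map reta r1)) (btens_map r2 r1).
  by apply: bh_btens_comp; apply: bh_ext.
have h2 := bh_btens_comp coev_unit res_id_S.
have h3 : bhomotopic (bcompm (btens_map (lhom_unit QG) (bid S)) (btens_map rdA rS))
    (btens_map (bcompm (lhom_unit QG) rdA) rS).
  by apply: bh_btens_comp; apply: bh_ext.
have h4 := bh_compl (lcomp QG (diag B)) (bh_trans (bh_trans (bh_compl (btens_map coev rS) h1) h2)
  (bh_sym h3)).
apply: (bh_trans (g := bcompm (lcomp QG (diag B)) (bcompm (btens_map coev rS)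
    (bcompm (compare_r Q S G S) (btens_map reta r1))))).
  by apply: bh_ext => b a n x; apply: counit_coev_l.
by apply: bh_trans h4 _; apply: bh_ext => b a n x; apply: lcomp_unit.
Qed.

Lemma adj_triangle_r : triangle_r adj_unit adj_counit.
Proof.
exists compare_r_qi.
apply: (@deq_cancel _ _ _ _ _ _ _ _ _ _ _ _ _ _ _ (bcompm (right_unitor G) (btens_map counit0 rG))).
  pose mid := btens_map (bcompm counit0 (res_mor (Q B B) (dcomp Q S G))) rG.
  apply: (bh_trans (g := bcompm (right_unitor G) mid)).
    apply: bh_trans (bh_compl (right_unitor G) (bh_btens_comp counit_res res_id_G)).
    exact: bh_ext.
  have h : bhomotopic (bcompm rG (bid QG)) rG by exact: bh_ext.
  apply: bh_sym; apply: bh_trans (bh_compl (right_unitor G) (bh_btens_comp (bh_refl _) h)).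
  exact: bh_ext.
(* As for the other triangle, with evaluation on QG in place of composition: once [coev] has
   absorbed the unit, evaluating the action of A is the left unitor. *)
pose r1 := res_map (Q B A) (Dof (bid G)).
pose r2 := bcompm (res_mor (Q A A) (dcomp Q G S)) reta.
have h1 : bhomotopic (bcompm (compare_l Q G S G) (btens_map r1 reta)) (btens_map (bid QG) r2).
  apply: bh_btens_comp; last exact: bh_refl.
  by apply: bh_trans (res_map_bid _ _); apply: bh_ext.
have h0 : bhomotopic (bcompm (bid QG) (bid QG)) (bid QG) by exact: bh_ext.
have h2 := bh_btens_comp h0 coev_unit.
have h4 := bh_compl (bcompm rG (lev QG QG)) (bh_trans (bh_compl (btens_map (bid QG) coev) h1) h2).
apply: (bh_trans (g := bcompm (bcompm rG (lev QG QG)) (bcompm (btens_map (bid QG) coev)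
    (bcompm (compare_l Q G S G) (btens_map r1 reta))))).
  by apply: bh_ext => a b n x; apply: counit_coev_r.
by apply: bh_trans h4 _; apply: bh_ext => a b n x; apply: lev_unit.
Qed.

Lemma left_dual_left_adjoint : left_adjoint Q S G.
Proof. exists adj_unit, adj_counit; exact: (conj adj_triangle_l adj_triangle_r). Qed.
End Reverse.

Theorem theorem1p2 (k : comPzRingType) (A B : dgcat k)
    (A' : hp_resolution A) (B' : hp_resolution B)
    (Q : forall X Y : dgcat k, bimod_resolution X Y)
    (G : bimod B' A') (hG : quasi_functor G) :
  (exists S : bimod A' B', quasi_functor S /\ left_adjoint Q S G) <->
  left_quasi_repr G.
Proof.
have hA : hproj_cat A' by exact: hp_hproj.
split=> [[S [qS SG]]|qG]; first by exact (left_quasi_repr_of_adjoint hA qS SG).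
exists (left_dual Q G); split; first exact: left_dual_quasi_functor.
exact: left_dual_left_adjoint.
Qed.
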